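(* Let $s\ge1$ be a fixed integer (not depending on $p$) and $A=\sqrt{2\log p/n}$. Assume either $\mathbf X\in\mathrm{SubG}(\sigma^2)$ with $n/(p(\log p)^2)\to\infty$, or $\mathbf X\in\mathcal O_n(p)$ with $n\ge p$. Then $\mathrm{Risk}(s,A)\to(1/2)^s$ as $p\to\infty$.
   Context: Setting: for each $p$ one observes $(\mathbf y,\mathbf X)$ with $\mathbf y=\mathbf X\boldsymbol\beta+\boldsymbol\varepsilon$, where $\boldsymbol\varepsilon\sim\mathcal N(0,I_n)$, $\mathbf X$ is an $n\times p$ real matrix independent of $\boldsymbol\varepsilon$, $\boldsymbol\beta\in\mathbb R^p$ is unknown, and $n=n(p)\to\infty$ as $p\to\infty$. Design classes: $\mathbf X\in\mathrm{SubG}(\sigma^2)$ means the rows of $\mathbf X$ are i.i.d. centered isotropic ($\mathbb E[xx^T]=I_p$) sub-Gaussian random vectors with sub-Gaussian parameter $\sigma^2$ (for every unit $u$ and $t\in\mathbb R$, $\log\mathbb E e^{t\langle u,x\rangle}\le\sigma^2t^2/2$), and $\mathbf X^T\mathbf X$ is almost surely positive definite; $\mathbf X\in\mathcal O_n(p)$ means $\mathbf X^T\mathbf X=nI_p$. For an integer $s$ and $A>0$, $\Xi(s,A)=\{\boldsymbol\beta\in\mathbb R^p:|\mathrm{supp}(\boldsymbol\beta)|=s,\ |\beta_i|\ge A\text{ for }i\in\mathrm{supp}(\boldsymbol\beta)\}$. A test $T$ is a measurable $[0,1]$-valued function of $(\mathbf y,\mathbf X)$; $\mathbb P_{\boldsymbol\beta},\mathbb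 E_{\boldsymbol\beta}$ denote the law/expectation of $(\mathbf y,\mathbf X)$ (including the randomness of $\mathbf X$) under parameter $\boldsymbol\beta$, and $\mathbb P_0,\mathbb E_0$ those under $\boldsymbol\beta=0$. $\mathrm{Risk}(T,s,A)=\mathbb E_0[T]+\sup_{\boldsymbol\beta\in\Xi(s,A)}\mathbb E_{\boldsymbol\beta}[1-T]$ and $\mathrm{Risk}(s,A)=\inf_T\mathrm{Risk}(T,s,A)$. *)

(* Defs.v *)
From HB Require Import structures.
From mathcomp Require Import all_boot all_order all_algebra.
From mathcomp Require Import all_classical all_reals all_analysis.
Set Implicit Arguments. Unset Strict Implicit. Unset Printing Implicit Defensive.
Import Order.TTheory GRing.Theory Num.Theory.
Import numFieldNormedType.Exports.
Local Open Scope classical_set_scope.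
Local Open Scope ring_scope.

Definition borel (T : topologicalType) : set (set T) := <<s open >>.

Section Model.
Context {R : realType} {d : measure_display} (Omega : measurableType d)
  (P : probability Omega R) (n p : nat).

Definition random_matrix (X : Omega -> 'M[R]_(n, p)) : Prop :=
  forall C : set 'M[R]_(n, p), borel C -> measurable (X @^-1` C).

Definition std_gaussian_indep (X : Omega -> 'M[R]_(n, p))
    (eps : Omega -> 'cV[R]_n) : Prop :=
  (forall i, measurable_fun setT (fun w => eps w i ord0)) /\
  forall (C : set 'M[R]_(n, p)) (B : 'I_n -> set R),
    borel C -> (forall i, measurable (B i)) ->
    P [set w | C (X w) /\ forall i, B i (eps w i ord0)] =
    (P (X @^-1` C) * \prod_(i < n) normal_prob 0 1 (B i))%E.

Definition rows_iid (X : Omega -> 'M[R]_(n, p)) : Prop :=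
  (forall (i j : 'I_n) (C : set 'rV[R]_p), borel C ->
     P [set w | C (row i (X w))] = P [set w | C (row j (X w))]) /\
  (forall C : 'I_n -> set 'rV[R]_p, (forall i, borel (C i)) ->
     P [set w | forall i, C i (row i (X w))] =
     (\prod_(i < n) P [set w | C i (row i (X w))])%E).

Definition posdef {k : nat} (M : 'M[R]_k) : Prop :=
  forall v : 'cV[R]_k, v != 0 -> 0 < (v^T *m M *m v) ord0 ord0.

Definition SubG (sigma2 : R) (X : Omega -> 'M[R]_(n, p)) : Prop :=
  random_matrix X /\ rows_iid X /\
  (forall (i : 'I_n) (j : 'I_p), (\int[P]_w (X w i j)%:E = 0)%E) /\
  (forall (i : 'I_n) (j k : 'I_p),
      (\int[P]_w (X w i j * X w i k)%:E = (j == k)%:R%:E)%E) /\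
  (forall (i : 'I_n) (u : 'I_p -> R), \sum_(j < p) u j ^+ 2 = 1 ->
     forall t : R,
       (\int[P]_w (expR (t * \sum_(j < p) u j * X w i j))%:E
          <= (expR (sigma2 * t ^+ 2 / 2))%:E)%E) /\
  {ae P, forall w, posdef ((X w)^T *m X w)}.

Definition Orth (X : Omega -> 'M[R]_(n, p)) : Prop :=
  random_matrix X /\ forall w, (X w)^T *m X w = n%:R%:M.

Definition is_test (T : 'cV[R]_n * 'M[R]_(n, p) -> R) : Prop :=
  (forall z, 0 <= T z <= 1) /\
  (forall B : set R, measurable B -> borel (T @^-1` B)).

Definition Ebeta (X : Omega -> 'M[R]_(n, p)) (eps : Omega -> 'cV[R]_n)
    (beta : 'cV[R]_p) (f : 'cV[R]_n * 'M[R]_(n, p) -> R) : \bar R :=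
  (\int[P]_w (f (X w *m beta + eps w, X w))%:E)%E.

Definition Xi (s : nat) (A : R) : set 'cV[R]_p :=
  [set beta | #|[set i : 'I_p | beta i ord0 != 0]| = s /\
              forall i, beta i ord0 != 0 -> A <= `|beta i ord0|].

Definition RiskT X eps (T : 'cV[R]_n * 'M[R]_(n, p) -> R) (s : nat) (A : R)
  : \bar R :=
  (Ebeta X eps 0 T +
   ereal_sup [set Ebeta X eps beta (fun z => (1 - T z)%R) | beta in Xi s A])%E.

Definition Risk X eps (s : nat) (A : R) : \bar R :=
  ereal_inf [set RiskT X eps T s A | T in is_test].

End Model.

(* Main.v *)
(** Put u_j = X_j / sqrt n and a = sqrt (2 log p), so that the least amplitude is A = a / sqrt n
    and y = sum_j (sqrt n beta_j) u_j + eps.  Call X good when |<u_j, u_k> - delta_jk| <= del for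
    all j, k, where del a^2 is small.  An orthogonal design is always good; a sub-Gaussian one is
    good with probability tending to 1, by a Chernoff bound for the sums of <u, x_i>^2 - 1 and
    polarization, since p^2 exp (- c n / log^2 p) tends to 0.  Given a good X, any m of the u_j
    are close to an orthonormal family (Gram-Schmidt), so that the events <u_j, eps> <= t with t
    small have joint probability close to 2^-m.

    Upper bound.  Reject when some |<u_j, y>| is at least a + eta, with eta a small constant.  The
    false alarm probability is at most of order p exp (- (a + eta)^2 / 2) <= exp (- a eta).  A
    signal is missed only if each of its s coordinates has noise of the wrong sign, up to o(1):
    probability 2^-s + o(1).

    Lower bound.  Draw beta with one entry A in each of s blocks of coordinates.  The likelihood
    ratio, truncated to <u_j, y> <= a - eta for the j in its support, has mean 2^-s + o(1), and
    second moment 4^-s + o(1) because k common coordinates contribute O(exp (- k a eta)).  Hence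
    it is close to the constant 2^-s in L^2, and no test has risk below 2^-s - o(1). *)
Require Import Defs.
From HB Require Import structures.
From mathcomp Require Import all_boot all_order all_algebra.
From mathcomp Require Import all_classical all_reals all_analysis.
From mathcomp Require Import measurable_realfun ring lra.
Set Implicit Arguments. Unset Strict Implicit. Unset Printing Implicit Defensive.
Import Order.TTheory GRing.Theory Num.Theory.
Import numFieldNormedType.Exports.
Local Open Scope classical_set_scope.
Local Open Scope ring_scope.

(** * Borel sets of matrices and equality of laws *)

(** The threshold sits at the least amplitude itself: projected on an active direction, y is a plus
    standard noise, so the sign of the noise decides, and both bounds come down to orthant
    probabilities with threshold near 0. The margin eta is caught between two demands: small, to
    move these probabilities little, and fixed, so that exp (- a eta) tends to 0. Hence the order of
    choices: e, then eta and kap, then K with a >= K. The scale del = kap / a^2 comes from the lower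
    bound, where inner products of directions enter an exponent multiplied by a^2.

    Truncation is needed because two draws sharing k coordinates have probability of order p^-k,
    while the product of their full likelihood ratios has mean about exp (k a^2) = p^(2k);
    truncation lowers this to about p^k exp (- k a eta).

    The constants depend only on s and e (on sigma2 for the concentration), since n, p and the
    probability space all change along the limit. The Gaussian law enters through its values on
    boxes and its invariance under redrawing one coordinate, without a density on R^n. *)

Notation Borel T := (g_sigma_algebraType (@open T)).

Section BorelCoordinates.
Context {R : realType} {d : measure_display} (Om : measurableType d).

(** An open U is the union of the balls inside it with centre [q c] and radius 1 / (k + 1), a
    countable family. Deciding by [if] which balls lie in U keeps the union over a plain countable
    type. *)
Lemma open_preimage_measurable (T : pseudoMetricType R) (C : countType)
    (q : C -> T) (F : Om -> T) :
  (forall z e, 0 < e -> exists c, ball z e (q c)) ->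
  (forall c r, 0 < r -> measurable (F @^-1` ball (q c) r)) ->
  forall U : set T, open U -> measurable (F @^-1` U).
Proof.
move=> qd mF U oU.
pose I := [set ck : C * nat | ball (q ck.1) ck.2.+1%:R^-1 `<=` U].
have -> : F @^-1` U = \bigcup_(ck : C * nat)
    (if `[< I ck >] then F @^-1` ball (q ck.1) ck.2.+1%:R^-1 else set0).
  apply/seteqP; split => w /=.
    move=> Uw; have := open_nbhs_nbhs (conj oU Uw) => /nbhs_ballP[e /= e0 eU].
    pose k := Num.bound ((e / 2)^-1).
    have kI : k.+1%:R^-1 < e / 2.
      rewrite invf_plt ?posrE ?ltr0n ?divr_gt0// (lt_le_trans (archi_boundP _))//.
        by rewrite invr_ge0 ltW ?divr_gt0.
      by rewrite ler_nat.
    have [c cF] := qd (F w) k.+1%:R^-1 ltac:(by rewrite invr_gt0 ltr0n).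
    exists (c, k) => //=; case: asboolP => [_|] /=; first exact: ball_sym.
    case => z /= bz; apply: eU; apply: (@le_ball _ _ _ (k.+1%:R^-1 + k.+1%:R^-1)).
      by rewrite ltW// (lt_le_trans (ltrD kI kI))// -splitr.
    exact: ball_triangle cF bz.
  by case=> ck _; case: asboolP => // I1 /I1.
apply: countable_bigcupT_measurable => // ck.
case: asboolP => _; last exact: measurable0.
by apply: mF; rewrite invr_gt0 ltr0n.
Qed.

Lemma measurable_fun_generated (T : pointedType) (G : set (set T)) (F : Om -> T) :
  (forall U : set T, G U -> measurable (F @^-1` U)) ->
  measurable_fun setT (F : Om -> g_sigma_algebraType G).
Proof.
move=> mF; apply: (@measurability _ _ _ (g_sigma_algebraType G) _ _ G) => //.
by move=> _ [U oU <-]; rewrite setTI; exact: mF.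
Qed.

Lemma mx_rat_dense n p (z : 'M[R]_(n, p)) (e : R) : 0 < e ->
  exists c : 'M[rat]_(n, p), ball z e (map_mx ratr c).
Proof.
move=> e0.
have zq i j : exists q : rat, ratr q \in `](z i j - e), (z i j + e)[.
  by apply: rat_in_itvoo; lra.
have /choice[c cP] : forall ij : 'I_n * 'I_p, exists q : rat,
    ratr q \in `](z ij.1 ij.2 - e), (z ij.1 ij.2 + e)[ by move=> ij; exact: zq.
exists (\matrix_(i, j) c (i, j)); split => // i j.
rewrite !mxE /ball /= ltr_distlC.
by have := cP (i, j); rewrite in_itv.
Qed.

Lemma preimage_mx_ball_measurable n p (F : Om -> 'M[R]_(n, p)) :
  (forall i j, measurable_fun setT (fun w => F w i j)) ->
  forall z r, 0 < r -> measurable (F @^-1` ball z r).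
Proof.
move=> mF z r r0.
have -> : F @^-1` ball z r = \bigcap_(ij in [set: 'I_n * 'I_p])
    ((fun w => F w ij.1 ij.2) @^-1` ball (z ij.1 ij.2) r).
  apply/seteqP; split => w /=; first by move=> [_ b] [i j] _ /=.
  by move=> b; split => // i j; apply: (b (i, j)).
apply: fin_bigcap_measurable; first exact: finite_finset.
move=> ij _; rewrite -[X in measurable X]setTI; apply: mF => //.
exact: measurable_ball.
Qed.

Lemma measurable_fun_Borel_mx n p (F : Om -> 'M[R]_(n, p)) :
  (forall i j, measurable_fun setT (fun w => F w i j)) ->
  measurable_fun setT (F : Om -> Borel 'M[R]_(n, p)).
Proof.
move=> mF; apply: measurable_fun_generated.
apply: (@open_preimage_measurable 'M[R]_(n, p) 'M[rat]_(n, p) (map_mx ratr)).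
  exact: mx_rat_dense.
by move=> c r r0; exact: preimage_mx_ball_measurable.
Qed.

(** The target carries the Borel sets of the product topology, for which [is_test] asks
    measurability. Pairs of rational matrices are dense, and a ball is a product of two balls. *)
Lemma measurable_fun_Borel_mx2 n p n' p' (F : Om -> 'M[R]_(n, p))
    (G : Om -> 'M[R]_(n', p')) :
  (forall i j, measurable_fun setT (fun w => F w i j)) ->
  (forall i j, measurable_fun setT (fun w => G w i j)) ->
  measurable_fun setT
    ((fun w => (F w, G w)) : Om -> Borel ('M[R]_(n, p) * 'M[R]_(n', p'))%type).
Proof.
move=> mF mG.
apply: measurable_fun_generated.
apply: (@open_preimage_measurable ('M[R]_(n, p) * 'M[R]_(n', p'))%type ('M[rat]_(n, p) *
  'M[rat]_(n', p'))%type
  (fun c => (map_mx ratr c.1, map_mx ratr c.2))).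
  move=> [z z'] e e0.
  have [c cz] := mx_rat_dense z e0; have [c' cz'] := mx_rat_dense z' e0.
  by exists (c, c').
move=> [c c'] r r0.
rewrite [X in measurable X](_ : _ = F @^-1` ball (map_mx ratr c : 'M[R]_(n, p)) r `&`
  G @^-1` ball (map_mx ratr c' : 'M[R]_(n', p')) r) //.
by apply: measurableI; apply: preimage_mx_ball_measurable.
Qed.

End BorelCoordinates.

Lemma measurable_coord (R : realType) n p (i : 'I_n) (j : 'I_p) :
  measurable_fun setT ((fun x : Borel 'M[R]_(n, p) => x i j)).
Proof.
apply: (@measurability _ _ (Borel 'M[R]_(n, p)) (measurableTypeR R) _ _ _ (RGenOpens.measurableE R)).
move=> _ [_ [a [b ->]] <-]; rewrite setTI; apply: sub_sigma_algebra.
apply: open_comp => [x _|]; first exact: coord_continuous.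
exact: interval_open.
Qed.

Section EqualLaws.
Context {R : realType} d1 d2 (O1 : measurableType d1) (O2 : measurableType d2).
Context (P1 : {measure set O1 -> \bar R}) (P2 : {measure set O2 -> \bar R}).

(** Image measures that agree on a pi-system agree on the sigma-algebra it generates. The two spaces
    differ so that one may be a product: independence then becomes an equality of integrals. *)
Lemma eq_integral_pi_system (T : pointedType) (G : set (set T)) (F1 : O1 -> T) (F2 : O2 -> T)
    (f : T -> \bar R) :
  (P1 setT < +oo)%E -> setI_closed G -> G setT ->
  (forall A, G A -> measurable (F1 @^-1` A)) ->
  (forall A, G A -> measurable (F2 @^-1` A)) ->
  (forall A, G A -> P1 (F1 @^-1` A) = P2 (F2 @^-1` A)) ->
  (forall t, 0 <= f t)%E -> measurable_fun setT (f : g_sigma_algebraType G -> \bar R) ->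
  (\int[P1]_w f (F1 w) = \int[P2]_w f (F2 w))%E.
Proof.
move=> P1oo GI GT m1 m2 e12 f0 mf.
have mF1 : measurable_fun setT (F1 : O1 -> g_sigma_algebraType G).
  exact: measurable_fun_generated.
have mF2 : measurable_fun setT (F2 : O2 -> g_sigma_algebraType G).
  exact: measurable_fun_generated.
have := @ge0_integral_pushforward _ _ _ (g_sigma_algebraType G) R _ mF1 P1 setT f measurableT mf.
rewrite preimage_setT => <-; last by move=> *; exact: f0.
have := @ge0_integral_pushforward _ _ _ (g_sigma_algebraType G) R _ mF2 P2 setT f measurableT mf.
rewrite preimage_setT => <-; last by move=> *; exact: f0.
apply: eq_measure_integral => A mA _.
apply: (@measure_unique _ _ (g_sigma_algebraType G) G (fun=> setT)) => //.
- by rewrite bigcup_const.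
Qed.

End EqualLaws.

(** * Standard Gaussian vectors and the Cameron-Martin formula *)

Section NormalIntegrals.
Context {R : realType}.
Local Notation gamma := (normal_prob (0 : R) 1).
Local Notation leb := (@lebesgue_measure R).

(** The density equals the Radon-Nikodym derivative almost everywhere, both having the same integral
    over every measurable set. *)
Lemma integral_normal_prob (f : R -> \bar R) :
  measurable_fun setT f -> (forall x, 0 <= f x)%E ->
  (\int[gamma]_x f x = \int[leb]_x (f x * (normal_pdf 0 1 x)%:E))%E.
Proof.
move=> mf f0.
rewrite -(@Radon_Nikodym_SigmaFinite.change_of_variables _ _ R _ leb (normal_prob_dominates 0 1) f)//.
have mp : measurable_fun setT (EFin \o normal_pdf (0 : R) 1).
  by apply/measurable_EFinP; exact: measurable_normal_pdf.
have dom : normal_prob (0:R) 1 `<< leb by exact: normal_prob_dominates.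
have iRN := Radon_Nikodym_SigmaFinite.f_integrable dom.
apply: ge0_ae_eq_integral => //.
- by apply: emeasurable_funM => //; exact: (measurable_int leb).
- exact: emeasurable_funM.
- by move=> x _; rewrite mule_ge0//; exact: Radon_Nikodym_SigmaFinite.f_ge0.
- by move=> x _; rewrite mule_ge0// lee_fin normal_pdf_ge0.
apply: ae_eqe_mul2l; apply: integral_ae_eq => //.
by move=> E _ mE; rewrite -Radon_Nikodym_SigmaFinite.f_integral.
Qed.

Lemma lebesgue_shift (c : R) (A : set (measurableTypeR R)) : measurable A ->
  leb ((fun x => x + c) @^-1` A) = leb A.
Proof.
have ms : measurable_fun setT (fun x : R => x + c) by exact: measurable_funD.
move=> mA; apply/esym.
apply: (@lebesgue_measure_unique R (pushforward leb ((fun x : R => x + c) : measurableTypeR R ->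
  measurableTypeR R))) => //.
move=> _ [[a b] _ <-]; rewrite /pushforward /=.
rewrite [X in _ = leb X](_ : _ = `]a - c, b - c]%classic); last first.
  by apply/seteqP; split => x /=; rewrite !in_itv/= ltrBlDr lerBrDr.
rewrite !lebesgue_measure_itv /= !lte_fin ltrD2r; case: ifP => // _.
by rewrite -!EFinB; congr (_%:E); ring.
Qed.

Lemma integral_shift (c : R) (f : R -> \bar R) :
  measurable_fun setT f -> (forall x, 0 <= f x)%E ->
  (\int[leb]_x f (x + c)%R = \int[leb]_x f x)%E.
Proof.
move=> mf f0.
have ms : measurable_fun setT (fun x : R => x + c) by exact: measurable_funD.
have := @ge0_integral_pushforward _ _ (measurableTypeR R) (measurableTypeR R) R _ ms leb setT f
  measurableT mf.
rewrite preimage_setT => <-; last by move=> *; exact: f0.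
apply: eq_measure_integral => A mA _; exact: lebesgue_shift.
Qed.

Lemma normal_pdf01 (x : R) :
  normal_pdf 0 1 x = normal_peak 1 * expR (- (x ^+ 2) / 2).
Proof.
by rewrite /normal_pdf oner_eq0 /normal_fun subr0 expr1n.
Qed.

(** Cameron-Martin in dimension one: translate Lebesgue measure by -c and complete the square in the
    exponent. *)
Lemma integral_normal_shift (c : R) (h : R -> \bar R) :
  measurable_fun setT h -> (forall x, 0 <= h x)%E ->
  (\int[gamma]_t h (t + c)%R =
   \int[gamma]_t (h t * (expR (c * t - c ^+ 2 / 2))%:E))%E.
Proof.
move=> mh h0.
have mc : measurable_fun setT (fun t : R => h (t + c)).
  by apply: (measurableT_comp mh); exact: measurable_funD.
have mp : measurable_fun setT (fun t : R => (normal_pdf 0 1 t)%:E).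
  by apply/measurable_EFinP; exact: measurable_normal_pdf.
have me : measurable_fun setT (fun t : R => (expR (c * t - c ^+ 2 / 2))%:E).
  apply/measurable_EFinP; apply: measurableT_comp => //.
  by apply: measurable_funB => //; exact: measurable_funM.
rewrite !integral_normal_prob//; last 2 first.
- exact: emeasurable_funM.
- by move=> x; rewrite mule_ge0// lee_fin expR_ge0.
rewrite -(integral_shift (- c)); last 2 first.
- exact: emeasurable_funM.
- by move=> x; rewrite mule_ge0// lee_fin normal_pdf_ge0.
apply: eq_integral => x _.
rewrite subrK -muleA; congr (_ * _)%E; rewrite -EFinM; congr (_%:E).
rewrite !normal_pdf01 mulrCA -expRD; congr (_ * expR _).
by field.
Qed.

End NormalIntegrals.

Section GaussianVectors.
Context {R : realType} {n : nat}.
Local Notation gamma := (normal_prob (0 : R) 1).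
Local Notation V := 'cV[R]_n.

Definition dot (u v : V) : R := \sum_(i < n) u i ord0 * v i ord0.

(** The law is recorded by its values on boxes, the form in which [std_gaussian_indep] provides
    it. *)
Definition std_normal_vec (mu : probability (Borel V) R) : Prop :=
  forall B : 'I_n -> set R, (forall i, measurable (B i)) ->
    mu [set e : V | forall i, B i (e i ord0)] = (\prod_(i < n) gamma (B i))%E.

Definition upd (e : V) (k : 'I_n) (t : R) : V :=
  \col_i (if i == k then t else e i ord0).

Definition boxes : set (set V) :=
  [set A | exists2 B : 'I_n -> set R, (forall i, measurable (B i)) &
     A = [set e : V | forall i, B i (e i ord0)]].

Lemma boxes_setI : setI_closed boxes.
Proof.
move=> _ _ [B mB ->] [C mC ->]; exists (fun i => B i `&` C i).
  by move=> i; exact: measurableI.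
apply/seteqP; split => e /=; first by move=> [h1 h2] i; split; [apply: h1|apply: h2].
by move=> h; split => i; case: (h i).
Qed.

Lemma boxes_setT : boxes setT.
Proof. by exists (fun=> setT) => //; apply/seteqP; split. Qed.

Lemma measurable_boxes (A : set V) : boxes A -> measurable (A : set (Borel V)).
Proof.
move=> [B mB ->].
have -> : [set e : V | forall i, B i (e i ord0)] =
   \bigcap_(i in [set: 'I_n]) ((fun e : V => e i ord0) @^-1` B i).
  by apply/seteqP; split => e /= h i *; [exact: h|exact: (h i)].
apply: fin_bigcap_measurable; first exact: finite_finset.
move=> i _; rewrite -[X in measurable X]setTI; exact: measurable_coord.
Qed.

(** Boxes generate the Borel sets: the identity from their sigma-algebra to the Borel one is
    measurable because each of its coordinates is. *)
Lemma measurable_fun_boxes (f : Borel V -> \bar R) : measurable_fun setT f ->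
  measurable_fun setT (f : g_sigma_algebraType boxes -> \bar R).
Proof.
move=> mf; have mi : measurable_fun setT (id : g_sigma_algebraType boxes -> Borel V).
  apply: measurable_fun_Borel_mx => i j _ B mB; rewrite setTI.
  apply: sub_sigma_algebra; exists (fun i' => if i' == i then B else setT).
    by move=> i'; case: ifP.
  apply/seteqP; split => e /=.
    by rewrite (ord1 j) => h i'; case: eqP => // ->.
  by move=> /(_ i); rewrite eqxx (ord1 j).
exact: (measurableT_comp mf mi).
Qed.

Context (mu : probability (Borel V) R) (hmu : std_normal_vec mu).

(* Redrawing one coordinate preserves the law: this takes the place of an n-fold product measure. *)
Lemma std_normal_resample (k : 'I_n) (F : Borel V -> \bar R) :
  measurable_fun setT F -> (forall e, 0 <= F e)%E ->
  (\int[mu]_e F e = \int[mu]_e \int[gamma]_t F (upd e k t))%E.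
Proof.
move=> mF F0.
have mupd : measurable_fun setT
    ((fun te => upd te.2 k te.1) : measurableTypeR R * Borel V -> Borel V).
  apply: measurable_fun_Borel_mx => i j; case: (eqVneq i k) => ik.
    under eq_fun do rewrite mxE ik eqxx.
    exact: measurable_fst.
  under eq_fun do rewrite mxE (negbTE ik).
  exact: (measurableT_comp (measurable_coord i ord0)).
rewrite (@eq_integral_pi_system _ _ _ (Borel V) (measurableTypeR R * Borel V)%type mu (gamma \x mu)%E
  _ boxes id (fun te => upd te.2 k te.1) F) //=.
- rewrite fubini_tonelli2//; exact: measurableT_comp mF mupd.
- by rewrite probability_setT ltry.
- exact: boxes_setI.
- exact: boxes_setT.
- by move=> A /measurable_boxes; rewrite preimage_id.
- move=> A /measurable_boxes mA; rewrite -[X in measurable X]setTI; exact: mupd.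
- move=> _ [B mB ->]; rewrite preimage_id hmu//.
  pose B' i := if i == k then setT else B i.
  have mB' i : measurable (B' i) by rewrite /B'; case: ifP.
  transitivity ((gamma \x mu)%E (B k `*` [set e : V | forall i, B' i (e i ord0)])).
    rewrite product_measure1E //; last by apply: measurable_boxes; exists B'.
    rewrite (bigD1 k)//=; congr (_ * _)%E; apply/esym.
    rewrite [LHS](hmu mB') (bigD1 k)//= {1}/B' eqxx.
    rewrite probability_setT mul1e.
    by apply: eq_bigr => i /negbTE ik; rewrite /B' ik.
    exact: mB.
  congr ((gamma \x mu)%E _); apply/seteqP; split => -[t e] /=.
    move=> [tB h] i; rewrite mxE; case: eqP => [->//|/eqP ik].
    by have := h i; rewrite /B' (negbTE ik).
  move=> h; split; first by have := h k; rewrite mxE eqxx.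
  by move=> i; rewrite /B'; have := h i; rewrite mxE; case: ifP.
- exact: measurable_fun_boxes.
Qed.

Lemma measurable_dot (u : V) : measurable_fun setT (dot u : Borel V -> R).
Proof.
apply: measurable_sum => i; apply: measurable_funM => //.
exact: measurable_coord.
Qed.

Lemma measurable_translate (v : V) :
  measurable_fun setT ((fun e => e + v) : Borel V -> Borel V).
Proof.
apply: measurable_fun_Borel_mx => i j; under eq_fun do rewrite mxE.
by apply: measurable_funD => //; exact: measurable_coord.
Qed.

Lemma std_normal_shift1 (k : 'I_n) (c : R) (F : Borel V -> \bar R) :
  measurable_fun setT F -> (forall e, 0 <= F e)%E ->
  (\int[mu]_e F (e + c *: delta_mx k ord0)%R =
   \int[mu]_e (F e * (expR (c * e k ord0 - c ^+ 2 / 2))%:E))%E.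
Proof.
move=> mF F0.
have mE : measurable_fun setT (fun e : Borel V => (expR (c * e k ord0 - c ^+ 2 / 2))%:E).
  apply/measurable_EFinP; apply: measurableT_comp => //.
  apply: measurable_funB => //; apply: measurable_funM => //.
  exact: measurable_coord.
rewrite (std_normal_resample k (F := fun e => F (e + c *: delta_mx k ord0)))//; last first.
  exact: measurableT_comp mF (measurable_translate _).
rewrite [RHS](std_normal_resample k); last 2 first.
- exact: emeasurable_funM.
- by move=> e; rewrite mule_ge0// lee_fin expR_ge0.
apply: eq_integral => e _.
have mu1 : measurable_fun setT ((fun t => upd e k t) : measurableTypeR R -> Borel V).
  apply: measurable_fun_Borel_mx => i j; case: (eqVneq i k) => ik.
    under eq_fun do rewrite mxE ik eqxx.
    exact: measurable_id.
  under eq_fun do rewrite mxE (negbTE ik).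
  exact: measurable_cst.
transitivity (\int[gamma]_t F (upd e k (t + c)))%E.
  apply: eq_integral => t _; congr F; apply/matrixP => i j.
  rewrite !mxE (ord1 j) eqxx andbT; case: eqP => _ /=; first by rewrite mulr1.
  by rewrite mulr0 addr0.
rewrite (integral_normal_shift c (measurableT_comp mF mu1) (fun t => F0 (upd e k t))).
by apply: eq_integral => t _; rewrite mxE eqxx.
Qed.

(** Cameron-Martin formula, one coordinate at a time. The induction runs over a duplicate-free list,
    so that the rest of the shift vanishes at coordinate k and leaves the factor already produced
    for k unchanged. *)
Lemma std_normal_shift (v : V) (F : Borel V -> \bar R) :
  measurable_fun setT F -> (forall e, 0 <= F e)%E ->
  (\int[mu]_e F (e + v)%R = \int[mu]_e (F e * (expR (dot v e - dot v v / 2))%:E))%E.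
Proof.
suff H (s : seq 'I_n) : uniq s -> forall G : Borel V -> \bar R,
   measurable_fun setT G -> (forall e, 0 <= G e)%E ->
  (\int[mu]_e G (e + \sum_(k <- s) v k ord0 *: delta_mx k ord0)%R =
   \int[mu]_e (G e * (expR (\sum_(k <- s) (v k ord0 * e k ord0 - v k ord0 ^+ 2 / 2)))%:E))%E.
  move=> mF F0; have := H _ (index_enum_uniq 'I_n) F mF F0.
  have -> : \sum_(k : 'I_n) v k ord0 *: delta_mx k ord0 = v.
    by rewrite [RHS]matrix_sum_delta; apply: eq_bigr => i _; rewrite big_ord1.
  move=> ->; apply: eq_integral => e _; congr (_ * (expR _)%:E)%E.
  rewrite sumrB /dot -mulr_suml; congr (_ - _ / _).
elim: s => [_ G mG G0|k s IH /= /andP[ks us] G mG G0].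
  apply: eq_integral => e _; rewrite !big_nil addr0 expR0 mule1//.
pose w : V := \sum_(j <- s) v j ord0 *: delta_mx j ord0.
have wk : w k ord0 = 0.
  rewrite /w summxE big_seq big1// => j js; rewrite !mxE.
  by case: eqP => [kj|_]; [rewrite kj js in ks|rewrite mulr0].
transitivity (\int[mu]_e G ((e + v k ord0 *: delta_mx k ord0) + w)%R)%E.
  by apply: eq_integral => e _; rewrite big_cons addrA.
have mGw := measurableT_comp mG (measurable_translate w).
rewrite (std_normal_shift1 k (v k ord0) mGw (fun e => G0 (e + w))).
pose G1 (e : Borel V) := (G e * (expR (v k ord0 * e k ord0 - v k ord0 ^+ 2 / 2))%:E)%E.
transitivity (\int[mu]_e G1 (e + w)%R)%E.
  by apply: eq_integral => e _ /=; rewrite /G1 mxE wk addr0.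
rewrite (IH us G1).
- apply: eq_integral => e _.
  by rewrite big_cons /G1 -muleA -EFinM -expRD.
- apply: emeasurable_funM => //; apply/measurable_EFinP; apply: measurableT_comp => //.
  apply: measurable_funB => //; apply: measurable_funM => //.
  exact: measurable_coord.
- by move=> e; rewrite mule_ge0// lee_fin expR_ge0.
Qed.

End GaussianVectors.

(** * The standard Gaussian distribution function near 0 *)

Section NormalHalf.
Context {R : realType}.
Local Notation gamma := (normal_prob (0 : R) 1).
Local Notation leb := (@lebesgue_measure R).

Lemma lebesgue_opp (A : set (measurableTypeR R)) : measurable A ->
  leb ((fun x => - x) @^-1` A) = leb A.
Proof.
have ms : measurable_fun setT (fun x : R => - x) by exact: oppr_measurable.
move=> mA; apply/esym.
apply: (@lebesgue_measure_unique R (pushforward leb ((fun x : R => - x) : measurableTypeR R ->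
  measurableTypeR R))) => //.
move=> _ [[a b] _ <-]; rewrite /pushforward /=.
rewrite [X in _ = leb X](_ : _ = `[- b, - a[%classic); last first.
  by apply/seteqP; split => x /=; rewrite !in_itv/= => /andP[xa xb]; apply/andP; split; lra.
rewrite !lebesgue_measure_itv /= !lte_fin ltrN2; case: ifP => // _.
by rewrite -!EFinB; congr (_%:E); ring.
Qed.

Lemma normal_prob_opp (A : set (measurableTypeR R)) : measurable A ->
  gamma ((fun x => - x) @^-1` A) = gamma A.
Proof.
move=> mA.
have ms : measurable_fun setT ((fun x => - x) : measurableTypeR R -> measurableTypeR R).
  exact: oppr_measurable.
have mp : measurable_fun setT (fun x : R => (normal_pdf 0 1 x)%:E).
  by apply/measurable_EFinP; exact: measurable_normal_pdf.
rewrite /normal_prob.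
have := @ge0_integral_pushforward _ _ (measurableTypeR R) (measurableTypeR R) R _ ms leb A
  (fun x => (normal_pdf 0 1 x)%:E) mA (measurable_funTS mp).
move=> H; transitivity (\int[leb]_(x in (fun x : R => (- x)%R) @^-1` A) ((fun x : R => (normal_pdf
  0 1 x)%:E) \o (fun x : R => (- x)%R)) x)%E.
  by apply: eq_integral => x _ /=; rewrite !normal_pdf01 sqrrN.
rewrite -H; last by move=> x _; rewrite lee_fin normal_pdf_ge0.
by apply: eq_measure_integral => B mB _; exact: lebesgue_opp.
Qed.

(** The density is at most 1 / sqrt (2 pi) <= 1. *)
Lemma normal_prob_itv_le (a b : R) : a <= b -> (gamma `]a, b]%classic <= (b - a)%:E)%E.
Proof.
move=> ab; apply: (@le_trans _ _ (\int[leb]_(x in `]a, b]) (cst 1%:E x))%E).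
  apply: ge0_le_integral => //=.
  - by move=> x _; rewrite lee_fin normal_pdf_ge0.
  - by apply/measurable_EFinP/measurable_funTS; exact: measurable_normal_pdf.
  - move=> x _; rewrite lee_fin (le_trans (normal_pdf_ub _ _ _))// ?oner_neq0//.
    have p2 := pi_ge2 R.
    rewrite /normal_peak expr1n mul1r invf_le1; last by rewrite sqrtr_gt0; lra.
    by rewrite -[leLHS]sqrtr1 ler_wsqrtr//; lra.
rewrite integral_cst//= mul1e lebesgue_measure_itv/= lte_fin.
by case: ifP => // _; rewrite lee_fin subr_ge0.
Qed.

Lemma normal_prob_point (a : R) : gamma [set a] = 0%E.
Proof.
have /null_content_dominatesP := @normal_prob_dominates R 0 1.
by apply => //; exact: lebesgue_measure_set1.
Qed.

Lemma normal_prob_half : gamma `]-oo, 0]%classic = (2^-1)%:E.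
Proof.
have h1 : gamma `[0, +oo[%classic = gamma `]-oo, 0]%classic.
  rewrite -[RHS]normal_prob_opp//; congr (gamma _).
  by apply/seteqP; split => x /=; rewrite !in_itv/= ?andbT oppr_le0.
have h2 : gamma `[0, +oo[%classic = gamma `]0, +oo[%classic.
  rewrite -(setU1itv false)// measureU//=; last first.
    by apply/seteqP; split => x //= [->]; rewrite in_itv/= ltxx.
  by rewrite normal_prob_point add0e.
have : gamma setT = 1%E by exact: probability_setT.
rewrite -(setUv `]-oo, 0]%classic) setCitvl measureU//=; last first.
  by rewrite -setCitvl setICr.
rewrite -h2 h1.
have := fin_num_measure gamma `]-oo, 0]%classic ltac:(by []).
case: (gamma _) => // r _; rewrite -EFinD => -[rr]; congr (_%:E); lra.
Qed.

Lemma normal_prob_le_half (x : R) :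
  ((2^-1 - `|x|)%:E <= gamma `]-oo, x]%classic <= (2^-1 + `|x|)%:E)%E.
Proof.
have [x0|x0] := leP 0 x.
  rewrite (ger0_norm x0).
  have -> : `]-oo, x]%classic = `]-oo, 0]%classic `|` `]0, x]%classic :> set R.
    apply/seteqP; split => y /=; rewrite !in_itv/=.
      by move=> yx; case: (leP y 0) => ?; [left|right].
    by case=> [/le_trans|/andP[]//]; apply.
  rewrite measureU//=; last first.
    by apply/seteqP; split => y //= []; rewrite !in_itv/= => y0 /andP[]; rewrite ltNge y0.
  rewrite normal_prob_half; have := normal_prob_itv_le x0; rewrite subr0 => xx.
  apply/andP; split; last by rewrite EFinD leeD.
  by rewrite (@le_trans _ _ (2^-1)%:E) ?lee_fin ?gerBl// leeDl.
rewrite (ltr0_norm x0).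
have : (gamma `]-oo, 0%R]%classic = gamma `]-oo, x]%classic + gamma `]x, 0%R]%classic)%E.
  rewrite -measureU//=; last first.
    by apply/seteqP; split => y //= []; rewrite !in_itv/= => y0 /andP[]; rewrite ltNge y0.
  congr (gamma _); apply/seteqP; split => y /=; rewrite !in_itv/=.
    by move=> yx; case: (leP y x) => ?; [left|right].
  by case=> [/le_trans|/andP[]//]; apply; exact: ltW.
rewrite normal_prob_half; have := normal_prob_itv_le (ltW x0).
have : (0 <= gamma `]x, 0%R]%classic)%E by [].
have := fin_num_measure gamma `]-oo, x]%classic ltac:(by []).
have := fin_num_measure gamma `]x, 0]%classic ltac:(by []).
case: (gamma _) => // r _; case: (gamma _) => // r' _.
rewrite -EFinD !lee_fin => r0 rx [->]; lra.
Qed.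

End NormalHalf.

(** * Gaussian projections *)

Section Dot.
Context {R : realType} {n : nat}.
Implicit Types u v w : 'cV[R]_n.

Lemma dotC u v : dot u v = dot v u.
Proof. by apply: eq_bigr => i _; rewrite mulrC. Qed.

Lemma dotDr u v w : dot u (v + w) = dot u v + dot u w.
Proof. by rewrite /dot -big_split; apply: eq_bigr => i _; rewrite mxE mulrDr. Qed.

Lemma dotDl u v w : dot (u + v) w = dot u w + dot v w.
Proof. by rewrite dotC dotDr !(dotC w). Qed.

Lemma dotZr a u v : dot u (a *: v) = a * dot u v.
Proof. by rewrite /dot mulr_sumr; apply: eq_bigr => i _; rewrite mxE mulrCA. Qed.

Lemma dotZl a u v : dot (a *: u) v = a * dot u v.
Proof. by rewrite dotC dotZr dotC. Qed.

Lemma dotNr u v : dot u (- v) = - dot u v.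
Proof. by rewrite -scaleN1r dotZr mulN1r. Qed.

Lemma dotNl u v : dot (- u) v = - dot u v.
Proof. by rewrite dotC dotNr dotC. Qed.

Lemma dotBr u v w : dot u (v - w) = dot u v - dot u w.
Proof. by rewrite dotDr dotNr. Qed.

Lemma dotBl u v w : dot (u - v) w = dot u w - dot v w.
Proof. by rewrite dotDl dotNl. Qed.

Lemma dot_sumr I (r : seq I) (p : pred I) u (v : I -> 'cV[R]_n) :
  dot u (\sum_(i <- r | p i) v i) = \sum_(i <- r | p i) dot u (v i).
Proof.
elim/big_rec2: _ => [|i y1 y2 _ <-]; last by rewrite dotDr.
by rewrite /dot big1// => i _; rewrite mxE mulr0.
Qed.

Lemma dot_suml I (r : seq I) (p : pred I) u (v : I -> 'cV[R]_n) :
  dot (\sum_(i <- r | p i) v i) u = \sum_(i <- r | p i) dot (v i) u.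
Proof. by rewrite dotC dot_sumr; apply: eq_bigr => i _; rewrite dotC. Qed.

Lemma dot_ge0 u : 0 <= dot u u.
Proof. by apply: sumr_ge0 => i _; rewrite -expr2 sqr_ge0. Qed.

Lemma dot_cauchy_schwarz u v : dot u v ^+ 2 <= dot u u * dot v v.
Proof.
have [v0|v0] := eqVneq (dot v v) 0.
  suff -> : dot u v = 0 by rewrite v0 expr0n mulr0.
  rewrite /dot big1// => i _.
  move/eqP: v0; rewrite psumr_eq0; last by move=> j _; rewrite -expr2 sqr_ge0.
  by move/allP => /(_ i (mem_index_enum i)); rewrite /= mulf_eq0 orbb => /eqP ->; rewrite mulr0.
have vp : 0 < dot v v by rewrite lt_def v0 dot_ge0.
have := dot_ge0 (dot v v *: u - dot u v *: v).
rewrite dotBl !dotBr !dotZl !dotZr (dotC v u).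
have -> : dot v v * (dot v v * dot u u) - dot v v * (dot u v * dot u v) -
  (dot u v * (dot v v * dot u v) - dot u v * (dot u v * dot v v)) =
  dot v v * (dot u u * dot v v - dot u v ^+ 2) by ring.
by rewrite pmulr_rge0// subr_ge0.
Qed.

End Dot.

Section Projections.
Context {R : realType} {n : nat}.
Local Notation gamma := (normal_prob (0 : R) 1).
Local Notation leb := (@lebesgue_measure R).
Local Notation V := 'cV[R]_n.
Context (mu : probability (Borel V) R) (hmu : std_normal_vec mu).

Lemma normal_pdf_tilt (g t : R) :
  normal_pdf 0 1 g * expR (t * g - t ^+ 2 / 2) = normal_pdf 0 1 (t - g).
Proof. by rewrite !normal_pdf01 -mulrA -expRD; congr (_ * expR _); field. Qed.

(* Compute the integral of F (<e, x> + t) 1_H (x) over mu(dx) dt, with F = 1_B times the normal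
   density, in both orders.  By translation invariance of dt it is gamma B * mu H; by the shift
   formula along e, where F (g) exp (t g - t^2/2) = 1_B (g) pdf (t - g), it is the left-hand side. *)
Lemma std_normal_proj (e : V) (H : set (Borel V)) (B : set R) :
  dot e e = 1 -> measurable H -> (forall x t, H x -> H (x + t *: e)) ->
  measurable B ->
  mu ([set x | B (dot e x)] `&` H) = (gamma B * mu H)%E.
Proof.
move=> e1 mH Hinv mB.
have HinvE x t : (\1_H (x + t *: e) : R) = \1_H x.
  rewrite !indicE; congr ((nat_of_bool _)%:R); apply/idP/idP; rewrite !in_setE; last exact: Hinv.
  by move=> /(Hinv _ (- t)); rewrite -addrA -scalerDl subrr scale0r addr0.
have mg := measurable_dot e.
have mp : measurable_fun setT (normal_pdf (0 : R) 1) by exact: measurable_normal_pdf.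
pose F y : R := \1_B y * normal_pdf 0 1 y.
have mF : measurable_fun setT F by apply: measurable_funM => //; exact: measurable_indic.
have F0 y : 0 <= F y by rewrite mulr_ge0 ?normal_pdf_ge0.
have mH1 : measurable_fun setT (\1_H : Borel V -> R) by exact: measurable_indic.
pose Q (xt : Borel V * measurableTypeR R) := (F (dot e xt.1 + xt.2) * \1_H xt.1)%:E.
have mQ : measurable_fun setT Q.
  apply/measurable_EFinP; apply: measurable_funM.
    apply: (measurableT_comp mF); apply: measurable_funD => //.
    exact: (measurableT_comp mg).
  exact: (measurableT_comp mH1).
have Q0 xt : (0 <= Q xt)%E by rewrite lee_fin mulr_ge0.
have mFE : measurable_fun setT (fun y => (F y)%:E) by exact/measurable_EFinP.
have E1 : (\int[mu]_x \int[leb]_t Q (x, t) = gamma B * mu H)%E.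
  transitivity (\int[mu]_x ((gamma B) * (\1_H x)%:E))%E.
    apply: eq_integral => x _; rewrite /Q /=.
    under eq_integral do rewrite EFinM muleC.
    rewrite ge0_integralZl//; last 2 first.
    - by apply/measurable_EFinP; apply: (measurableT_comp mF); exact: measurable_funD.
    - by move=> t _; rewrite lee_fin.
    rewrite muleC; congr (_ * _)%E.
    transitivity (\int[leb]_t (F (t + dot e x))%:E)%E.
      by apply: eq_integral => t _; rewrite addrC.
    rewrite (@integral_shift _ _ (fun t => (F t)%:E)) //.
    rewrite /normal_prob [RHS]integral_mkcond; apply: eq_integral => t _.
    by rewrite epatch_indic /F EFinM muleC.
  rewrite ge0_integralZl//; last exact/measurable_EFinP.
  by rewrite integral_indic// setIT.
rewrite -E1 fubini_tonelli//.
have E2 t : (\int[mu]_x Q (x, t) = \int[mu]_x (\1_B (dot e x) * normal_pdf 0 1 (t - dot e x) * \1_H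
  x)%:E)%E.
  transitivity (\int[mu]_x (fun x => (F (dot e x) * \1_H x)%:E) (x + t *: e)%R)%E.
    by apply: eq_integral => x _; rewrite /Q/= HinvE dotDr dotZr e1 mulr1.
  rewrite (std_normal_shift hmu (t *: e) (F := fun x => (F (dot e x) * \1_H x)%:E)).
  - apply: eq_integral => x _; rewrite -EFinM; congr (_%:E).
    by rewrite !dotZl dotZr e1 mulr1 -expr2 /F -normal_pdf_tilt; ring.
  - apply/measurable_EFinP; apply: measurable_funM => //.
    exact: (measurableT_comp mF).
  - by move=> x; rewrite lee_fin mulr_ge0.
under eq_integral do rewrite E2.
rewrite -(fubini_tonelli (m1 := mu) (m2 := leb) (fun xt => (\1_B (dot e xt.1) * normal_pdf 0 1
  (xt.2 - dot e xt.1) * \1_H xt.1)%:E)); last 2 first.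
- apply/measurable_EFinP; apply: measurable_funM; last exact: (measurableT_comp mH1).
  apply: measurable_funM.
    apply: (measurableT_comp (measurable_indic mB)); exact: (measurableT_comp mg).
  apply: (measurableT_comp mp); apply: measurable_funB => //.
  exact: (measurableT_comp mg).
- by move=> xt; rewrite lee_fin !mulr_ge0// normal_pdf_ge0.
have mBH : measurable ([set x : Borel V | B (dot e x)] `&` H).
  apply: measurableI => //; rewrite -[X in measurable X]setTI; exact: mg.
rewrite -[in LHS](setIT (_ `&` H)) -integral_indic//.
apply: eq_integral => x _ /=.
under eq_integral do rewrite mulrAC EFinM.
have mpx : measurable_fun setT (fun t : R => (normal_pdf 0 1 (t - dot e x))%:E).
  by apply/measurable_EFinP; apply: (measurableT_comp mp); exact: measurable_funD.
have px0 (t : R) : (0 <= (normal_pdf 0 1 t)%:E)%E by rewrite lee_fin normal_pdf_ge0.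
rewrite ge0_integralZl//.
rewrite (@integral_shift _ _ (fun t => (normal_pdf 0 1 t)%:E)) //; last exact/measurable_EFinP.
by rewrite integral_normal_pdf mule1 indicI /= !indicE.
Qed.

(** Exponential Markov inequality; the moment generating function is read off the shift formula
    applied to the constant 1. The parameter l stays free because each use picks its own. *)
Lemma std_normal_chernoff (u : V) (r l : R) : 0 <= l ->
  (mu [set x | (r <= dot u x)%R] <= (expR (l ^+ 2 * dot u u / 2 - l * r))%:E)%E.
Proof.
move=> l0.
have mg := measurable_dot u.
have mA : measurable [set x : Borel V | r <= dot u x].
  rewrite (_ : [set x | _] = setT `&` dot u @^-1` `[r, +oo[%classic); first exact: mg.
  by rewrite setTI; apply/seteqP; split => x /=; rewrite in_itv/= andbT.
have me : measurable_fun setT (fun x : Borel V => (expR (dot (l *: u) x - dot (l *: u) (l *: u) /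
  2))%:E).
  apply/measurable_EFinP; apply: measurableT_comp => //.
  by apply: measurable_funB => //; exact: measurable_dot.
have E1 : (\int[mu]_x (expR (dot (l *: u) x - dot (l *: u) (l *: u) / 2))%:E = 1)%E.
  have := std_normal_shift hmu (l *: u) (F := cst 1%E) (@measurable_cst _ _ _ _ _ _) (fun=> lee01).
  have -> : (\int[mu]_e cst 1%E (e + l *: u)%R = 1)%E.
    by rewrite -[RHS](@probability_setT _ _ R mu) -[RHS]mul1e -(integral_cst mu measurableT 1%E).
  move=> ->; by apply: eq_integral => x _; rewrite mul1e.
rewrite -[in leLHS](setIT [set x | _]) -integral_indic//.
rewrite -[leRHS]mule1 -E1 -ge0_integralZl//.
apply: ge0_le_integral => //.
- by apply/measurable_EFinP; exact: measurable_indic.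
- by apply: emeasurable_funM => //; exact/measurable_EFinP.
move=> x _; rewrite -EFinM -expRD lee_fin indicE.
case: (boolP (x \in _)) => [|_]; last by rewrite expR_ge0.
rewrite in_setE /= => rx; rewrite -[leLHS]expR0 ler_expR !dotZl !dotZr.
have : 0 <= l * (dot u x - r) by rewrite mulr_ge0// subr_ge0.
have -> : l * (l * dot u u) = l ^+ 2 * dot u u by ring.
lra.
Qed.

(** The event for the remaining indices is invariant under translation along [e k], so
    [std_normal_proj] splits off one factor at a time. *)
Lemma std_normal_orthonormal (I : finType) (e : I -> V) (B : I -> set R) :
  (forall i j, dot (e i) (e j) = (i == j)%:R) -> (forall i, measurable (B i)) ->
  mu [set x | forall i, B i (dot (e i) x)] = (\prod_i gamma (B i))%E.
Proof.
move=> eo mB.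
suff H (s : seq I) : uniq s ->
    measurable [set x : Borel V | forall i, i \in s -> B i (dot (e i) x)] /\
    mu [set x | forall i, i \in s -> B i (dot (e i) x)] = (\prod_(i <- s) gamma (B i))%E.
  have [_ <-] := H _ (index_enum_uniq I); congr (mu _).
  by apply/seteqP; split => x /= h i *; apply: h => //; rewrite mem_index_enum.
elim: s => [_|k s IH /= /andP[ks us]].
  rewrite big_nil -(@probability_setT _ _ R mu).
  suff -> : [set x : Borel V | forall i, i \in [::] -> B i (dot (e i) x)] = setT by [].
  by apply/seteqP; split.
have [mH EH] := IH us.
have -> : [set x : Borel V | forall i, i \in k :: s -> B i (dot (e i) x)] =
  [set x | B k (dot (e k) x)] `&` [set x | forall i, i \in s -> B i (dot (e i) x)].
  apply/seteqP; split => x /=.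
    by move=> h; split => [|i si]; apply: h; rewrite inE ?eqxx// si orbT.
  by move=> [h1 h2] i; rewrite inE => /orP[/eqP->//|]; exact: h2.
split.
  apply: measurableI => //; rewrite -[X in measurable X]setTI.
  exact: (measurable_dot (e k)).
rewrite std_normal_proj//; last 2 first.
- by rewrite eo eqxx.
- move=> x t h i si; rewrite dotDr dotZr eo.
  by case: eqP => [ik|_]; [rewrite -ik si in ks|rewrite mulr0 addr0; exact: h].
by rewrite EH big_cons.
Qed.

End Projections.

(** Gram-Schmidt with error control: one new vector is orthogonalized against k vectors already
    within r' of orthonormal ones, then normalized. [del] depends on k and r but not on n, since
    only inner products enter. *)
Lemma gram_schmidt_approx (R : realType) k (r : R) : 0 < r <= 1 ->
  exists2 del : R, 0 < del <= 1 &
  forall n (I : eqType) (u : I -> 'cV[R]_n) (s : seq I), size s = k -> uniq s ->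
  (forall i j, i \in s -> j \in s -> `|dot (u i) (u j) - (i == j)%:R| <= del) ->
  exists e : I -> 'cV[R]_n,
    (forall i j, i \in s -> j \in s -> dot (e i) (e j) = (i == j)%:R) /\
    (forall i, i \in s -> dot (u i - e i) (u i - e i) <= r).
Proof.
elim: k r => [|k IH] r /andP[r0 r1].
  exists 1; first by rewrite ltr01 lexx.
  by move=> n I u [|//] _ _ _; exists u.
have k16 : 0 < 16 * k.+1%:R :> R by rewrite mulr_gt0// ltr0n.
have k1 : 1 <= k.+1%:R :> R by rewrite ler1n.
have kS : k.+1%:R = k%:R + 1 :> R by rewrite -natr1.
have k0 : 0 <= k%:R :> R by rewrite ler0n.
(* The factor 16 covers the final error 3 del + 2 k (2 del + 4 r') <= (12 k + 3) r', as del <=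
   r'. *)
pose r' := r / (16 * k.+1%:R).
have r'0 : 0 < r' by rewrite divr_gt0.
have r'E : r' * (16 * (k%:R + 1)) = r by rewrite -kS /r' divfK// gt_eqF.
have r'1 : r' <= 1.
  rewrite /r' ler_pdivrMr// mul1r (le_trans r1)//; lra.
have [del' /andP[del'0 del'1] IHd] := IH r' ltac:(by rewrite r'0 r'1).
pose del := Num.min del' r'.
have d0 : 0 < del by rewrite lt_min del'0 r'0.
have dd' : del <= del' by rewrite ge_min lexx.
have dr' : del <= r' by rewrite ge_min lexx orbT.
have d1 : del <= 1 by exact: le_trans r'1.
exists del; first by rewrite d0 d1.
move=> n I u [//|a s] /= [sk] /andP[as_ us] hu.
have [|e [eo eu]] := IHd n I u s sk us.
  by move=> i j si sj; apply: le_trans dd'; apply: hu; rewrite inE ?si ?sj orbT.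
pose c j := dot (u a) (e j).
pose v := u a - \sum_(j <- s) c j *: e j.
have ua : `|dot (u a) (u a) - 1| <= del.
  by have := hu a a; rewrite inE !eqxx /= => /(_ isT isT).
(* Here c_j = <u_a, u_j> - <u_a, u_j - e_j>: near orthogonality bounds the first term,
   Cauchy-Schwarz the second. *)
have cb j : j \in s -> c j ^+ 2 <= 2 * del + 4 * r'.
  move=> sj; have aj : (a == j) = false by apply/eqP => aj; rewrite aj sj in as_.
  have h1 : `|dot (u a) (u j)| <= del.
    by have := hu a j; rewrite !inE eqxx sj orbT aj subr0 => /(_ isT isT).
  have h2 := dot_cauchy_schwarz (u a) (u j - e j).
  have h3 := eu j sj.
  have -> : c j = dot (u a) (u j) - dot (u a) (u j - e j) by rewrite dotBr /c; ring.
  set x := dot (u a) (u j) in h1 *; set y := dot (u a) (u j - e j) in h2 *.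
  have hx : x ^+ 2 <= del.
    rewrite -real_normK ?num_real//; rewrite expr2.
    by apply: (le_trans (ler_pM _ _ h1 h1)) => //; nra.
  have hy : y ^+ 2 <= 2 * r'.
    apply: (le_trans h2); apply: ler_pM; rewrite ?dot_ge0//.
    move: ua; rewrite ler_norml; lra.
  have := sqr_ge0 (x + y); nra.
have dve j : j \in s -> dot (e j) v = 0.
  move=> sj; rewrite /v dotBr dot_sumr (bigD1_seq j)//= dotZr eo// eqxx mulr1.
  rewrite big_seq_cond big1 ?addr0.
    by rewrite /c dotC subrr.
  by move=> i /andP[si ij]; rewrite dotZr eo// eq_sym (negbTE ij) mulr0.
have dvv : dot v v = dot (u a) v.
  rewrite {1}/v dotBl dot_suml big_seq big1 ?subr0// => i si.
  by rewrite dotZl dve// mulr0.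
have dvv2 : dot v v = dot (u a) (u a) - \sum_(j <- s) c j ^+ 2.
  rewrite dvv /v dotBr dot_sumr; congr (_ - _).
  by apply: eq_bigr => i _; rewrite dotZr /c expr2.
have Sc : \sum_(j <- s) c j ^+ 2 <= k%:R * (2 * del + 4 * r').
  rewrite -sk -sum1_size natr_sum mulr_suml big_seq [leRHS]big_seq.
  by apply: ler_sum => i si; rewrite mul1r cb.
have Sc0 : 0 <= \sum_(j <- s) c j ^+ 2 by apply: sumr_ge0 => i _; exact: sqr_ge0.
have Sc2 : del + k%:R * (2 * del + 4 * r') <= r / 2 by rewrite -r'E; nra.
have ua' : 1 - del <= dot (u a) (u a) <= 1 + del by move: ua; rewrite ler_norml => /andP[]; lra.
have dv0 : 0 < dot v v by rewrite dvv2; lra.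
pose N := Num.sqrt (dot v v).
have N0 : 0 < N by rewrite sqrtr_gt0.
have NN : N ^+ 2 = dot v v by rewrite sqr_sqrtr ?ltW.
have Nlow : 1 - r / 2 <= N.
  have : 1 - r / 2 <= N ^+ 2 by rewrite NN dvv2; lra.
  by case: (leP N 1) => N1; nra.
exists (fun i => if i == a then N^-1 *: v else e i); split.
  move=> i j; rewrite !inE.
  have eia x : x \in s -> (x == a) = false.
    by move=> sx; apply/eqP => xa; rewrite -xa sx in as_.
  case: eqP => [->|/eqP ia] /= si; case: eqP => [->|/eqP ja] /= sj.
  - by rewrite eqxx dotZl dotZr -NN mulr1n; field; rewrite gt_eqF.
  - by rewrite dotZl dotC dve// mulr0 eq_sym (negbTE ja).
  - by rewrite dotZr dve// mulr0 (negbTE ia).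
  - by rewrite eo.
move=> i; rewrite inE; case: eqP => [->|/eqP ia] /= si; last first.
  apply: (le_trans (eu i si)); rewrite -r'E; nra.
rewrite dotBl !dotBr !dotZl !dotZr (dotC v) -dvv -NN.
(* As <u_a, v> = |v|^2 = N^2, the squared distance from u_a to v / N is |u_a|^2 + 1 - 2 N. The lower
   bound on N^2 passes to N because N >= N^2 when N <= 1. *)
have -> : dot (u a) (u a) - N^-1 * N ^+ 2 - (N^-1 * N ^+ 2 - N^-1 * (N^-1 * N ^+ 2)) =
   dot (u a) (u a) + 1 - 2 * N by field; rewrite gt_eqF.
have h4 : 1 - (del + k%:R * (2 * del + 4 * r')) <= N.
  have : 1 - (del + k%:R * (2 * del + 4 * r')) <= N ^+ 2 by rewrite NN dvv2; lra.
  have h5 : 0 <= k%:R * (2 * del + 4 * r') by rewrite mulr_ge0//; lra.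
  by case: (leP N 1) => N1; nra.
have : 3 * del + 2 * (k%:R * (2 * del + 4 * r')) <= r.
  have kd : k%:R * del <= k%:R * r' by rewrite ler_wpM2l.
  have kr : 0 <= k%:R * r' by rewrite mulr_ge0// ltW.
  by rewrite -r'E; lra.
lra.
Qed.

Lemma ler_normXB (R : realDomainType) (x y : R) k : `|x| <= 1 -> `|y| <= 1 ->
  `|x ^+ k - y ^+ k| <= k%:R * `|x - y|.
Proof.
move=> x1 y1; elim: k => [|k IH]; first by rewrite !expr0 subrr normr0 mul0r.
have -> : x ^+ k.+1 - y ^+ k.+1 = x * (x ^+ k - y ^+ k) + (x - y) * y ^+ k.
  by rewrite !exprS; ring.
rewrite (le_trans (ler_normD _ _))// !normrM normrX -natr1 mulrDl mul1r lerD//.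
  by rewrite (le_trans _ IH)// ler_piMl.
by rewrite ler_piMr// exprn_ile1.
Qed.

(** * Orthant probabilities *)

Section FiniteUnions.
Context d (T : measurableType d) (R : realType) (mu : {measure set T -> \bar R}).
Context (I : finType) (C : I -> set T) (mC : forall i, measurable (C i)).

Lemma measurable_finall : measurable [set x | forall i, C i x].
Proof.
have -> : [set x | forall i, C i x] = \bigcap_(i in [set: I]) C i.
  by apply/seteqP; split => x /= h i *; [exact: h|exact: (h i)].
by apply: fin_bigcap_measurable => //; exact: finite_finset.
Qed.

Lemma measurable_finex : measurable [set x | exists i, C i x].
Proof.
have -> : [set x | exists i, C i x] = \bigcup_(i in [set: I]) C i.
  by apply/seteqP; split => x /= -[i]; exists i.
by apply: fin_bigcup_measurable => //; exact: finite_finset.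
Qed.

Lemma measure_finex_le : (mu [set x | exists i, C i x] <= \sum_i mu (C i))%E.
Proof.
suff H (s : seq I) : measurable [set x | exists2 i, i \in s & C i x] /\
    (mu [set x | exists2 i, i \in s & C i x] <= \sum_(i <- s) mu (C i))%E.
  have [_ le] := H (index_enum I); apply: le_trans le.
  apply: le_measure; rewrite ?inE; [exact: measurable_finex|by case: (H (index_enum I))|].
  by move=> x [i Ci]; exists i => //; rewrite mem_index_enum.
elim: s => [|k s [mH IH]].
  suff -> : [set x | exists2 i, i \in [::] & C i x] = set0.
    by rewrite measure0 big_nil; split.
  by apply/seteqP; split => x //= -[].
have -> : [set x | exists2 i, i \in k :: s & C i x] = C k `|` [set x | exists2 i, i \in s & C i x].
  apply/seteqP; split => x /=.
    by move=> [i]; rewrite inE => /orP[/eqP->|si Ci]; [left|right; exists i].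
  by move=> [Ck|[i si Ci]]; [exists k; rewrite ?inE ?eqxx|exists i; rewrite ?inE ?si ?orbT].
split; first exact: measurableU.
by rewrite big_cons (le_trans (measureU2 _ _ _))// leeD2l.
Qed.

End FiniteUnions.

Section Orthants.
Context {R : realType}.
Local Notation gamma := (normal_prob (0 : R) 1).

Lemma measurable_dot_le n (u : 'cV[R]_n) (t : R) :
  measurable [set x : Borel 'cV[R]_n | dot u x <= t].
Proof.
rewrite (_ : [set x | _] = setT `&` dot u @^-1` `]-oo, t]%classic).
  exact: measurable_dot.
by rewrite setTI; apply/seteqP; split => x /=; rewrite in_itv/=.
Qed.

Lemma measurable_dot_ge n (u : 'cV[R]_n) (t : R) :
  measurable [set x : Borel 'cV[R]_n | t <= dot u x].
Proof.
rewrite (_ : [set x | _] = setT `&` dot u @^-1` `[t, +oo[%classic).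
  exact: measurable_dot.
by rewrite setTI; apply/seteqP; split => x /=; rewrite in_itv/= andbT.
Qed.

Lemma std_normal_orthonormal_orthant n (mu : probability (Borel 'cV[R]_n) R)
    (I : finType) (e : I -> 'cV[R]_n) (t : R) : std_normal_vec mu ->
  (forall i j, dot (e i) (e j) = (i == j)%:R) -> `|t| <= 2^-1 ->
  ((2^-1 ^+ #|I| - #|I|%:R * `|t|)%:E <= mu [set x | forall i, (dot (e i) x <= t)%R]
    <= (2^-1 ^+ #|I| + #|I|%:R * `|t|)%:E)%E.
Proof.
move=> hmu eo t2.
have := @std_normal_orthonormal R n mu hmu I e (fun=> `]-oo, t]%classic) eo (fun=> measurable_itv _).
have -> : [set x : 'cV[R]_n | forall i : I, `]-oo, t]%classic (dot (e i) x)] =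
    [set x : 'cV[R]_n | forall i, dot (e i) x <= t].
  by apply/seteqP; split => x /= h i; have := h i; rewrite in_itv.
move=> ->.
have := normal_prob_le_half t.
have := fineK (fin_num_measure gamma `]-oo, t]%classic ltac:(by [])).
set g := fine _ => <-; rewrite !lee_fin => /andP[g1 g2].
rewrite prodEFin !lee_fin prodr_const.
have g01 : `|g| <= 1 by rewrite ler_norml; lra.
have h : `|g - 2^-1| <= `|t| by rewrite ler_norml; lra.
have := @ler_normXB R g 2^-1 #|I| g01 ltac:(by rewrite ger0_norm; lra).
move=> /le_trans /(_ (ler_wpM2l (ler0n _ _) h)).
rewrite ler_norml; lra.
Qed.

(** Gram-Schmidt replaces u by an orthonormal family. The differences <u_i - e_i, x> have variance
    at most r and stay below tau except with probability e1 each, so the two orthants compare after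
    moving t by tau. *)
Lemma std_normal_orthant k (e : R) : 0 < e ->
  exists2 kap : R, 0 < kap &
  forall n (mu : probability (Borel 'cV[R]_n) R), std_normal_vec mu ->
  forall (I : finType) (u : I -> 'cV[R]_n) (t : R), #|I| = k ->
  (forall i j, `|dot (u i) (u j) - (i == j)%:R| <= kap) -> `|t| <= kap ->
  ((2^-1 ^+ k - e)%:E <= mu [set x | forall i, (dot (u i) x <= t)%R]
    <= (2^-1 ^+ k + e)%:E)%E.
Proof.
move=> e0.
have k0 : 0 <= k%:R :> R by rewrite ler0n.
have kS : k.+1%:R = k%:R + 1 :> R by rewrite -natr1.
(* The total error is k e1 for the tails plus at most 2 k tau for the moved threshold, and tau <=
   e1. *)
pose e1 := e / (4 * k.+1%:R).
have e10 : 0 < e1 by rewrite divr_gt0// mulr_gt0// ltr0n.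
have e1E : e1 * (4 * (k%:R + 1)) = e by rewrite -kS /e1 divfK// gt_eqF// mulr_gt0// ltr0n.
pose tau := Num.min e1 4^-1.
have tau0 : 0 < tau by rewrite lt_min e10 invr_gt0 ltr0n.
have taue : tau <= e1 by rewrite ge_min lexx.
have tau4 : tau <= 4^-1 by rewrite ge_min lexx orbT.
(* With |w|^2 <= r <= l^-2, the Chernoff exponent l^2 |w|^2 / 2 - l tau is at most - |ln e1| <= ln
   e1. *)
pose l := (2^-1 + `|ln e1|) / tau.
have l0 : 0 < l by rewrite divr_gt0// ltr_wpDr// invr_gt0.
pose r := Num.min 1 (l ^- 2).
have r01 : 0 < r <= 1 by rewrite lt_min ltr01 invr_gt0 exprn_gt0//= ge_min lexx.
have [del /andP[del0 del1] hd] := gram_schmidt_approx k r01.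
exists (Num.min del tau); first by rewrite lt_min del0.
move=> n mu hmu I u t Ik uo tk.
have {}tk : `|t| <= tau by rewrite (le_trans tk)// ge_min lexx orbT.
have [||i j _ _|e_ [eo eu]] := hd n I u (index_enum I).
- by rewrite -Ik cardE enumT.
- exact: index_enum_uniq.
- by rewrite (le_trans (uo _ _))// ge_min lexx.
have {}eo i j : dot (e_ i) (e_ j) = (i == j)%:R by rewrite eo ?mem_index_enum.
have {}eu i : dot (u i - e_ i) (u i - e_ i) <= r by rewrite eu ?mem_index_enum.
have tail (w : 'cV[R]_n) : dot w w <= r -> (mu [set x | (tau <= dot w x)%R] <= e1%:E)%E.
  move=> wr; apply: (le_trans (std_normal_chernoff hmu w tau (ltW l0))).
  rewrite lee_fin -[leRHS]lnK ?posrE// ler_expR.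
  have -> : l * tau = 2^-1 + `|ln e1| by rewrite /l divfK// gt_eqF.
  have : l ^+ 2 * dot w w <= 1.
    have : dot w w <= l ^- 2 by rewrite (le_trans wr)// ge_min lexx orbT.
    by rewrite -(ler_pM2l (exprn_gt0 2 l0)) divff// gt_eqF// exprn_gt0.
  have := ler_norm (- ln e1); rewrite normrN; lra.
(* Stated for arbitrary families: the lower bound passes from the orthonormal family to u, the upper
   bound from u to the orthonormal family. *)
have union (w w' : I -> 'cV[R]_n) (a b : R) : b = a + tau ->
    (forall i, dot (w' i - w i) (w' i - w i) <= r) ->
    (mu [set x | forall i, (dot (w i) x <= a)%R] <=
     mu [set x | forall i, (dot (w' i) x <= b)%R] + (k%:R * e1)%:E)%E.
  move=> ba ww.
  apply: (@le_trans _ _ (mu ([set x | forall i, (dot (w' i) x <= b)%R] `|`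
      [set x | exists i, (tau <= dot (w' i - w i) x)%R]))).
    apply: le_measure; rewrite ?inE.
    - by apply: measurable_finall => i; exact: measurable_dot_le.
    - apply: measurableU.
        by apply: measurable_finall => i; exact: measurable_dot_le.
      by apply: measurable_finex => i; exact: measurable_dot_ge.
    move=> x /= h; case: (pselect (exists i, tau <= dot (w' i - w i) x)) => ex; [by right|left].
    move=> i; have := h i; case: (leP tau (dot (w' i - w i) x)) => h1; first by case: ex; exists i.
    by move: h1; rewrite dotBl; lra.
  rewrite (le_trans (measureU2 _ _ _))//.
  - by apply: measurable_finall => i; exact: measurable_dot_le.
  - by apply: measurable_finex => i; exact: measurable_dot_ge.
  apply: leeD => //; apply: (le_trans (measure_finex_le _ _)).
    by move=> i; exact: measurable_dot_ge.
  apply: (@le_trans _ _ (\sum_(i : I) e1%:E)%E).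
    by apply: lee_sum => i _; exact: tail.
  by rewrite sumEFin sumr_const Ik mulr_natl.
have ke : k%:R * e1 <= e / 4 by rewrite -e1E; lra.
have tt (a : R) : `|a| <= tau + tau -> k%:R * `|a| <= e / 2.
  by move=> at2; rewrite (@le_trans _ _ (k%:R * (e1 + e1)))//; [rewrite ler_wpM2l//;
    lra|rewrite -e1E; lra].
move: tk; rewrite ler_norml => /andP[t1 t2].
apply/andP; split.
  have tm : `|t - tau| <= tau + tau by rewrite ler_norml; lra.
  have := union e_ u (t - tau) t ltac:(by rewrite subrK) eu.
  have /andP[+ _] := std_normal_orthonormal_orthant (t := t - tau) hmu eo ltac:(lra).
  move=> /le_trans h /h; rewrite Ik.
  have mA : measurable [set x : Borel 'cV[R]_n | forall i, dot (u i) x <= t].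
    by apply: measurable_finall => i; exact: measurable_dot_le.
  have := fineK (fin_num_measure mu _ mA); set m := fine _ => <-; rewrite -EFinD !lee_fin.
  by have := tt _ tm; lra.
have tm : `|t + tau| <= tau + tau by rewrite ler_norml; lra.
apply: (le_trans (union u e_ t (t + tau) erefl _)).
  by move=> i; rewrite -opprB dotNl dotNr opprK.
have /andP[_ +] := std_normal_orthonormal_orthant (t := t + tau) hmu eo ltac:(lra).
rewrite Ik => h; apply: (le_trans (leeD h (lexx _))).
by rewrite -EFinD lee_fin; have := tt _ tm; lra.
Qed.

End Orthants.

(** * The maximum test *)

Section Detection.
Context {R : realType}.

Lemma measurable_abs_dot_ge n (u v : 'cV[R]_n) (t : R) :
  measurable [set x : Borel 'cV[R]_n | t <= `|dot u (x + v)|].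
Proof.
rewrite (_ : [set x | _] = setT `&` (fun x => `|dot u (x + v)|) @^-1` `[t, +oo[%classic).
  have mf : measurable_fun setT (fun x : Borel 'cV[R]_n => `|dot u (x + v)|).
    apply: measurableT_comp => //.
    exact: (measurableT_comp (measurable_dot u) (measurable_translate v)).
  exact: mf.
by rewrite setTI; apply/seteqP; split => x /=; rewrite in_itv/= andbT.
Qed.

Lemma measurable_abs_dot_lt n (u v : 'cV[R]_n) (t : R) :
  measurable [set x : Borel 'cV[R]_n | `|dot u (x + v)| < t].
Proof.
rewrite (_ : [set x | _] = ~` [set x : Borel 'cV[R]_n | t <= `|dot u (x + v)|]).
  by apply: measurableC; exact: measurable_abs_dot_ge.
by apply/seteqP; split => x /=; rewrite ltNge => /negP.
Qed.

Lemma std_normal_abs_chernoff n (mu : probability (Borel 'cV[R]_n) R) (u : 'cV[R]_n)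
    (t l : R) : std_normal_vec mu -> 0 <= l ->
  (mu [set x | (t <= `|dot u x|)%R] <=
     (2 * expR (l ^+ 2 * dot u u / 2 - l * t))%:E)%E.
Proof.
move=> hmu l0.
apply: (@le_trans _ _ (mu ([set x | (t <= dot u x)%R] `|` [set x | (t <= dot (- u) x)%R]))).
  apply: le_measure; rewrite ?inE.
  - by have := measurable_abs_dot_ge u 0 t; under eq_set do rewrite addr0.
  - by apply: measurableU; exact: measurable_dot_ge.
  by move=> x /=; rewrite ler_normr dotNl => /orP[]; [left|right].
rewrite (le_trans (measureU2 _ _ _))//; try exact: measurable_dot_ge.
rewrite mulr2n mulrDl mul1r EFinD leeD//; first exact: std_normal_chernoff.
by apply: (le_trans (std_normal_chernoff hmu _ _ l0)); rewrite dotNl dotNr opprK.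
Qed.

(* The margin eta is a constant: exp (- a eta) then beats the union bound without the 1/a factor of
   the Mills ratio. *)
Lemma false_alarm (e : R) : 0 < e -> exists K : R,
  forall n (mu : probability (Borel 'cV[R]_n) R), std_normal_vec mu ->
  forall p (u : 'I_p -> 'cV[R]_n) (a eta del : R),
  0 <= a -> 0 <= eta <= a -> K <= a * eta -> 0 <= del -> del * a ^+ 2 <= 1 ->
  (p%:R <= expR (a ^+ 2 / 2)) ->
  (forall i, dot (u i) (u i) <= 1 + del) ->
  (mu [set x | exists i, (a + eta <= `|dot (u i) x|)%R] <= e%:E)%E.
Proof.
move=> e0; exists (2 - ln (e / 2)) => n mu hmu p u a eta del a0 /andP[eta0 etaa] Ka del0 dela pa uu.
have t0 : 0 <= a + eta by rewrite addr_ge0.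
apply: (le_trans (measure_finex_le _ _)).
  by move=> i; have := measurable_abs_dot_ge (u i) 0 (a + eta); under eq_set do rewrite addr0.
apply: (@le_trans _ _ (\sum_(i < p) (2 * (expR (- (a ^+ 2 / 2)) * (e / 2)))%:E)%E); last first.
  rewrite sumEFin sumr_const card_ord -(mulr_natr _ p) lee_fin.
  have : expR (- (a ^+ 2 / 2)) * p%:R <= 1.
    by rewrite expRN mulrC ler_pdivrMr ?expR_gt0// mul1r.
  set E := expR _ => Ep.
  have -> : 2 * (E * (e / 2)) * p%:R = e * (E * p%:R) by field.
  by rewrite ler_piMr// ltW.
apply: lee_sum => i _; apply: (le_trans (std_normal_abs_chernoff (u i) _ hmu t0)).
rewrite lee_fin ler_pM2l// -[e / 2]lnK ?posrE ?divr_gt0// -expRD ler_expR.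
have h1 := uu i.
have h2 : (a + eta) ^+ 2 * (dot (u i) (u i)) <= (a + eta) ^+ 2 * (1 + del).
  by rewrite ler_wpM2l// sqr_ge0.
have h3 : (a + eta) ^+ 2 * del <= 4 * (del * a ^+ 2).
  have : (a + eta) ^+ 2 <= 4 * a ^+ 2 by nra.
  nra.
nra.
Qed.

(** The mean of the i-th projection is b_i up to s max |b| del. For moderate coefficients, put the
    sign of b_i into w_i: a miss forces <w_i, x> <= eta + 2 a s del for every i in the support, an
    orthant event for s nearly orthonormal vectors. *)
Lemma missed_detection s (e : R) : 0 < e -> exists2 kap : R, 0 < kap & exists K : R,
  forall n (mu : probability (Borel 'cV[R]_n) R), std_normal_vec mu ->
  forall p (u : 'I_p -> 'cV[R]_n) (a eta del : R) (b : 'I_p -> R),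
  K <= a -> 0 <= eta <= kap -> 0 <= del -> del * a ^+ 2 <= kap ->
  (forall i j, `|dot (u i) (u j) - (i == j)%:R| <= del) ->
  #|[set i | b i != 0]%SET| = s -> (forall i, b i != 0 -> a <= `|b i|) ->
  (mu [set x | forall i, (`|dot (u i) (x + \sum_j b j *: u j)%R| < a + eta)%R]
     <= (2^-1 ^+ s + e)%:E)%E.
Proof.
move=> e0; have [kap0 kap00 horth] := std_normal_orthant s e0.
have s0 : 0 <= s%:R :> R by [].
have sS : s.+1%:R = s%:R + 1 :> R by rewrite -natr1.
(* Makes the threshold eta + 2 s a del at most kap0, and s del at most 1/4 for the cross terms. *)
pose kap := Num.min kap0 4^-1 / (4 * s.+1%:R).
have sS0 : 0 < 4 * s.+1%:R :> R by rewrite mulr_gt0// ltr0n.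
have m0 : 0 < Num.min kap0 4^-1 by rewrite lt_min kap00 invr_gt0 ltr0n.
have kappa0 : 0 < kap by rewrite divr_gt0.
have kapE : kap * (4 * (s%:R + 1)) = Num.min kap0 4^-1 by rewrite -sS /kap divfK// gt_eqF.
have kk0 : kap * (4 * (s%:R + 1)) <= kap0 by rewrite kapE ge_min lexx.
have kk4 : kap * (4 * (s%:R + 1)) <= 4^-1 by rewrite kapE ge_min lexx orbT.
have sk : 0 <= s%:R * kap by rewrite mulr_ge0// ltW.
(* The second constant serves a large coefficient: the exponent (1 + del) / 2 - a / 4 is then at
   most ln (e / 2). *)
exists kap => //; exists (Num.max 1 (4 * (1 - ln (e / 2)))).
move=> n mu hmu p u a eta del b; rewrite ge_max => /andP[a1 aK] /andP[eta0 etak] del0 dela uo bs ba.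
have delk : del <= kap by rewrite (le_trans _ dela)// ler_peMr// expr_ge1//; lra.
have dela1 : a * del <= kap by rewrite (le_trans _ dela)// mulrC ler_wpM2l// ler_eXnr.
set v := \sum_j b j *: u j.
have mE : measurable [set x : Borel 'cV[R]_n | forall i, `|dot (u i) (x + v)| < a + eta].
  by apply: measurable_finall => i; exact: measurable_abs_dot_lt.
have mean (B : R) i : (forall j, `|b j| <= B) -> `|dot (u i) v - b i| <= s%:R * (B * del).
  move=> bB.
  have -> : dot (u i) v - b i = \sum_(j | b j != 0) b j * (dot (u i) (u j) - (i == j)%:R).
    rewrite /v dot_sumr; under [RHS]eq_bigr do rewrite mulrBr; rewrite sumrB.
    congr (_ - _).
      rewrite [LHS](bigID (fun j => b j != 0))/= [X in _ + X]big1 ?addr0.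
        by apply: eq_bigr => j _; rewrite dotZr.
      by move=> j; rewrite negbK => /eqP ->; rewrite scale0r -(scale0r (u i)) dotZr mul0r.
    have [bi|bi] := eqVneq (b i) 0.
      rewrite bi big1// => j bj; case: eqP => [ij|_]; last by rewrite mulr0.
      by rewrite -ij bi eqxx in bj.
    rewrite (bigD1 i)//= eqxx mulr1 big1 ?addr0// => j /andP[_ ji].
    by rewrite eq_sym (negbTE ji) mulr0.
  rewrite (le_trans (ler_norm_sum _ _ _))//.
  apply: (@le_trans _ _ (\sum_(j | b j != 0) B * del)).
    by apply: ler_sum => j _; rewrite normrM ler_pM.
  by rewrite sumr_const mulr_natl -bs cardsE.
(* A coefficient of size 2a is detected on its own; otherwise all coefficients are at most 2a, and the
   cross terms 2 a s del are negligible. *)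
have [[k bk]|small] := pselect (exists k, 2 * a <= `|b k|).
  (* The largest coefficient is the one to test, because the cross terms scale with the maximum of
     |b|. *)
  pose k' := [arg max_(i > k) `|b i| ]%O.
  have kmax i : `|b i| <= `|b k'|.
    by rewrite /k'; case: Order.TotalTheory.arg_maxP => // j _ /(_ i isT).
  have bk' : 2 * a <= `|b k'| by exact: le_trans (kmax k).
  (* The mean is at least 3 |b k'| / 4 >= 3 a / 2 in absolute value; staying below a + eta takes
     noise of size a / 2 - eta >= a / 4. *)
  apply: (@le_trans _ _ (mu [set x | (a / 4 <= `|dot (u k') x|)%R])).
    apply: le_measure; rewrite ?inE//.
      by have := measurable_abs_dot_ge (u k') 0 (a / 4); under eq_set do rewrite addr0.
    move=> x /= /(_ k'); rewrite dotDr => hx.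
    have hm := mean _ k' kmax.
    have sd : s%:R * (`|b k'| * del) <= `|b k'| / 4.
      have : s%:R * del <= s%:R * kap by rewrite ler_wpM2l.
      have : 0 <= `|b k'| by [].
      nra.
    have h1 : `|b k'| <= `|dot (u k') v| + `|dot (u k') v - b k'|.
      by rewrite -[leLHS]normrN; have := ler_normB (dot (u k') v - b k') (dot (u k') v);
        rewrite addrAC subrr add0r normrN addrC.
    have h2 : `|dot (u k') v| <= `|dot (u k') x| + `|dot (u k') x + dot (u k') v|.
      by have := ler_normB (dot (u k') x + dot (u k') v) (dot (u k') x);
        rewrite addrAC subrr add0r addrC.
    lra.
  apply: (le_trans (std_normal_abs_chernoff (u k') _ hmu ler01)).
  rewrite lee_fin (@le_trans _ _ e)//; last by rewrite lerDr exprn_ge0.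
  have -> : e = 2 * (e / 2) by field.
  rewrite ler_pM2l// -[e / 2]lnK ?posrE ?divr_gt0// ler_expR.
  have := uo k' k'; rewrite eqxx mulr1n ler_norml expr1n => /andP[_ h1]; lra.
have {}small i : `|b i| <= 2 * a.
  by rewrite leNgt; apply/negP => h; apply: small; exists i; exact: ltW.
pose I : finType := {i : 'I_p | b i != 0}.
pose w (i : I) := Num.sg (b (val i)) *: u (val i).
have cI : #|I| = s by rewrite card_sig -bs cardsE.
have wo (i j : I) : `|dot (w i) (w j) - (i == j)%:R| <= kap0.
  apply: (@le_trans _ _ del); last by nra.
  rewrite /w dotZl dotZr.
  case: (eqVneq i j) => [->|ij].
    by have := uo (val j) (val j); rewrite eqxx mulrA -expr2 sqr_sg (valP j) mul1r.
  have := uo (val i) (val j); rewrite (inj_eq val_inj) (negbTE ij) !subr0.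
  by rewrite !normrM !normr_sg (valP i) (valP j) !mul1r.
pose t := eta + s%:R * (2 * a * del).
have tk : `|t| <= kap0.
  rewrite ger0_norm /t; last by rewrite addr_ge0// !mulr_ge0//; lra.
  have : s%:R * (a * del) <= s%:R * kap by rewrite ler_wpM2l.
  lra.
have /andP[_ h] := horth n mu hmu I w t cI wo tk.
apply: le_trans h; apply: le_measure; rewrite ?inE//.
  by apply: measurable_finall => i; exact: measurable_dot_le.
move=> x /= hx i; have := hx (val i); rewrite dotDr /w dotZl => hi.
have hm := mean _ (val i) small.
have hb := ba _ (valP i).
have := valP i; rewrite neq_lt => /orP[bi|bi].
  rewrite ltr0_sg// mulN1r; move: hi hm hb; rewrite (ltr0_norm bi) ltr_norml ler_norml /t; lra.
rewrite gtr0_sg// mul1r; move: hi hm hb; rewrite (gtr0_norm bi) ltr_norml ler_norml /t; lra.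
Qed.

End Detection.

(** * The Bayes lower bound *)

(* G is the truncated likelihood ratio of each alternative; k is the parameter of
   |y - c| <= k + (y - c)^2 / (4 k), applied to the average y of the G f. *)
Section SecondMoment.
Context d (T : measurableType d) (R : realType) (mu : probability T R).
Context (F : finType) (G : F -> T -> R) (phi : T -> R) (c e1 e2 k : R).

(** The integrand phi + (1 - phi) y is at least min (1, y), hence near c when y is near c in L^2.
    The two moment hypotheses give E (y - c)^2 <= 2 c e1 + e2. *)
Lemma second_moment_bound :
  (0 < #|F|)%N -> (forall f, measurable_fun setT (G f)) -> (forall f x, 0 <= G f x) ->
  measurable_fun setT phi -> (forall x, 0 <= phi x <= 1) ->
  0 < k <= c -> c <= 1 ->
  (forall f, (c - e1)%:E <= \int[mu]_x (G f x)%:E)%E ->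
  (\sum_f \sum_g \int[mu]_x (G f x * G g x)%:E <= (#|F|%:R ^+ 2 * (c ^+ 2 + e2))%:E)%E ->
  ((c - k - (2 * c * e1 + e2) / (4 * k))%:E <=
    \int[mu]_x (phi x)%:E + (#|F|%:R^-1)%:E * \sum_f \int[mu]_x ((1 - phi x) * G f x)%:E)%E.
Proof.
move=> F0 mG G0 mphi phi01 /andP[k0 kc] c1 hY hQ.
set M : R := #|F|%:R.
have M0 : 0 < M by rewrite ltr0n.
have c0 : 0 < c by exact: lt_le_trans kc.
have p0 x : 0 <= phi x by case/andP: (phi01 x).
have p1 x : 0 <= 1 - phi x by rewrite subr_ge0; case/andP: (phi01 x).
have m1p : measurable_fun setT (fun x => 1 - phi x) by exact: measurable_funB.
have mpG f : measurable_fun setT (fun x => ((1 - phi x) * G f x)%:E).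
  by apply/measurable_EFinP; exact: measurable_funM.
have mGG f g : measurable_fun setT (fun x => (G f x * G g x)%:E).
  by apply/measurable_EFinP; exact: measurable_funM.
have mGE f : measurable_fun setT (fun x => (G f x)%:E) by exact/measurable_EFinP.
have mphiE : measurable_fun setT (fun x => (phi x)%:E) by exact/measurable_EFinP.
pose y x := M^-1 * \sum_f G f x.
have my : measurable_fun setT y.
  by apply: measurable_funM => //; apply: measurable_sum.
have y0 x : 0 <= y x by rewrite /y mulr_ge0 ?invr_ge0 ?(ltW M0)//; apply: sumr_ge0.
have k4 : 0 < 4 * k by rewrite mulr_gt0.
(* This is phi + (1 - phi) y >= c - k - (y - c)^2 / (4 k), rearranged so that every term is
   nonnegative and integrates separately. It holds because y - c + 2 k (1 - phi) has a nonnegative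
   square. *)
have key x : (c - k) + c / (2 * k) * y x <=
    phi x + (1 - phi x) * y x + (4 * k)^-1 * (y x ^+ 2) + c ^+ 2 / (4 * k).
  have h1 : 0 <= (y x - c + 2 * k * (1 - phi x)) ^+ 2 by exact: sqr_ge0.
  have h2 : 0 <= 1 - (1 - phi x) ^+ 2 by have := p0 x; have := p1 x; nra.
  have h3 := p0 x; have h4 := y0 x.
  rewrite -(ler_pM2l k4).
  have -> : 4 * k * (c - k + c / (2 * k) * y x) = 4 * k * (c - k) + 2 * c * y x.
    by field; rewrite gt_eqF.
  have -> : 4 * k * (phi x + (1 - phi x) * y x + (4 * k)^-1 * y x ^+ 2 + c ^+ 2 / (4 * k)) =
     4 * k * (phi x + (1 - phi x) * y x) + y x ^+ 2 + c ^+ 2.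
    by field; rewrite gt_eqF.
  have h5 : 0 <= k * (phi x * (1 - c)) by rewrite !mulr_ge0//; lra.
  have h6 : 0 <= k ^+ 2 * (1 - (1 - phi x) ^+ 2) by rewrite mulr_ge0// sqr_ge0.
  nra.
have IY : (\int[mu]_x (y x)%:E = (M^-1)%:E * \sum_f \int[mu]_x (G f x)%:E)%E.
  under eq_integral do rewrite /y EFinM -sumEFin.
  rewrite ge0_integralZl//.
  - by rewrite ge0_integral_sum// => f x _; rewrite lee_fin.
  - by apply: emeasurable_sum.
  - by move=> x _; rewrite sumEFin lee_fin sumr_ge0.
  - by rewrite lee_fin invr_ge0 ltW.
have IP : (\int[mu]_x ((1 - phi x) * y x)%:E = (M^-1)%:E * \sum_f \int[mu]_x ((1 - phi x) * G f x)%:E)%E.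
  transitivity (\int[mu]_x ((M^-1)%:E * \sum_f ((1 - phi x) * G f x)%:E))%E.
    by apply: eq_integral => x _; rewrite /y mulrCA EFinM sumEFin mulr_sumr.
  rewrite ge0_integralZl//.
  - by rewrite ge0_integral_sum// => f x _; rewrite lee_fin mulr_ge0.
  - by apply: emeasurable_sum.
  - by move=> x _; rewrite sumEFin lee_fin sumr_ge0// => f _; rewrite mulr_ge0.
  - by rewrite lee_fin invr_ge0 ltW.
have IQ : (\int[mu]_x (y x ^+ 2)%:E = (M ^- 2)%:E * \sum_f \sum_g \int[mu]_x (G f x * G g x)%:E)%E.
  transitivity (\int[mu]_x ((M^-2)%:E * \sum_f \sum_g (G f x * G g x)%:E))%E.
    apply: eq_integral => x _; rewrite /y exprMn exprVn EFinM; congr (_ * _)%E.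
    rewrite expr2 mulr_suml -sumEFin; apply: eq_bigr => f _.
    by rewrite mulr_sumr sumEFin.
  rewrite ge0_integralZl//.
  - rewrite ge0_integral_sum//.
    + congr (_ * _)%E; apply: eq_bigr => f _.
      by rewrite ge0_integral_sum// => g x _; rewrite lee_fin mulr_ge0.
    + by move=> f; apply: emeasurable_sum.
    + by move=> f x _; rewrite sumEFin lee_fin sumr_ge0// => g _; rewrite mulr_ge0.
  - by apply: emeasurable_sum => f; apply: emeasurable_sum.
  - move=> x _; apply: sume_ge0 => f _; apply: sume_ge0 => g _.
    by rewrite lee_fin mulr_ge0.
  - by rewrite lee_fin invr_ge0 exprn_ge0// ltW.
have YY : ((c - e1)%:E <= \int[mu]_x (y x)%:E)%E.
  rewrite IY -(@lee_pmul2l _ M%:E)// [leRHS]muleA -[X in (_ <= X * _)%E]EFinM divff ?gt_eqF// mul1e.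
  apply: (@le_trans _ _ (\sum_(f : F) (c - e1)%:E)%E); last exact: lee_sum.
  by rewrite sumEFin sumr_const -EFinM mulr_natl lexx.
have QQ : (\int[mu]_x (y x ^+ 2)%:E <= (c ^+ 2 + e2)%:E)%E.
  rewrite IQ -(@lee_pmul2l _ (M ^+ 2)%:E)//; last by rewrite lte_fin exprn_gt0.
  by rewrite [leLHS]muleA -[X in (X * _ <= _)%E]EFinM divff ?mul1e -?EFinM// gt_eqF// exprn_gt0.
rewrite -IP.
have my2 : measurable_fun setT (fun x => (y x ^+ 2)%:E).
  by apply/measurable_EFinP; exact: measurable_funX.
have mpy : measurable_fun setT (fun x => ((1 - phi x) * y x)%:E).
  by apply/measurable_EFinP; exact: measurable_funM.
have myE : measurable_fun setT (fun x => (y x)%:E) by exact/measurable_EFinP.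
have key2 : ((c - k)%:E + (c / (2 * k))%:E * \int[mu]_x (y x)%:E <=
   \int[mu]_x (phi x)%:E + \int[mu]_x ((1 - phi x) * y x)%:E +
   ((4 * k)^-1)%:E * \int[mu]_x (y x ^+ 2)%:E + (c ^+ 2 / (4 * k))%:E)%E.
  have cst_int (r : R) : (\int[mu]_x (cst r%:E x) = r%:E)%E.
    transitivity (r%:E * mu setT)%E; [exact: (integral_cst mu measurableT r%:E)|by rewrite
      (@probability_setT _ _ R mu) mule1].
  have ck : 0 <= c / (2 * k) by rewrite divr_ge0//; lra.
  have ik : 0 <= (4 * k)^-1 by rewrite invr_ge0 ltW.
  have ck2 : 0 <= c ^+ 2 / (4 * k) by rewrite divr_ge0 ?sqr_ge0// ltW.
  have ck0 : 0 <= c - k by rewrite subr_ge0.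
  have my_ : measurable_fun setT (fun x => c / (2 * k) * y x) by exact: measurable_funM.
  have my2_ : measurable_fun setT (fun x => (4 * k)^-1 * y x ^+ 2).
    by apply: measurable_funM => //; exact: measurable_funX.
  have mpy_ : measurable_fun setT (fun x => (1 - phi x) * y x) by exact: measurable_funM.
  have int_addE (f g : T -> R) : measurable_fun setT f -> measurable_fun setT g ->
      (forall x, 0 <= f x) -> (forall x, 0 <= g x) ->
      (\int[mu]_x (f x + g x)%:E = \int[mu]_x (f x)%:E + \int[mu]_x (g x)%:E)%E.
    move=> mf mg f0 g0; under eq_integral do rewrite EFinD.
    by rewrite ge0_integralD//; [move=> x _; rewrite lee_fin|exact/measurable_EFinP|
      move=> x _; rewrite lee_fin|exact/measurable_EFinP].
  have int_scaleE (r : R) (f : T -> R) : 0 <= r -> measurable_fun setT f ->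
      (forall x, 0 <= f x) -> (\int[mu]_x (r * f x)%:E = r%:E * \int[mu]_x (f x)%:E)%E.
    move=> r0 mf f0; under eq_integral do rewrite EFinM.
    by rewrite ge0_integralZl//; [exact/measurable_EFinP|move=> x _; rewrite lee_fin].
  have HL : (\int[mu]_x ((c - k) + c / (2 * k) * y x)%:E =
      (c - k)%:E + (c / (2 * k))%:E * \int[mu]_x (y x)%:E)%E.
    rewrite (int_addE (fun=> c - k))//; last by move=> x; rewrite mulr_ge0.
    by rewrite int_scaleE//; congr (_ + _)%E; exact: (cst_int (c - k)).
  have HR : (\int[mu]_x (phi x + (1 - phi x) * y x + (4 * k)^-1 * (y x ^+ 2) + c ^+ 2 / (4 * k))%:E =
     \int[mu]_x (phi x)%:E + \int[mu]_x ((1 - phi x) * y x)%:E +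
     ((4 * k)^-1)%:E * \int[mu]_x (y x ^+ 2)%:E + (c ^+ 2 / (4 * k))%:E)%E.
    have q0 x : 0 <= (1 - phi x) * y x by rewrite mulr_ge0.
    have r0 x : 0 <= (4 * k)^-1 * y x ^+ 2 by rewrite mulr_ge0 ?sqr_ge0.
    rewrite (int_addE _ (fun=> c ^+ 2 / (4 * k)))//; last 2 first.
    - by apply: measurable_funD => //; exact: measurable_funD.
    - by move=> x; rewrite !addr_ge0.
    congr (_ + _)%E; last exact: (cst_int (c ^+ 2 / (4 * k))).
    rewrite (int_addE _ (fun x => (4 * k)^-1 * (y x ^+ 2)))//; last 2 first.
    - exact: measurable_funD.
    - by move=> x; rewrite addr_ge0.
    rewrite int_addE// int_scaleE//; last by move=> x; rewrite sqr_ge0.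
    exact: measurable_funX.
  rewrite -HL -HR; apply: ge0_le_integral => //.
  - by move=> x _; rewrite lee_fin addr_ge0// mulr_ge0.
  - by apply/measurable_EFinP; exact: measurable_funD.
  - by apply/measurable_EFinP; repeat apply: measurable_funD => //.
  - by move=> x _; rewrite lee_fin; exact: key.
set A := (\int[mu]_x (phi x)%:E + _)%E in key2 *.
have : ((c - k)%:E + (c / (2 * k))%:E * (c - e1)%:E <=
   A + (((4 * k)^-1 * (c ^+ 2 + e2))%:E + (c ^+ 2 / (4 * k))%:E))%E.
  apply: (le_trans (leeD2l _ (lee_wpmul2l _ YY))).
    by rewrite lee_fin divr_ge0//; lra.
  apply: (le_trans key2); rewrite addeA; apply: leeD => //; apply: leeD => //.
  by rewrite EFinM; apply: lee_wpmul2l => //; rewrite lee_fin invr_ge0 ltW.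
rewrite -EFinM -!EFinD -leeBlDr//.
apply: le_trans; rewrite -EFinB lee_fin.
rewrite le_eqVlt; apply/orP; left; apply/eqP; field.
by rewrite gt_eqF.
Qed.

End SecondMoment.

(* One spike a u_{i, f i} in each of s blocks of q columns, f uniform: the blocks make the
   overlaps of two draws independent. *)
Section BayesPrior.
Context {R : realType} {n s q : nat} (mu : probability (Borel 'cV[R]_n) R).
Context (hmu : std_normal_vec mu) (u : 'I_s -> 'I_q -> 'cV[R]_n) (a del eta : R).
Context (uo : forall i j i' j',
  `|dot (u i j) (u i' j') - ((i == i') && (j == j'))%:R| <= del).
Context (a0 : 0 <= a) (del0 : 0 <= del).
Local Notation prior := {ffun 'I_s -> 'I_q}.
Implicit Types f g : prior.

Definition direction f : 'cV[R]_n := \sum_i u i (f i).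

Definition overlap f g : nat := (\sum_i (f i == g i))%N.

Definition below f : set (Borel 'cV[R]_n) :=
  [set x | forall i, dot (u i (f i)) x <= a - eta].

(* Likelihood ratio of f truncated to below f; without truncation its second moment diverges. *)
Definition tilted f (x : 'cV[R]_n) : R :=
  \1_(below f) x * expR (dot (a *: direction f) x - dot (a *: direction f) (a *: direction f) / 2).

Lemma measurable_below f : measurable (below f).
Proof. by apply: measurable_finall => i; exact: measurable_dot_le. Qed.

Lemma measurable_tilted f : measurable_fun setT (tilted f : Borel 'cV[R]_n -> R).
Proof.
apply: measurable_funM; first by apply: measurable_indic; exact: measurable_below.
apply: measurableT_comp => //; apply: measurable_funB => //; exact: measurable_dot.
Qed.

Lemma tilted_ge0 f x : 0 <= tilted f x.
Proof. by rewrite mulr_ge0// expR_ge0. Qed.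

Lemma dot_direction f g i :
  `|dot (u i (f i)) (direction g) - (f i == g i)%:R| <= s%:R * del.
Proof.
have -> : dot (u i (f i)) (direction g) - (f i == g i)%:R =
   \sum_j (dot (u i (f i)) (u j (g j)) - ((i == j) && (f i == g j))%:R).
  rewrite sumrB /direction dot_sumr; congr (_ - _).
  rewrite (bigD1 i)//= eqxx /= big1 ?addr0// => j ji.
  by rewrite eq_sym (negbTE ji).
rewrite (le_trans (ler_norm_sum _ _ _))//.
apply: (@le_trans _ _ (\sum_(j < s) del)); first exact: ler_sum.
by rewrite sumr_const card_ord mulr_natl.
Qed.

Lemma dot_direction2 f g :
  dot (direction f) (direction g) <= (overlap f g)%:R + s%:R ^+ 2 * del.
Proof.
rewrite {1}/direction dot_suml /overlap natr_sum.
rewrite -lerBlDl -sumrB.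
apply: (@le_trans _ _ (\sum_(i < s) s%:R * del)).
  apply: ler_sum => i _; apply: le_trans (ler_norm _) (dot_direction f g i).
by rewrite sumr_const card_ord -[leLHS]mulr_natl mulrA -expr2.
Qed.

Lemma integral_indic_shift (D : set (Borel 'cV[R]_n)) (v : 'cV[R]_n) : measurable D ->
  (\int[mu]_x (\1_D x * expR (dot v x - dot v v / 2))%:E = mu [set x | D (x + v)%R])%E.
Proof.
move=> mD.
have := std_normal_shift hmu v (F := fun x => (\1_D x)%:E).
move=> /(_ _ _)/esym; under eq_integral do rewrite -EFinM; move=> ->.
- rewrite -[RHS]mule1 -[in RHS](setIT [set x | _]).
  have mDv : measurable [set x : Borel 'cV[R]_n | D (x + v)].
    rewrite -[X in measurable X]setTI; exact: (measurable_translate v).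
  rewrite mule1 -integral_indic//.
- by apply/measurable_EFinP; exact: measurable_indic.
- by move=> x; rewrite lee_fin.
Qed.

(** The mean of the truncated ratio is the probability of [below f] when f is the signal; each
    projection is then shifted by a up to s a del, so threshold a - eta becomes about - eta. *)
Lemma tilted_integral_ge f (c : R) :
  (c%:E <= mu [set x | forall i, (dot (u i (f i)) x <= - eta - s%:R * (a * del))%R])%E ->
  (c%:E <= \int[mu]_x (tilted f x)%:E)%E.
Proof.
move=> /le_trans; apply; rewrite integral_indic_shift; last exact: measurable_below.
apply: le_measure; rewrite ?inE.
- by apply: measurable_finall => i; exact: measurable_dot_le.
- rewrite -[X in measurable X]setTI; apply: (measurable_translate (a *: direction f)) => //.
  exact: measurable_below.
move=> x /= hx i; rewrite dotDr dotZr.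
have := dot_direction f f i; rewrite eqxx mulr1n ler_norml => /andP[_ h].
have h2 : a * dot (u i (f i)) (direction f) <= a * (1 + s%:R * del).
  by rewrite ler_wpM2l//; lra.
have := hx i; lra.
Qed.

(** Two likelihood ratios multiply to the ratio for the sum of the shifts, times the exponential of
    the inner product of the shifts, by expanding the square of the sum. *)
Lemma tilted_product f g :
  (\int[mu]_x (tilted f x * tilted g x)%:E =
   (expR (a ^+ 2 * dot (direction f) (direction g)))%:E *
   mu [set x | (below f `&` below g) (x + a *: (direction f + direction g))%R])%E.
Proof.
have mI : measurable (below f `&` below g) by apply: measurableI; exact: measurable_below.
rewrite -integral_indic_shift//.
set v := a *: (direction f + direction g).
have mF : measurable_fun setT
    (fun x : Borel 'cV[R]_n => (\1_(below f `&` below g) x * expR (dot v x - dot v v / 2))%:E).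
  apply/measurable_EFinP; apply: measurable_funM; first exact: measurable_indic.
  apply: measurableT_comp => //; apply: measurable_funB => //; exact: measurable_dot.
have F0 (x : Borel 'cV[R]_n) : [set: Borel 'cV[R]_n] x ->
    (0 <= (\1_(below f `&` below g) x * expR (dot v x - dot v v / 2))%:E)%E.
  by move=> _; rewrite lee_fin mulr_ge0// expR_ge0.
rewrite -(ge0_integralZl mu measurableT mF F0); last by rewrite lee_fin expR_ge0.
apply: eq_integral => x _; rewrite -EFinM; congr (_%:E).
rewrite /tilted indicI /= mulrACA [RHS]mulrCA -!expRD; congr (_ * expR _).
rewrite /v !dotZl !dotZr !dotDl !dotDr (dotC (direction g) (direction f)).
move: (dot _ _) (dot _ _) (dot _ _) (dot _ _) (dot _ _) => A B C D E. lra.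
Qed.

(** The shift by both directions counts the i-th spike of f once, or twice when f and g agree at
    i. *)
Lemma shifted_below f g x i :
  (below f) (x + a *: (direction f + direction g)) ->
  dot (u i (f i)) x <= a - eta - a * (1 + (f i == g i)%:R) + 2 * (s%:R * (a * del)).
Proof.
move=> /(_ i); rewrite dotDr dotZr dotDr.
have := dot_direction f f i; rewrite eqxx mulr1n ler_norml => /andP[h1 _].
have := dot_direction f g i; rewrite ler_norml => /andP[h2 _].
have h : a * (1 + (f i == g i)%:R - 2 * (s%:R * del)) <=
   a * (dot (u i (f i)) (direction f) + dot (u i (f i)) (direction g)).
  by rewrite ler_wpM2l//; lra.
lra.
Qed.

Lemma measurable_shifted_pair f g :
  measurable [set x : Borel 'cV[R]_n | (below f `&` below g) (x + a *: (direction f + direction g))].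
Proof.
rewrite -[X in measurable X]setTI.
apply: (measurable_translate (a *: (direction f + direction g))) => //.
by apply: measurableI; exact: measurable_below.
Qed.

(** Each of the k common coordinates needs noise below about - (a + eta). Chernoff with parameter a
    for their sum gives exp (k a^2 / 2 - k a (a + eta)), to be multiplied by exp (k a^2). The last
    factor collects the Gram errors, which add up to at most 7/2 s^2 del a^2. *)
Lemma tilted_product_overlap f g : (0 < overlap f g)%N ->
  (\int[mu]_x (tilted f x * tilted g x)%:E <=
   (expR (a ^+ 2 / 2 - a * eta) ^+ overlap f g * expR (4 * (s%:R ^+ 2 * (del * a ^+ 2))))%:E)%E.
Proof.
move=> k0; rewrite tilted_product; set k := overlap f g in k0 *.
(* The bound of [shifted_below] at a common coordinate, with the sign reversed. *)
pose tau := a + eta - 2 * (s%:R * (a * del)).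
pose w : 'cV[R]_n := \sum_(i | f i == g i) u i (f i).
have kE : k = #|[pred i | f i == g i]| .
  rewrite /k /overlap -sum1_card [RHS]big_mkcond; apply: eq_bigr => i _.
  by rewrite inE; case: (f i == g i).
have ks : k%:R <= s%:R :> R.
  by rewrite ler_nat kE -[X in (_ <= X)%N]card_ord max_card.
have s0 : 0 <= s%:R :> R by [].
have ww : dot w w <= k%:R + s%:R ^+ 2 * del.
  rewrite {1}/w dot_suml.
  apply: (@le_trans _ _ (\sum_(i | f i == g i) (1 + s%:R * del))).
    apply: ler_sum => i fgi; rewrite /w dot_sumr.
    rewrite -lerBlDl.
    apply: (@le_trans _ _ (\sum_(j | f j == g j) (dot (u i (f i)) (u j (f j)) - ((i == j) && (f i
      == f j))%:R))).
      rewrite sumrB lerD2l lerN2 (bigD1 i)//= !eqxx /= big1 ?addr0// => j /andP[_ ji].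
      by rewrite eq_sym (negbTE ji).
    apply: (@le_trans _ _ (\sum_(j | f j == g j) del)).
      by apply: ler_sum => j _; exact: le_trans (ler_norm _) (uo _ _ _ _).
    by rewrite sumr_const -kE -[leLHS]mulr_natl ler_wpM2r.
  rewrite sumr_const -kE -[leLHS]mulr_natl mulrDr mulr1 lerD2l expr2 -mulrA ler_wpM2r// mulr_ge0//.
have step : (mu [set x | (below f `&` below g) (x + a *: (direction f + direction g))%R] <=
   mu [set x | (k%:R * tau <= dot (- w) x)%R])%E.
  apply: le_measure; rewrite ?inE; [exact: measurable_shifted_pair|exact: measurable_dot_ge|].
  move=> x /= [hf _]; rewrite dotNl lerNr /w dot_suml.
  apply: (@le_trans _ _ (\sum_(i | f i == g i) (- tau))).
    apply: ler_sum => i fgi; apply: (le_trans (shifted_below i hf)).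
    by rewrite fgi mulr1n /tau; lra.
  by rewrite sumr_const -kE -[leLHS]mulr_natl mulrN.
apply: (@le_trans _ _ ((expR (a ^+ 2 * dot (direction f) (direction g)))%:E *
   (expR (a ^+ 2 * dot (- w) (- w) / 2 - a * (k%:R * tau)))%:E)%E).
  apply: lee_wpmul2l; first by rewrite lee_fin expR_ge0.
  by apply: (le_trans step); exact: std_normal_chernoff.
rewrite -EFinM -expRD lee_fin -expRM_natl -expRD ler_expR dotNl dotNr opprK.
have h1 : a ^+ 2 * dot (direction f) (direction g) <= a ^+ 2 * (k%:R + s%:R ^+ 2 * del).
  by rewrite ler_wpM2l ?sqr_ge0// dot_direction2.
have h2 : a ^+ 2 * dot w w <= a ^+ 2 * (k%:R + s%:R ^+ 2 * del).
  by rewrite ler_wpM2l ?sqr_ge0.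
have h3 : k%:R * (s%:R * (a ^+ 2 * del)) <= s%:R * (s%:R * (a ^+ 2 * del)).
  by rewrite ler_wpM2r// !mulr_ge0// sqr_ge0.
have h4 : 0 <= s%:R * (s%:R * (a ^+ 2 * del)) by rewrite !mulr_ge0// sqr_ge0.
have -> : a * (k%:R * tau) = k%:R * a ^+ 2 + k%:R * (a * eta) - 2 * (k%:R * (s%:R * (a ^+ 2 * del))).
  by rewrite /tau; ring.
lra.
Qed.

(** Without overlap the 2 s spikes form one nearly orthonormal family, indexed by a sum type, and
    both truncations together are a single orthant event; c will be close to 4^-s. *)
Lemma tilted_product_disjoint f g (c : R) : overlap f g = 0%N ->
  (forall (w : ('I_s + 'I_s)%type -> 'cV[R]_n),
     (forall i j, `|dot (w i) (w j) - (i == j)%:R| <= del) ->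
     (mu [set x | forall i, (dot (w i) x <= - eta + 2 * (s%:R * (a * del)))%R] <= c%:E)%E) ->
  (\int[mu]_x (tilted f x * tilted g x)%:E <=
     (expR (s%:R ^+ 2 * (del * a ^+ 2)) * c)%:E)%E.
Proof.
move=> k0 hc; rewrite tilted_product EFinM.
have fg i : (f i == g i) = false.
  by apply/eqP => fgi; have := k0; rewrite /overlap (bigD1 i)//= fgi eqxx.
pose w (i : ('I_s + 'I_s)%type) := match i with inl i => u i (f i) | inr i => u i (g i) end.
have hw : forall i j, `|dot (w i) (w j) - (i == j)%:R| <= del.
  move=> [i|i] [j|j] /=.
  - suff -> : (inl i == inl j :> 'I_s + 'I_s) = (i == j) && (f i == f j) by exact: uo.
    by apply/eqP/andP => [[->]|[/eqP-> _]].
  - suff ij : (i == j) && (f i == g j) = false by have := uo i (f i) j (g j); rewrite ij.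
    by apply/negbTE/negP => /andP[/eqP->]; rewrite fg.
  - suff ij : (i == j) && (g i == f j) = false by have := uo i (g i) j (f j); rewrite ij.
    by apply/negbTE/negP => /andP[/eqP->]; rewrite eq_sym fg.
  - suff -> : (inr i == inr j :> 'I_s + 'I_s) = (i == j) && (g i == g j) by exact: uo.
    by apply/eqP/andP => [[->]|[/eqP-> _]].
apply: lee_pmul => //.
- by rewrite lee_fin ler_expR mulrA mulrC ler_wpM2r ?sqr_ge0// (le_trans (dot_direction2 f g))// k0
  add0r.
- apply: le_trans (hc w hw); apply: le_measure; rewrite ?inE.
  + exact: measurable_shifted_pair.
  + by apply: measurable_finall => i; exact: measurable_dot_le.
  move=> x /= [hf hg] [i|i] /=.
    by apply: (le_trans (shifted_below i hf)); rewrite fg mulr0n; lra.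
  rewrite (addrC (direction f)) in hg; apply: (le_trans (shifted_below i hg)).
  by rewrite eq_sym fg mulr0n; lra.
Qed.

(** Generating function of the overlap: the blocks of g vary independently, and each contributes (q
    - 1) + (1 + z). *)
Lemma sum_overlap_weights f (z : R) : (0 < q)%N ->
  \sum_(g : prior) \prod_i (1 + z * (f i == g i)%:R) = (q%:R + z) ^+ s.
Proof.
move=> q0; rewrite -(bigA_distr_bigA (fun i j => 1 + z * (f i == j)%:R)).
rewrite (eq_bigr (fun=> q%:R + z)) ?prodr_const ?card_ord// => i _.
rewrite big_split/= sumr_const card_ord; congr (_ + _).
rewrite (bigD1 (f i))//= eqxx mulr1 big1 ?addr0// => j /negbTE ji.
by rewrite eq_sym ji mulr0.
Qed.

Lemma prod_overlap f g (z : R) :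
  \prod_i (1 + z * (f i == g i)%:R) = (1 + z) ^+ overlap f g.
Proof.
rewrite /overlap -prodrXr; apply: eq_bigr => i _.
by case: (f i == g i); rewrite ?mulr1 ?mulr0 ?addr0.
Qed.

(** The right-hand side vanishes for disjoint pairs and sums in closed form, so one expression can
    bound the second moments of all pairs. *)
Lemma overlap_weight_ge f g (z : R) : 0 <= z -> (0 < overlap f g)%N ->
  z ^+ overlap f g <= \prod_i (1 + z * (f i == g i)%:R) - 1.
Proof.
move=> z0.
rewrite prod_overlap; move: (overlap f g) => [//|k] _; elim: k => [|k IH]; first by rewrite !expr1; lra.
rewrite exprS [in leRHS]exprS.
have : 1 <= (1 + z) ^+ k.+1 by rewrite exprn_ege1// lerDl.
nra.
Qed.

End BayesPrior.

(** With z = exp (a^2 / 2 - a eta) <= 2 s q exp (- a eta), the overlap sum (q + z)^s exceeds q^s by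
    a factor close to 1: common coordinates are rare enough to pay for their large product. *)
Lemma bayes_risk_lower (R : realType) s (e : R) : 0 < e ->
  exists2 kap : R, 0 < kap & exists K : R,
  forall n (mu : probability (Borel 'cV[R]_n) R), std_normal_vec mu ->
  forall q (u : 'I_s -> 'I_q -> 'cV[R]_n) (a del : R) (phi : Borel 'cV[R]_n -> R),
  K <= a -> 0 <= del -> del * a ^+ 2 <= kap -> (0 < q)%N ->
  expR (a ^+ 2 / 2) <= 2 * s%:R * q%:R ->
  (forall i j i' j', `|dot (u i j) (u i' j') - ((i == i') && (j == j'))%:R| <= del) ->
  measurable_fun setT phi -> (forall x, 0 <= phi x <= 1) ->
  ((2^-1 ^+ s - e)%:E <= \int[mu]_x (phi x)%:E +
    ((q%:R ^+ s)^-1)%:E * \sum_(f : {ffun 'I_s -> 'I_q})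
      \int[mu]_x (1 - phi (x + a *: direction u f)%R)%:E)%E.
Proof.
move=> e0; pose c : R := 2^-1 ^+ s.
have c0 : 0 < c by rewrite exprn_gt0// invr_gt0.
have c1 : c <= 1 by rewrite exprn_ile1// invf_le1// ler1n.
pose k := Num.min c (e / 2).
have k0 : 0 < k by rewrite lt_min c0 divr_gt0.
have kc : k <= c by rewrite ge_min lexx.
have ke : k <= e / 2 by rewrite ge_min lexx orbT.
(* Since c <= 1, the loss (2 c e1 + e1) / (4 k) is at most 3 e / 8. *)
pose e1 := e * k / 2.
have e10 : 0 < e1 by rewrite divr_gt0// mulr_gt0.
(* The second moment errs by 3 e3 from disjoint pairs and 2 e3 from overlaps, which must stay below
   e1. *)
pose e3 := Num.min (e1 / 6) 1.
have e30 : 0 < e3 by rewrite lt_min ltr01 divr_gt0.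
have e31 : e3 <= 1 by rewrite ge_min lexx orbT.
have e36 : e3 <= e1 / 6 by rewrite ge_min lexx.
have [kapA kapA0 hA] := std_normal_orthant s e10.
have [kapB kapB0 hB] := std_normal_orthant (s + s) e30.
(* Target for the small exponents: the Gram errors and s z / q are kept below L, so that their
   exponentials are at most 1 + e3. *)
pose L := ln (1 + e3).
have L0 : 0 < L by rewrite ln_gt0//; lra.
have LE : expR L = 1 + e3 by rewrite lnK// posrE; lra.
pose m := Num.min kapA kapB.
have m0 : 0 < m by rewrite lt_min kapA0.
have mA : m <= kapA by rewrite ge_min lexx.
have mB : m <= kapB by rewrite ge_min lexx orbT.
pose eta := m / 2.
have eta0 : 0 < eta by rewrite divr_gt0.
have sN0 : 0 <= s%:R :> R by [].
have s40 : 0 < 4 * (s%:R + 1) :> R by lra.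
have s240 : 0 < 4 * (s%:R ^+ 2 + 1) :> R by have := sqr_ge0 (s%:R : R); lra.
pose kap := Num.min (m / (4 * (s%:R + 1))) (L / (4 * (s%:R ^+ 2 + 1))).
have kap0 : 0 < kap by rewrite lt_min !divr_gt0.
have kapm : kap * (4 * (s%:R + 1)) <= m by rewrite -ler_pdivlMr// ge_min lexx.
have kapL : kap * (4 * (s%:R ^+ 2 + 1)) <= L by rewrite -ler_pdivlMr// ge_min lexx orbT.
(* Gives s z / q <= 2 s^2 exp (- a eta) <= 2 s^2 / (a eta) <= L. *)
exists kap => //; exists (Num.max 1 (2 * s%:R ^+ 2 / (eta * L))).
move=> n mu hmu q u a del phi; rewrite ge_max => /andP[a1 aK] del0 dela q0 qa uo mphi phi01.
have a0 : 0 <= a by exact: le_trans ler01 a1.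
have delk : del <= kap by rewrite (le_trans _ dela)// ler_peMr// expr_ge1//; lra.
have dela1 : a * del <= kap by rewrite (le_trans _ dela)// mulrC ler_wpM2l// ler_eXnr.
have ad0 : 0 <= a * del by rewrite mulr_ge0.
have sk : 0 <= s%:R * kap by rewrite mulr_ge0// ltW.
have sad : s%:R * (a * del) <= s%:R * kap by rewrite ler_wpM2l.
have sad0 : 0 <= s%:R * (a * del) by rewrite mulr_ge0.
have s2k : 4 * (s%:R ^+ 2 * (del * a ^+ 2)) <= L.
  have : s%:R ^+ 2 * (del * a ^+ 2) <= s%:R ^+ 2 * kap by rewrite ler_wpM2l// sqr_ge0.
  by move=> h; clear -h kapL kap0; lra.
have s2k0 : 0 <= s%:R ^+ 2 * (del * a ^+ 2) by rewrite !mulr_ge0// sqr_ge0.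
have cardP : #|{ffun 'I_s -> 'I_q}|%:R = q%:R ^+ s :> R by rewrite card_ffun !card_ord natrX.
have qs0 : 0 < q%:R ^+ s :> R by rewrite exprn_gt0// ltr0n.
pose G (f : {ffun 'I_s -> 'I_q}) := tilted u a eta f.
have mean (f : {ffun 'I_s -> 'I_q}) : ((c - e1)%:E <= \int[mu]_x (G f x)%:E)%E.
  apply: (tilted_integral_ge hmu uo a0).
  have uo' (i j : 'I_s) : `|dot (u i (f i)) (u j (f j)) - (i == j)%:R| <= kapA.
    apply: (@le_trans _ _ del); last by clear -delk kapm mA sk kap0; lra.
    have := uo i (f i) j (f j); suff -> : (i == j) && (f i == f j) = (i == j) by [].
    by case: eqP => // ->; rewrite eqxx.
  have t0 : `|- eta - s%:R * (a * del)| <= kapA.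
    by rewrite ler_norml /eta; clear -sad sad0 kapm mA sk kap0 m0; lra.
  by have /andP[] := hA n mu hmu 'I_s (fun i => u i (f i)) _ (card_ord s) uo' t0.
pose z := expR (a ^+ 2 / 2 - a * eta).
have z0 : 0 <= z by exact: expR_ge0.
have pair (f g : {ffun 'I_s -> 'I_q}) : (\int[mu]_x (G f x * G g x)%:E <=
    ((c ^+ 2 + 3 * e3) + 2 * (\prod_i (1 + z * (f i == g i)%:R) - 1))%:E)%E.
  have [ov|ov] := posnP (overlap f g); last first.
    apply: (le_trans (tilted_product_overlap hmu eta uo a0 del0 ov)); rewrite lee_fin.
    have h1 := overlap_weight_ge (R := R) z0 ov.
    have h2 : expR (4 * (s%:R ^+ 2 * (del * a ^+ 2))) <= 2.
      by rewrite (@le_trans _ _ (expR L))// ?ler_expR// LE; clear -e31; lra.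
    have h3 : 0 <= z ^+ overlap f g by rewrite exprn_ge0.
    have h4 : z ^+ overlap f g * expR (4 * (s%:R ^+ 2 * (del * a ^+ 2))) <= z ^+ overlap f g * 2.
      by rewrite ler_wpM2l.
    have hc := sqr_ge0 c; rewrite -/z; clear -hc h1 h4 e30; lra.
  rewrite prod_overlap ov expr0 subrr mulr0 addr0.
  have D := tilted_product_disjoint hmu uo a0 (c := c ^+ 2 + e3) (eta := eta) ov.
  apply: (le_trans (D _)); last first.
    rewrite lee_fin; apply: (@le_trans _ _ ((1 + e3) * (c ^+ 2 + e3))).
      have ce : 0 <= c ^+ 2 + e3 by rewrite addr_ge0 ?sqr_ge0// ltW.
      by rewrite ler_wpM2r// -LE ler_expR; clear -s2k s2k0; lra.
    have : c ^+ 2 <= 1 by rewrite exprn_ile1// ltW.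
    have : 0 <= c ^+ 2 by exact: sqr_ge0.
    by move=> h1 h2; clear -h1 h2 e30 e31; nra.
  move=> w wo.
  have wo' i j : `|dot (w i) (w j) - (i == j)%:R| <= kapB.
    by apply: (le_trans (wo i j)); clear -delk kapm mB sk kap0; lra.
  have t0 : `|- eta + 2 * (s%:R * (a * del))| <= kapB.
    by rewrite ler_norml /eta; clear -sad sad0 kapm mB sk kap0 m0; lra.
  have cs : #|{: 'I_s + 'I_s}| = (s + s)%N by rewrite card_sum !card_ord.
  have /andP[_] := hB n mu hmu _ w _ cs wo' t0.
  by rewrite exprD -expr2.
have y1 : (q%:R + z) ^+ s <= q%:R ^+ s * (1 + e3).
  have q00 : 0 < q%:R :> R by rewrite ltr0n.
  have -> : q%:R + z = q%:R * (1 + z / q%:R) by field; rewrite gt_eqF.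
  rewrite exprMn ler_pM2l//.
  apply: (@le_trans _ _ (expR (z / q%:R) ^+ s)).
    by rewrite lerXn2r ?nnegrE ?addr_ge0 ?divr_ge0 ?expR_ge0// expR_ge1Dx.
  rewrite -expRM_natl -LE ler_expR.
  have zq : z / q%:R <= 2 * s%:R * expR (- (a * eta)).
    by rewrite ler_pdivrMr// /z expRD [leRHS]mulrAC ler_wpM2r// expR_ge0.
  have ae : 0 < a * eta by rewrite mulr_gt0//; exact: lt_le_trans a1.
  have exm : expR (- (a * eta)) <= (a * eta)^-1.
    rewrite expRN lef_pV2 ?posrE ?expR_gt0//.
    by apply: le_trans (expR_ge1Dx _); rewrite lerDr.
  apply: (@le_trans _ _ (s%:R * (2 * s%:R * (a * eta)^-1))).
    by rewrite ler_wpM2l// (le_trans zq)// ler_wpM2l// mulr_ge0.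
  have : 2 * s%:R ^+ 2 <= L * (a * eta).
    move: aK; rewrite ler_pdivrMr; last by rewrite mulr_gt0.
    by move=> h; clear -h; lra.
  by rewrite -ler_pdivrMr//; apply: le_trans; rewrite le_eqVlt; apply/orP; left; apply/eqP; ring.
have cst_sum (r : R) : \sum_(f : {ffun 'I_s -> 'I_q}) r = q%:R ^+ s * r.
  by rewrite sumr_const -cardP mulr_natl.
have Q : (\sum_(f : {ffun 'I_s -> 'I_q}) \sum_(g : {ffun 'I_s -> 'I_q}) \int[mu]_x (G f x * G g x)%:E <=
    (#|{ffun 'I_s -> 'I_q}|%:R ^+ 2 * (c ^+ 2 + e1))%:E)%E.
  apply: (@le_trans _ _ (\sum_(f : {ffun 'I_s -> 'I_q}) (q%:R ^+ s * (c ^+ 2 + e1))%:E)%E); last first.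
    by rewrite sumEFin cst_sum cardP lee_fin [(q%:R ^+ s) ^+ 2]expr2 mulrA.
  apply: lee_sum => f _.
  apply: (le_trans (lee_sum _ (fun g _ => pair f g))).
  rewrite sumEFin lee_fin big_split/= cst_sum -mulr_sumr sumrB cst_sum.
  rewrite sum_overlap_weights// mulr1.
  have : q%:R ^+ s * (5 * e3) <= q%:R ^+ s * e1 by rewrite ler_pM2l//; clear -e36 e30; lra.
  move: y1; clear; lra.
have mG (f : {ffun 'I_s -> 'I_q}) : measurable_fun setT (G f : Borel 'cV[R]_n -> R) by exact:
  measurable_tilted.
have G0 (f : {ffun 'I_s -> 'I_q}) x : 0 <= G f x by exact: tilted_ge0.
have P0 : (0 < #|{ffun 'I_s -> 'I_q}|)%N by rewrite -(ltr_nat R) cardP.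
have := second_moment_bound (mu := mu) (G := G) (phi := phi) (c := c) (e1 := e1) (e2 := e1) (k := k)
  P0 mG G0 mphi phi01 ltac:(by rewrite k0) c1 mean Q.
have ee : c - e <= c - k - (2 * c * e1 + e1) / (4 * k).
  have : (2 * c * e1 + e1) / (4 * k) <= e / 2; last by move=> h; clear -h ke; lra.
  rewrite ler_pdivrMr ?mulr_gt0// /e1.
  have : 0 <= e * k * (1 - c) by rewrite !mulr_ge0 ?subr_ge0// ltW.
  have : 0 < e * k by rewrite mulr_gt0.
  by move=> h1 h2; clear -h1 h2; lra.
move=> h; apply: (@le_trans _ _ (c - k - (2 * c * e1 + e1) / (4 * k))%:E); first by rewrite lee_fin.
apply: (le_trans h); rewrite cardP; apply: leeD => //.
apply: lee_wpmul2l; first by rewrite lee_fin invr_ge0 ltW.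
apply: lee_sum => f _.
have m1p : measurable_fun setT (fun x => (1 - phi x)%:E).
  by apply/measurable_EFinP; exact: measurable_funB.
have p0 x : (0 <= (1 - phi x)%:E)%E by rewrite lee_fin subr_ge0; case/andP: (phi01 x).
(* The mean under signal f carries the full likelihood ratio, which dominates the truncated one. *)
have := std_normal_shift hmu (a *: direction u f) m1p p0.
move=> ->; apply: ge0_le_integral => //.
- by move=> x _; rewrite lee_fin mulr_ge0// subr_ge0; case/andP: (phi01 x).
- by apply/measurable_EFinP; apply: measurable_funM => //; exact: measurable_funB.
- apply: emeasurable_funM => //; apply/measurable_EFinP; apply: measurableT_comp => //.
  by apply: measurable_funB => //; exact: measurable_dot.
move=> x _; rewrite -EFinM lee_fin /G /tilted ler_wpM2l//; first by have := p0 x; rewrite lee_fin.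
rewrite ler_piMl ?expR_ge0// indicE; case: (_ \in _) => //=.
Qed.

(** * Concentration of the Gram matrix *)

Lemma expR_le_quadratic (R : realType) (y : R) : expR y <= 1 + y + y ^+ 2 * expR `|y|.
Proof.
have [y0|y0] := leP 0 y.
  rewrite ger0_norm//; have e0 := expR_gt0 y.
  have [y1|y1] := leP 1 y.
    have : 1 <= y ^+ 2 by rewrite exprn_ege1.
    by nra.
  have : expR y * (1 - y) <= 1.
    rewrite -(ler_pM2l (expR_gt0 (- y))) mulrA -expRD addNr expR0 mul1r mulr1.
    exact: expR_ge1Dx.
  by nra.
rewrite ltr0_norm//; set v := - y; have -> : y = - v by rewrite opprK.
have v0 : 0 < v by rewrite oppr_gt0.
have h1 : expR (- v) * (1 + v) <= 1.
  by rewrite -(ler_pM2l (expR_gt0 v)) mulrA -expRD subrr expR0 mul1r mulr1 expR_ge1Dx.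
have e0 := expR_gt0 (- v).
have h2 : 1 <= expR v by rewrite -expR0 ler_expR ltW.
have h3 : expR (- v) <= 1 - v + v ^+ 2.
  have v3 : 0 <= v ^+ 3 by rewrite exprn_ge0// ltW.
  rewrite -(ler_pM2r (addr_gt0 ltr01 v0)); apply: (le_trans h1).
  have -> : (1 - v + v ^+ 2) * (1 + v) = 1 + v ^+ 3 by ring.
  by rewrite lerDl.
have := sqr_ge0 v; rewrite sqrrN; nra.
Qed.

Lemma sqr_le_expR (R : realType) (x : R) : 0 <= x -> x ^+ 2 <= 4 * expR x.
Proof.
move=> x0; have h : x / 2 <= expR (x / 2) by have := expR_ge1Dx (x / 2); lra.
have -> : expR x = expR (x / 2) ^+ 2 by rewrite expr2 -expRD -splitr.
have : (x / 2) ^+ 2 <= expR (x / 2) ^+ 2.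
  by rewrite lerXn2r ?nnegrE ?expR_ge0// divr_ge0.
by rewrite exprMn exprVn; lra.
Qed.

Section NormalMgf.
Context {R : realType}.
Local Notation gamma := (normal_prob (0 : R) 1).

Lemma normal_mgf (b : R) : (\int[gamma]_t (expR (b * t))%:E = (expR (b ^+ 2 / 2))%:E)%E.
Proof.
have := integral_normal_shift (R := R) b (h := cst 1%E) (@measurable_cst _ _ _ _ _ _) (fun=> lee01).
have -> : (\int[gamma]_t cst 1%E (t + b)%R = 1)%E.
  transitivity (1 * gamma setT)%E; first exact: (integral_cst gamma measurableT 1%E).
  by rewrite (@probability_setT _ _ R gamma) mule1.
move=> h; rewrite -[RHS]mule1 h -ge0_integralZl//; last 2 first.
- apply/measurable_EFinP; apply: measurable_funM => //; apply: measurableT_comp => //.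
  apply: measurable_funB => //; exact: measurable_funM.
- by move=> t _; rewrite mul1e lee_fin expR_ge0.
by apply: eq_integral => t _ /=; rewrite mul1e -EFinM -expRD; congr (expR _)%:E; lra.
Qed.

(** Multiplied by exp (t^2 / 4), the standard density becomes a multiple of the density of variance
    2. *)
Lemma normal_exp_sqr_finite : exists M : R,
  (\int[gamma]_t (expR (t ^+ 2 / 4))%:E <= M%:E)%E.
Proof.
pose r : R := normal_peak 1 / normal_peak (Num.sqrt 2).
have s2 : Num.sqrt 2 != 0 :> R by rewrite sqrtr_eq0 -ltNge.
exists r; rewrite integral_normal_prob//; last first.
  apply/measurable_EFinP; apply: measurableT_comp => //; apply: measurable_funM => //.
have p2 := normal_peak_gt0 s2.
rewrite (_ : r%:E = \int[lebesgue_measure]_x (r * normal_pdf 0 (Num.sqrt 2) x)%:E)%E; last first.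
  under eq_integral do rewrite EFinM.
  rewrite ge0_integralZl// ?integral_normal_pdf ?mule1//.
  - by apply/measurable_EFinP; exact: measurable_normal_pdf.
  - by move=> x _; rewrite lee_fin normal_pdf_ge0.
  - by rewrite lee_fin divr_ge0// normal_peak_ge0.
rewrite le_eqVlt; apply/orP; left; apply/eqP; apply: eq_integral => x _.
rewrite -EFinM; congr (_%:E); rewrite normal_pdf01 /normal_pdf (negbTE s2) /normal_fun subr0.
rewrite /r [RHS]mulrA divfK ?gt_eqF// mulrCA -expRD; congr (_ * expR _).
by rewrite sqr_sqrtr//; field.
Qed.

End NormalMgf.

Section SquareMgf.
Context {R : realType} d (Om : measurableType d) (P : probability Om R).

(* exp (Y^2 / (4 V)) is the average of exp (b Y t) over a standard normal t, with b^2 = 1 / (2 V). *)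
Lemma subgaussian_exp_sqr (Y : Om -> R) (V : R) : measurable_fun setT Y -> 0 < V ->
  (forall t : R, \int[P]_w (expR (t * Y w))%:E <= (expR (V * t ^+ 2 / 2))%:E)%E ->
  (\int[P]_w (expR (Y w ^+ 2 / (4 * V)))%:E <= \int[normal_prob (0 : R) 1]_t (expR (t ^+ 2 / 4))%:E)%E.
Proof.
move=> mY V0 hY.
pose b : R := Num.sqrt (2 * V)^-1.
have b2 : b ^+ 2 = (2 * V)^-1 by rewrite sqr_sqrtr// invr_ge0 mulr_ge0// ltW.
pose Q (wt : Om * measurableTypeR R) := (expR (b * Y wt.1 * wt.2))%:E.
have mQ : measurable_fun setT Q.
  apply/measurable_EFinP; apply: measurableT_comp => //; apply: measurable_funM => //.
  by apply: measurable_funM => //; exact: measurableT_comp.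
have Q0 wt : (0 <= Q wt)%E by rewrite lee_fin expR_ge0.
have -> : (\int[P]_w (expR (Y w ^+ 2 / (4 * V)))%:E =
    \int[P]_w \int[normal_prob (0 : R) 1]_t Q (w, t))%E.
  apply: eq_integral => w _; rewrite /Q /= normal_mgf exprMn b2; congr (expR _)%:E.
  by field; rewrite gt_eqF.
rewrite fubini_tonelli//; apply: ge0_le_integral => //.
- by move=> t _; apply: integral_ge0 => w _; exact: Q0.
- exact: measurable_fun_fubini_tonelli_G.
- apply/measurable_EFinP; apply: measurableT_comp => //; apply: measurable_funM => //.
move=> t _; rewrite /Q /=.
under eq_integral do rewrite mulrAC.
apply: (le_trans (hY (b * t))); rewrite lee_fin ler_expR exprMn b2.
rewrite le_eqVlt; apply/orP; left; apply/eqP; field.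
by rewrite gt_eqF.
Qed.

End SquareMgf.

(** Y^2 - 1 is centred, so the linear term of [expR_le_quadratic] integrates to 0, and the quadratic
    remainder is dominated by exp (Y^2 / (4 V)), whose mean has a universal bound. *)
Lemma square_mgf_bound (R : realType) (V : R) : 0 < V -> exists B l : R, [/\ 0 < B, 0 < l &
  forall d (Om : measurableType d) (P : probability Om R) (Y : Om -> R),
  measurable_fun setT Y -> (\int[P]_w (Y w ^+ 2)%:E = 1)%E ->
  (forall t : R, \int[P]_w (expR (t * Y w))%:E <= (expR (V * t ^+ 2 / 2))%:E)%E ->
  forall x : R, `|x| <= l ->
  (\int[P]_w (expR (x * (Y w ^+ 2 - 1)))%:E <= (expR (B * x ^+ 2))%:E)%E].
Proof.
move=> V0; have [M hM] := normal_exp_sqr_finite (R := R).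
have M0 : 0 <= M.
  rewrite -lee_fin; apply: le_trans hM; apply: integral_ge0 => t _.
  by rewrite lee_fin expR_ge0.
(* Two factors exp (l |Y^2 - 1|) arise, one from absorbing the square and one from the remainder; 2
   l = 1 / (4 V) makes their product integrable. *)
pose l : R := (8 * V)^-1.
have l0 : 0 < l by rewrite invr_gt0 mulr_gt0.
pose K : R := 4 / l ^+ 2 * expR (2 * l).
have K0 : 0 <= K by rewrite mulr_ge0 ?expR_ge0// divr_ge0// sqr_ge0.
exists (K * M + 1), l; split => //; first by rewrite ltr_wpDl// mulr_ge0.
move=> d Om P Y mY Y1 hY x xl.
have mY2 : measurable_fun setT (fun w => Y w ^+ 2) by exact: measurable_funX.
have E2 : (\int[P]_w (expR (Y w ^+ 2 / (4 * V)))%:E <= M%:E)%E.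
  exact: le_trans (subgaussian_exp_sqr mY V0 hY) hM.
have l2 : 2 * l = (4 * V)^-1 by rewrite /l; field; rewrite gt_eqF.
have key w : expR (x * (Y w ^+ 2 - 1)) <=
    1 + x * (Y w ^+ 2 - 1) + x ^+ 2 * K * expR (Y w ^+ 2 / (4 * V)).
  apply: (le_trans (expR_le_quadratic _)); rewrite lerD2l exprMn -[leLHS]mulrA -[leRHS]mulrA.
  rewrite ler_wpM2l ?sqr_ge0//.
  set z := Y w ^+ 2 - 1; have Y0 := sqr_ge0 (Y w).
  have zz : `|z| <= Y w ^+ 2 + 1 by rewrite /z ler_norml; lra.
  have h1 : (l * `|z|) ^+ 2 <= 4 * expR (l * `|z|) by apply: sqr_le_expR; rewrite mulr_ge0// ltW.
  have h2 : expR `|x * z| <= expR (l * `|z|) by rewrite ler_expR normrM ler_wpM2r.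
  have h3 : z ^+ 2 <= 4 / l ^+ 2 * expR (l * `|z|).
    rewrite -(ler_pM2l (exprn_gt0 2 l0)).
    have -> : l ^+ 2 * (4 / l ^+ 2 * expR (l * `|z|)) = 4 * expR (l * `|z|).
      by field; rewrite gt_eqF.
    by move: h1; rewrite exprMn real_normK// num_real.
  have h4 : expR (l * `|z|) * expR (l * `|z|) <= expR (2 * l) * expR (Y w ^+ 2 / (4 * V)).
    rewrite -!expRD ler_expR -l2.
    have : l * `|z| <= l * (Y w ^+ 2 + 1) by rewrite ler_wpM2l// ltW.
    lra.
  apply: (@le_trans _ _ (4 / l ^+ 2 * expR (l * `|z|) * expR (l * `|z|))).
    by apply: ler_pM => //; rewrite ?sqr_ge0 ?expR_ge0.
  rewrite -[leLHS]mulrA /K -[leRHS]mulrA ler_wpM2l//.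
  by rewrite divr_ge0// sqr_ge0.
have mE : measurable_fun setT (fun w => expR (Y w ^+ 2 / (4 * V))).
  by apply: measurableT_comp => //; apply: measurable_funM.
have mX : measurable_fun setT (fun w => expR (x * (Y w ^+ 2 - 1))).
  apply: measurableT_comp => //; apply: measurable_funM => //; exact: measurable_funB.
have int_addE (f g : Om -> R) : measurable_fun setT f -> measurable_fun setT g ->
    (forall w, 0 <= f w) -> (forall w, 0 <= g w) ->
    (\int[P]_w (f w + g w)%:E = \int[P]_w (f w)%:E + \int[P]_w (g w)%:E)%E.
  move=> mf mg f0 g0; under eq_integral do rewrite EFinD.
  by rewrite ge0_integralD//; [move=> ? _; rewrite lee_fin|exact/measurable_EFinP|
    move=> ? _; rewrite lee_fin|exact/measurable_EFinP].
have int_scaleE (r : R) (f : Om -> R) : 0 <= r -> measurable_fun setT f ->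
    (forall w, 0 <= f w) -> (\int[P]_w (r * f w)%:E = r%:E * \int[P]_w (f w)%:E)%E.
  move=> r0 mf f0; under eq_integral do rewrite EFinM.
  by rewrite ge0_integralZl//; [exact/measurable_EFinP|move=> ? _; rewrite lee_fin].
have cst_int (r : R) : (\int[P]_w (cst r%:E w) = r%:E)%E.
  transitivity (r%:E * P setT)%E; first exact: (integral_cst P measurableT r%:E).
  by rewrite (@probability_setT _ _ R P) mule1.
(* The sign of x is unknown: its negative part is moved across the inequality, so that only
   nonnegative functions are integrated. *)
pose xp := Num.max x 0; pose xm := Num.max (- x) 0.
have xp0 : 0 <= xp by rewrite le_max lexx orbT.
have xm0 : 0 <= xm by rewrite le_max lexx orbT.
have xE : x = xp - xm by rewrite /xp /xm /Num.max; case: ifP; case: ifP; lra.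
have xK0 : 0 <= x ^+ 2 * K by rewrite mulr_ge0// sqr_ge0.
have main : (\int[P]_w (expR (x * (Y w ^+ 2 - 1)) + (xp + xm * Y w ^+ 2))%:E <=
  \int[P]_w ((1 + xm) + (xp * Y w ^+ 2 + x ^+ 2 * K * expR (Y w ^+ 2 / (4 * V))))%:E)%E.
  apply: ge0_le_integral => //.
  - by move=> v _; rewrite lee_fin !addr_ge0 ?expR_ge0// mulr_ge0// sqr_ge0.
  - apply/measurable_EFinP; apply: measurable_funD => //; apply: measurable_funD => //.
    exact: measurable_funM.
  - apply/measurable_EFinP; apply: measurable_funD => //; apply: measurable_funD => //;
    exact: measurable_funM.
  - by move=> v _; rewrite lee_fin; have := key v; rewrite {2}xE; lra.
rewrite int_addE// in main; last 2 first.
- by apply: measurable_funD => //; exact: measurable_funM.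
- by move=> v; rewrite addr_ge0// mulr_ge0// sqr_ge0.
rewrite (int_addE (fun=> xp)) // in main; last 2 first.
- exact: measurable_funM.
- by move=> v; rewrite mulr_ge0// sqr_ge0.
rewrite (int_addE (fun=> 1 + xm)) // in main; last 3 first.
- by apply: measurable_funD => //; exact: measurable_funM.
- by move=> v; rewrite addr_ge0.
- by move=> v; apply: addr_ge0; apply: mulr_ge0; rewrite ?sqr_ge0 ?expR_ge0.
rewrite (int_addE (fun w => xp * _)) // in main; last 4 first.
- exact: measurable_funM.
- exact: measurable_funM.
- by move=> v; rewrite mulr_ge0// sqr_ge0.
- by move=> v; rewrite mulr_ge0// expR_ge0.
have sq0 w : 0 <= Y w ^+ 2 by rewrite sqr_ge0.
rewrite !int_scaleE// Y1 !mule1 in main.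
have c1 := cst_int xp; have c2 := cst_int (1 + xm); rewrite /= in c1 c2.
rewrite c1 c2 in main.
have {main} : (\int[P]_w (expR (x * (Y w ^+ 2 - 1)))%:E + (xp + xm)%:E <=
   (1 + xm + (xp + x ^+ 2 * K * M))%:E)%E.
  apply: (le_trans main); rewrite [leRHS]EFinD; apply: leeD => //; rewrite EFinD;
    apply: leeD => //; rewrite [leRHS]EFinM; exact: lee_wpmul2l.
rewrite -leeBrDr// -EFinB => /le_trans; apply; rewrite lee_fin.
have -> : 1 + xm + (xp + x ^+ 2 * K * M) - (xp + xm) = 1 + x ^+ 2 * (K * M) by ring.
apply: (le_trans _ (expR_ge1Dx _)); rewrite lerD2l mulrC ler_wpM2r ?sqr_ge0//.
by rewrite lerDl.
Qed.

(** * Independent rows *)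

Section Rows.
Context {R : realType} d (Om : measurableType d) (P : probability Om R) {n p : nat}.
Context (X : Om -> 'M[R]_(n, p)).
Hypothesis rX : random_matrix X.
Hypothesis iX : forall C : 'I_n -> set 'rV[R]_p, (forall i, borel (C i)) ->
  P [set w | forall i, C i (row i (X w))] = (\prod_(i < n) P [set w | C i (row i (X w))])%E.

Lemma measurable_random_matrix : measurable_fun setT (X : Om -> Borel 'M[R]_(n, p)).
Proof.
apply: measurable_fun_generated => U oU; apply: rX; exact: sub_sigma_algebra.
Qed.

Lemma measurable_random_entry i j : measurable_fun setT (fun w => X w i j).
Proof. exact: (measurableT_comp (measurable_coord i j) measurable_random_matrix). Qed.

Lemma measurable_row (i : 'I_n) :
  measurable_fun setT (row i : Borel 'M[R]_(n, p) -> Borel 'rV[R]_p).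
Proof.
apply: measurable_fun_Borel_mx => i' j; under eq_fun do rewrite mxE.
exact: measurable_coord.
Qed.

Lemma measurable_random_row (i : 'I_n) (C : set 'rV[R]_p) : borel C ->
  measurable [set w | C (row i (X w))].
Proof.
move=> bC; rewrite -[X in measurable X]setTI.
exact: (measurableT_comp (measurable_row i) measurable_random_matrix).
Qed.

Definition row_boxes : set (set 'M[R]_(n, p)) :=
  [set A | exists2 C : 'I_n -> set 'rV[R]_p, (forall i, borel (C i)) &
     A = [set x | forall i, C i (row i x)]].

Lemma row_boxes_setI : setI_closed row_boxes.
Proof.
move=> _ _ [B mB ->] [C mC ->]; exists (fun i => B i `&` C i).
  move=> i; exact: (@measurableI _ (Borel 'rV[R]_p) _ _ (mB i) (mC i)).
apply/seteqP; split => e /=; first by move=> [h1 h2] i; split; [apply: h1|apply: h2].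
by move=> h; split => i; case: (h i).
Qed.

Lemma row_boxes_setT : row_boxes setT.
Proof.
exists (fun=> setT); last by apply/seteqP; split.
by move=> i; exact: (@measurableT _ (Borel 'rV[R]_p)).
Qed.

Lemma measurable_fun_row_boxes (f : Borel 'M[R]_(n, p) -> \bar R) : measurable_fun setT f ->
  measurable_fun setT (f : g_sigma_algebraType row_boxes -> \bar R).
Proof.
move=> mf; have mi : measurable_fun setT (id : g_sigma_algebraType row_boxes -> Borel 'M[R]_(n, p)).
  apply: measurable_fun_Borel_mx => i j _ B mB; rewrite setTI.
  apply: sub_sigma_algebra.
  exists (fun i' => if i' == i then [set r : 'rV[R]_p | B (r ord0 j)] else setT).
    move=> i'; case: ifP => _; last exact: (@measurableT _ (Borel 'rV[R]_p)).
    have := @measurable_coord R 1 p ord0 j measurableT B mB; by rewrite setTI.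
  apply/seteqP; split => e /=.
    by move=> h i'; case: eqP => // -> /=; rewrite mxE.
  by move=> /(_ i); rewrite eqxx /= mxE.
exact: (measurableT_comp mf mi).
Qed.

Definition upd_row (k : 'I_n) (x y : 'M[R]_(n, p)) : 'M[R]_(n, p) :=
  \matrix_(i, j) (if i == k then y i j else x i j).

Lemma row_upd_row k x y i : row i (upd_row k x y) = if i == k then row i y else row i x.
Proof. by apply/rowP => j; rewrite !mxE; case: ifP => ik; rewrite mxE. Qed.

(** The row analogue of [std_normal_resample]: row k is taken from an independent copy of X, and
    independence of the rows shows that the law on row boxes is unchanged. *)
Lemma resample_row (k : 'I_n) (F : Borel 'M[R]_(n, p) -> \bar R) :
  measurable_fun setT F -> (forall x, 0 <= F x)%E ->
  (\int[P]_w F (X w) = \int[P]_w \int[P]_w' F (upd_row k (X w) (X w')))%E.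
Proof.
move=> mF F0.
have mupd : measurable_fun setT
    ((fun ww => upd_row k (X ww.1) (X ww.2)) : Om * Om -> Borel 'M[R]_(n, p)).
  apply: measurable_fun_Borel_mx => i j; case: (eqVneq i k) => ik.
    rewrite (_ : (fun ww => _) = (fun ww : Om * Om => X ww.2 k j)).
      exact: (measurableT_comp (measurable_random_entry k j) measurable_snd).
    by apply/funext => ww; rewrite mxE ik eqxx.
  rewrite (_ : (fun ww => _) = (fun ww : Om * Om => X ww.1 i j)); last first.
    by apply/funext => ww; rewrite mxE (negbTE ik).
  exact: (measurableT_comp (measurable_random_entry i j) measurable_fst).
have mbox A : row_boxes A -> measurable (A : set (Borel 'M[R]_(n, p))).
  move=> [C bC ->].
  have mC i : measurable ([set x | C i (row i x)] : set (Borel 'M[R]_(n, p))).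
    by have := measurable_row i measurableT (bC i); rewrite setTI.
  exact: measurable_finall mC.
rewrite (@eq_integral_pi_system _ _ _ Om (Om * Om)%type P (P \x P)%E
  _ row_boxes X (fun ww => upd_row k (X ww.1) (X ww.2)) F) //=.
- rewrite fubini_tonelli1//; exact: measurableT_comp mF mupd.
- by rewrite probability_setT ltry.
- exact: row_boxes_setI.
- exact: row_boxes_setT.
- move=> A /mbox mA; rewrite -[X in measurable X]setTI; exact: measurable_random_matrix.
- move=> A /mbox mA; rewrite -[X in measurable X]setTI; exact: mupd.
- move=> _ [C bC ->].
  transitivity (P [set w | forall i, C i (row i (X w))]) => //.
  rewrite iX//.
  pose C' i := if i == k then setT else C i.
  have bC' i : borel (C' i).
    by rewrite /C'; case: ifP => // _; exact: (@measurableT _ (Borel 'rV[R]_p)).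
  transitivity ((P \x P)%E ([set w | forall i, C' i (row i (X w))] `*` [set w | C k (row k (X w))])).
    rewrite product_measure1E //; last 2 first.
    - by apply: measurable_finall => i; exact: measurable_random_row.
    - exact: measurable_random_row.
    rewrite (bigD1 k)//= muleC; congr (_ * _)%E; apply/esym.
    rewrite [LHS](iX bC') (bigD1 k)//= {1}/C' eqxx.
    rewrite (_ : [set w | _] = setT); last by apply/seteqP; split.
    rewrite (@probability_setT _ _ R P) mul1e.
    by apply: eq_bigr => i /negbTE ik; rewrite /C' ik.
  congr ((P \x P)%E _); apply/seteqP; split => -[w w'] /=.
    move=> [h wB] i; rewrite row_upd_row; case: eqP => [->//|/eqP ik].
    by have := h i; rewrite /C' (negbTE ik).
  move=> h; split; last by have := h k; rewrite row_upd_row eqxx.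
  by move=> i; rewrite /C'; have := h i; rewrite row_upd_row; case: ifP.
- exact: measurable_fun_row_boxes.
Qed.

Lemma integral_prod_rows (h : Borel 'rV[R]_p -> R) :
  measurable_fun setT h -> (forall r, 0 <= h r) ->
  (\int[P]_w (\prod_(i < n) h (row i (X w)))%:E =
   \prod_(i < n) \int[P]_w (h (row i (X w)))%:E)%E.
Proof.
move=> mh h0.
suff H (s : seq 'I_n) : uniq s ->
  (\int[P]_w (\prod_(i <- s) h (row i (X w)))%:E =
   \prod_(i <- s) \int[P]_w (h (row i (X w)))%:E)%E by exact/H/index_enum_uniq.
have mhr i : measurable_fun setT (fun x : Borel 'M[R]_(n, p) => h (row i x)).
  exact: (measurableT_comp mh (measurable_row i)).
have mhX i : measurable_fun setT (fun w => h (row i (X w))).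
  exact: (measurableT_comp (mhr i) measurable_random_matrix).
elim: s => [_|k s IH /= /andP[ks us]].
  rewrite big_nil; under eq_integral do rewrite big_nil.
  transitivity (1 * P setT)%E; first exact: (integral_cst P measurableT 1%E).
  by rewrite (@probability_setT _ _ R P) mule1.
have mprod : measurable_fun setT (fun x : Borel 'M[R]_(n, p) => \prod_(i <- k :: s) h (row i x)).
  by apply: measurable_prod => i _.
have mprodX : measurable_fun setT (fun w => (\prod_(i <- s) h (row i (X w)))%:E).
  by apply/measurable_EFinP; apply: measurable_prod => i _.
rewrite (@resample_row k (fun x => (\prod_(i <- k :: s) h (row i x))%:E)); last 2 first.
- exact/measurable_EFinP.
- by move=> x; rewrite lee_fin prodr_ge0.
rewrite big_cons -(IH us).
have I0 : (0 <= \int[P]_w (h (row k (X w)))%:E)%E by apply: integral_ge0 => w _; rewrite lee_fin.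
transitivity (\int[P]_w (\int[P]_w' (h (row k (X w')))%:E * (\prod_(i <- s) h (row i (X w)))%:E))%E.
  apply: eq_integral => w _.
  transitivity (\int[P]_w' ((\prod_(i <- s) h (row i (X w)))%:E * (h (row k (X w')))%:E))%E.
    apply: eq_integral => w' _; rewrite big_cons row_upd_row eqxx EFinM muleC; congr (_%:E * _)%E.
    rewrite big_seq [RHS]big_seq; apply: eq_bigr => i si.
    rewrite row_upd_row; case: eqP => // ik; by rewrite -ik si in ks.
  rewrite ge0_integralZl// 1?muleC//; first exact/measurable_EFinP.
  - by move=> w' _; rewrite lee_fin.
  - by rewrite lee_fin prodr_ge0.
have IH0 w : [set: Om] w -> (0 <= (\prod_(i <- s) h (row i (X w)))%:E)%E.
  by move=> _; rewrite lee_fin prodr_ge0.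
by rewrite (ge0_integralZl P measurableT mprodX IH0 I0).
Qed.

End Rows.

Lemma exponential_markov (R : realType) d (Om : measurableType d) (P : probability Om R)
    (Z : Om -> R) (r : R) : measurable_fun setT Z ->
  (P [set w | (r <= Z w)%R] <= (expR (- r))%:E * \int[P]_w (expR (Z w))%:E)%E.
Proof.
move=> mZ.
have mA : measurable [set w | r <= Z w].
  rewrite (_ : [set w | _] = setT `&` Z @^-1` `[r, +oo[%classic); first exact: mZ.
  by rewrite setTI; apply/seteqP; split => x /=; rewrite in_itv/= andbT.
have me : measurable_fun setT (fun w => (expR (Z w))%:E).
  by apply/measurable_EFinP; exact: measurableT_comp.
have e0 w : [set: Om] w -> (0 <= (expR (Z w))%:E)%E by move=> _; rewrite lee_fin expR_ge0.
have c0 : (0 <= (expR (- r))%:E)%E by rewrite lee_fin expR_ge0.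
rewrite -(ge0_integralZl P measurableT me e0 c0).
rewrite -[in leLHS](setIT [set w | _]) -integral_indic//.
apply: ge0_le_integral => //.
- by apply/measurable_EFinP; exact: measurable_indic.
- exact: measurable_funeM.
move=> w _; rewrite -EFinM -expRD lee_fin indicE.
case: (boolP (w \in _)) => [|_]; last by rewrite expR_ge0.
by rewrite in_setE /= => rw; rewrite -[leLHS]expR0 ler_expR; lra.
Qed.

Section GramTail.
Context {R : realType} d (Om : measurableType d) (P : probability Om R) {n p : nat}.
Context (sigma2 : R) (X : Om -> 'M[R]_(n, p)) (hX : SubG P sigma2 X).

Let rX : random_matrix X. Proof. by case: hX. Qed.

Let mX i j : measurable_fun setT (fun w => X w i j).
Proof. exact: measurable_random_entry. Qed.

Definition lincomb (u : 'I_p -> R) (r : 'rV[R]_p) : R := \sum_(j < p) u j * r ord0 j.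

Lemma measurable_lincomb u : measurable_fun setT (lincomb u : Borel 'rV[R]_p -> R).
Proof.
by apply: measurable_sum => j; apply: measurable_funM => //; exact: measurable_coord.
Qed.

Let lincombE u w i : lincomb u (row i (X w)) = \sum_j u j * X w i j.
Proof. by apply: eq_bigr => j _; rewrite mxE. Qed.

Let mL u i : measurable_fun setT (fun w => lincomb u (row i (X w))).
Proof.
apply: (measurableT_comp (measurable_lincomb u)).
exact: (measurableT_comp (measurable_row i) (measurable_random_matrix rX)).
Qed.

(** [SubG] only gives values of integrals; linearity needs integrability, which the second moments
    provide through |x y| <= x^2 + y^2. *)
Let integrable_entries i j k : P.-integrable setT (fun w => (X w i j * X w i k)%:E).
Proof.
have [_ [_ [_ [hcov _]]]] := hX.
have sq l : P.-integrable setT (fun w => (X w i l * X w i l)%:E).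
  apply/integrableP; split; first by apply/measurable_EFinP; exact: measurable_funM.
  under eq_integral do rewrite gee0_abs ?lee_fin -?expr2 ?sqr_ge0// expr2.
  by rewrite hcov ltry.
apply: (@le_integrable _ _ _ P setT measurableT _
  (fun w => (X w i j * X w i j)%:E + (X w i k * X w i k)%:E)%E).
- by apply/measurable_EFinP; exact: measurable_funM.
- move=> w _; rewrite -EFinD /= lee_fin normrM.
  rewrite [leRHS]ger0_norm; last by rewrite addr_ge0// -expr2 sqr_ge0.
  have := sqr_ge0 (`|X w i j| - `|X w i k|).
  have := real_normK (num_real (X w i j)); have := real_normK (num_real (X w i k)).
  by have := sqr_ge0 (X w i j); have := sqr_ge0 (X w i k); nra.
- exact: integrableD.
Qed.

Lemma lincomb_second_moment u i : \sum_(j < p) u j ^+ 2 = 1 ->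
  (\int[P]_w (lincomb u (row i (X w)) ^+ 2)%:E = 1)%E.
Proof.
move=> u1; have [_ [_ [_ [hcov _]]]] := hX.
transitivity (\int[P]_w (\sum_(j < p) \sum_(k < p) (u j * u k)%:E * (X w i j * X w i k)%:E))%E.
  apply: eq_integral => w _; rewrite lincombE expr2 mulr_suml -sumEFin.
  apply: eq_bigr => j _; rewrite mulr_sumr -sumEFin; apply: eq_bigr => k _.
  by rewrite -EFinM mulrACA.
have int2 j k : P.-integrable setT (fun w => (u j * u k)%:E * (X w i j * X w i k)%:E)%E.
  exact: integrableZl.
rewrite integral_sum//; last by move=> j; exact: integrable_sum.
rewrite -u1 -sumEFin; apply: eq_bigr => j _.
rewrite integral_sum// (bigD1 j)//= integralZl// hcov eqxx mule1 big1 ?adde0.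
  by rewrite expr2.
by move=> k kj; rewrite integralZl// hcov eq_sym (negbTE kj) mule0.
Qed.

Definition quad_dev (u : 'I_p -> R) (w : Om) : R :=
  \sum_(i < n) (lincomb u (row i (X w)) ^+ 2 - 1).

Lemma measurable_quad_dev u : measurable_fun setT (quad_dev u).
Proof.
apply: measurable_sum => i; apply: measurable_funB => //; exact: measurable_funX.
Qed.

(** By independence the moment generating function of [quad_dev] is a product over rows; Chernoff at
    x and at -x accounts for the factor 2. *)
Lemma quad_dev_tail (V B l : R) : sigma2 <= V ->
  (forall Y : Om -> R, measurable_fun setT Y -> (\int[P]_w (Y w ^+ 2)%:E = 1)%E ->
  (forall t : R, \int[P]_w (expR (t * Y w))%:E <= (expR (V * t ^+ 2 / 2))%:E)%E ->
  forall x : R, `|x| <= l ->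
  (\int[P]_w (expR (x * (Y w ^+ 2 - 1)))%:E <= (expR (B * x ^+ 2))%:E)%E) ->
  forall (u : 'I_p -> R) (t x : R), \sum_(j < p) u j ^+ 2 = 1 -> 0 <= x <= l ->
  (P [set w | (n%:R * t <= `|quad_dev u w|)%R] <=
     (2 * expR (n%:R * (B * x ^+ 2 - x * t)))%:E)%E.
Proof.
move=> sV hB u t x u1 /andP[x0 xl].
have [_ [[_ hrows] [_ [_ [hsub _]]]]] := hX.
have one (y : R) : `|y| <= l ->
    (\int[P]_w (expR (y * quad_dev u w))%:E <= (expR (n%:R * (B * y ^+ 2)))%:E)%E.
  move=> yl; pose h (r : Borel 'rV[R]_p) := expR (y * (lincomb u r ^+ 2 - 1)).
  have mh : measurable_fun setT h.
    apply: measurableT_comp => //; apply: measurable_funM => //; apply: measurable_funB => //.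
    by apply: measurable_funX; exact: measurable_lincomb.
  have -> : (\int[P]_w (expR (y * quad_dev u w))%:E = \prod_(i < n) \int[P]_w (h (row i (X w)))%:E)%E.
    rewrite -(integral_prod_rows rX hrows mh); last by move=> r; exact: expR_ge0.
    by apply: eq_integral => w _; rewrite /quad_dev mulr_sumr expR_sum.
  have -> : expR (n%:R * (B * y ^+ 2)) = \prod_(i < n) expR (B * y ^+ 2).
    by rewrite prodr_const card_ord expRM_natl.
  rewrite -prodEFin.
  suff : (0 <= \prod_(i < n) \int[P]_w (h (row i (X w)))%:E /\
    \prod_(i < n) \int[P]_w (h (row i (X w)))%:E <= \prod_(i < n) (expR (B * y ^+ 2))%:E)%E by case.
  apply: (big_ind2 (fun a b : \bar R => (0 <= a)%E /\ (a <= b)%E)) => [|a b a' b' [a0 ab] [a'0 ab']|i _].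
  - by rewrite lee_fin ler01.
  - by split; [exact: mule_ge0|exact: lee_pmul].
  split; first by apply: integral_ge0 => w _; rewrite lee_fin expR_ge0.
  apply: (hB (fun w => lincomb u (row i (X w)))) => //.
    exact: lincomb_second_moment.
  move=> t'; under eq_integral do rewrite lincombE.
  apply: (le_trans (hsub i u u1 t')); rewrite lee_fin ler_expR ler_pM2r//.
  by rewrite ler_wpM2r// sqr_ge0.
have tail (y : R) : `|y| <= l -> (P [set w | (x * (n%:R * t) <= y * quad_dev u w)%R] <=
    (expR (n%:R * (B * y ^+ 2 - x * t)))%:E)%E.
  move=> yl; apply: (le_trans (exponential_markov P _ _)).
    by apply: measurable_funM => //; exact: measurable_quad_dev.
  apply: (le_trans (lee_wpmul2l _ (one y yl))); first by rewrite lee_fin expR_ge0.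
  rewrite -EFinM -expRD lee_fin ler_expR; lra.
have mq (y : R) : measurable [set w | (x * (n%:R * t) <= y * quad_dev u w)%R].
  rewrite (_ : [set w | _] = setT `&` (fun w => y * quad_dev u w) @^-1` `[x * (n%:R * t), +oo[%classic).
    have : measurable_fun setT (fun w => y * quad_dev u w).
      by apply: measurable_funM => //; exact: measurable_quad_dev.
    exact.
  by rewrite setTI; apply/seteqP; split => w /=; rewrite in_itv/= andbT.
apply: (@le_trans _ _ (P ([set w | (x * (n%:R * t) <= x * quad_dev u w)%R] `|`
   [set w | (x * (n%:R * t) <= (- x) * quad_dev u w)%R]))).
  apply: le_measure; rewrite ?inE.
  - rewrite (_ : [set w | _] = setT `&` (fun w => `|quad_dev u w|) @^-1` `[n%:R * t, +oo[%classic).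
      have : measurable_fun setT (fun w => `|quad_dev u w|).
        by apply: measurableT_comp => //; exact: measurable_quad_dev.
      exact.
    by rewrite setTI; apply/seteqP; split => w /=; rewrite in_itv/= andbT.
  - exact: measurableU.
  - move=> w /=; rewrite ler_normr => /orP[h|h]; [left|right]; first by rewrite ler_wpM2l.
    by rewrite mulNr -mulrN ler_wpM2l.
apply: (le_trans (measureU2 _ _ _)) => //.
rewrite mulr2n mulrDl mul1r EFinD; apply: leeD.
  by apply: tail; rewrite ger0_norm.
by rewrite -sqrrN; apply: tail; rewrite normrN ger0_norm.
Qed.

Lemma lincomb_delta j w i : lincomb (fun l => (l == j)%:R) (row i (X w)) = X w i j.
Proof.
rewrite lincombE (bigD1 j)//= eqxx mul1r big1 ?addr0// => l /negbTE ->.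
by rewrite mul0r.
Qed.

End GramTail.

(** A union bound over the p^2 entries. An off-diagonal entry is controlled by two quadratic
    deviations with two tails each, whence the 4. *)
Lemma gram_tail (R : realType) (sigma2 : R) : exists2 rho : R, 0 < rho &
  forall d (Om : measurableType d) (P : probability Om R) n p (X : Om -> 'M[R]_(n, p)),
  SubG P sigma2 X -> forall t : R, 0 < t <= 1 ->
  (P [set w | exists jk : 'I_p * 'I_p,
      (n%:R * t < `|\sum_i X w i jk.1 * X w i jk.2 - n%:R * (jk.1 == jk.2)%:R|)%R] <=
   ((p%:R ^+ 2) * (4 * expR (- (rho * (n%:R * t ^+ 2)))))%:E)%E.
Proof.
(* [sigma2] is an arbitrary real, while a positive V is divided by. *)
pose V := Num.max sigma2 1.
have V0 : 0 < V by rewrite lt_max ltr01 orbT.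
have sV : sigma2 <= V by rewrite le_max lexx.
have [B [l [B0 l0 hB]]] := square_mgf_bound V0.
(* The Chernoff parameter is x = r t: it stays within l as t <= 1, and B r <= 1/2 gives B x^2 - x t
   <= - r t^2 / 2. *)
pose r := Num.min l (2 * B)^-1.
have r0 : 0 < r by rewrite lt_min l0 invr_gt0 mulr_gt0.
have rl : r <= l by rewrite ge_min lexx.
have rB : B * r <= 2^-1.
  rewrite -(ler_pM2l (ltr0n _ 2)) mulrA mulfV// -ler_pdivlMl ?mulr_gt0// mulr1.
  by rewrite ge_min lexx orbT.
exists (r / 2); first by rewrite divr_gt0.
move=> d Om P n p X hX t /andP[t0 t1].
have rX : random_matrix X by case: hX.
have mXX (j k : 'I_p) : measurable_fun setT (fun w => `|\sum_i X w i j * X w i k - n%:R * (j == k)%:R|).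
  apply: measurableT_comp => //; apply: measurable_funB => //; apply: measurable_sum => i.
  by apply: measurable_funM; exact: measurable_random_entry.
have tail (u : 'I_p -> R) : \sum_(j < p) u j ^+ 2 = 1 ->
   (P [set w | (n%:R * t <= `|quad_dev X u w|)%R] <= (2 * expR (- (r / 2 * (n%:R * t ^+ 2))))%:E)%E.
  move=> u1; have Q := @quad_dev_tail _ _ _ _ _ _ _ _ hX V B l sV (hB d Om P) u t (r * t) u1.
  apply: (le_trans (Q _)).
    by apply/andP; split; [rewrite mulr_ge0// ltW|rewrite (le_trans _ rl)// ler_piMr// ltW].
  rewrite lee_fin ler_pM2l// ler_expR.
  have : n%:R * (t ^+ 2 * (r * (B * r))) <= n%:R * (t ^+ 2 * (r * 2^-1)).
    by rewrite ler_wpM2l// ler_wpM2l ?sqr_ge0// ler_wpM2l// ltW.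
  lra.
have mtail u : measurable [set w | (n%:R * t <= `|quad_dev X u w|)%R].
  rewrite (_ : [set w | _] = setT `&` (fun w => `|quad_dev X u w|) @^-1` `[n%:R * t, +oo[%classic).
    have : measurable_fun setT (fun w => `|quad_dev X u w|).
      by apply: measurableT_comp => //; exact: (measurable_quad_dev hX).
    exact.
  by rewrite setTI; apply/seteqP; split => w /=; rewrite in_itv/= andbT.
pose bad (jk : 'I_p * 'I_p) := [set w | (n%:R * t < `|\sum_i X w i jk.1 * X w i jk.2 - n%:R * (jk.1
  == jk.2)%:R|)%R].
have mbad jk : measurable (bad jk).
  rewrite (_ : bad jk = setT `&` (fun w => `|\sum_i X w i jk.1 * X w i jk.2 - n%:R * (jk.1 ==
    jk.2)%:R|) @^-1` `]n%:R * t, +oo[%classic).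
    exact: mXX.
  by rewrite setTI; apply/seteqP; split => w /=; rewrite in_itv/= andbT.
apply: (le_trans (measure_finex_le P (C := bad) mbad)).
set E := expR _.
apply: (@le_trans _ _ (\sum_(jk : 'I_p * 'I_p) (4 * E)%:E)%E); last first.
  by rewrite sumEFin sumr_const card_prod card_ord lee_fin -[leLHS]mulr_natl natrM expr2.
apply: lee_sum => -[j k] _.
have E0 : 0 <= E by exact: expR_ge0.
case: (eqVneq j k) => [->|jk].
  apply: (@le_trans _ _ (2 * E)%:E); last by rewrite lee_fin ler_wpM2r// ler_nat.
  apply: le_trans (tail (fun l => (l == k)%:R) _).
    apply: le_measure; rewrite ?inE; [exact: mbad|exact: mtail|].
    move=> w; rewrite /bad /= eqxx mulr1n mulr1 => /ltW/le_trans; apply.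
    rewrite le_eqVlt; apply/orP; left; apply/eqP; congr `|_|; rewrite /quad_dev sumrB.
    congr (_ - _); last by rewrite sumr_const card_ord.
    by apply: eq_bigr => i _; rewrite lincomb_delta expr2.
  rewrite (bigD1 k)//= eqxx expr1n big1 ?addr0// => i /negbTE ->.
  by rewrite expr0n.
(* Polarization: 2 x_j x_k = <u_1, x>^2 - <u_{-1}, x>^2 for u_c = (e_j + c e_k) / sqrt 2. *)
pose io : R := (Num.sqrt 2)^-1.
have io2 : io ^+ 2 = 2^-1 by rewrite exprVn sqr_sqrtr.
pose up (c : R) (i : 'I_p) : R := io * ((i == j)%:R + c * (i == k)%:R).
have up1 (c : R) : c ^+ 2 = 1 -> \sum_(i < p) up c i ^+ 2 = 1.
  move=> c2; rewrite (bigD1 j)//= (bigD1 k)/=; last by rewrite eq_sym.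
  rewrite big1 ?addr0; last first.
    by move=> i /andP[/negbTE ij /negbTE ik]; rewrite /up ij ik mulr0 addr0 mulr0 expr0n.
  rewrite /up !eqxx (negbTE jk) eq_sym (negbTE jk) !mulr1n !mulr0n mulr0 addr0 add0r !mulr1 exprMn
    io2 c2 mulr1.
  by lra.
have upE (c : R) w i : lincomb (up c) (row i (X w)) = io * (X w i j + c * X w i k).
  rewrite -(lincomb_delta X j) -(lincomb_delta X k) /lincomb [c * _]mulr_sumr -big_split mulr_sumr.
  by apply: eq_bigr => a _; rewrite /up /=; ring.
apply: (@le_trans _ _ (P ([set w | (n%:R * t <= `|quad_dev X (up 1) w|)%R] `|`
    [set w | (n%:R * t <= `|quad_dev X (up (-1)) w|)%R]))).
  apply: le_measure; rewrite ?inE; [exact: mbad|by apply: measurableU; exact: mtail|].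
  move=> w; rewrite /bad /= (negbTE jk) mulr0n mulr0 subr0 => h.
  case: (leP (n%:R * t) `|quad_dev X (up 1) w|) => h1; first by left.
  case: (leP (n%:R * t) `|quad_dev X (up (-1)) w|) => h2; first by right.
  exfalso; move: h; apply/negP; rewrite -leNgt.
  have -> : \sum_i X w i j * X w i k = (quad_dev X (up 1) w - quad_dev X (up (-1)) w) / 2.
    rewrite /quad_dev -sumrB mulr_suml; apply: eq_bigr => i _.
    by rewrite !upE !exprMn io2; field.
  move: h1 h2; rewrite !ltr_norml => /andP[h1 h2] /andP[h3 h4].
  by rewrite ler_norml; lra.
apply: (le_trans (measureU2 _ _ _)) => //.
have -> : 4 * E = 2 * E + 2 * E by ring.
rewrite EFinD; apply: leeD; apply: tail; apply: up1; ring.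
Qed.

(** * Conditioning on the design *)

Lemma measurable_fst_coord (R : realType) n p (i : 'I_n) :
  measurable_fun setT (fun z : Borel ('cV[R]_n * 'M[R]_(n, p))%type => z.1 i ord0).
Proof.
apply: (@measurability _ _ (Borel ('cV[R]_n * 'M[R]_(n, p))%type) (measurableTypeR R) _ _ _
  (RGenOpens.measurableE R)).
move=> _ [_ [a [b ->]] <-]; rewrite setTI; apply: sub_sigma_algebra.
apply: (@open_comp _ _ (fun z : ('cV[R]_n * 'M[R]_(n, p))%type => z.1 i ord0)) => [z _|];
  last exact: interval_open.
apply: (@continuous_comp _ _ _ (fst : ('cV[R]_n * 'M[R]_(n, p))%type -> 'cV[R]_n) (fun x : 'cV[R]_n
  => x i ord0)).
  exact: cvg_fst.
exact: coord_continuous.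
Qed.

Lemma measurable_snd_coord (R : realType) n p (i : 'I_n) (j : 'I_p) :
  measurable_fun setT (fun z : Borel ('cV[R]_n * 'M[R]_(n, p))%type => z.2 i j).
Proof.
apply: (@measurability _ _ (Borel ('cV[R]_n * 'M[R]_(n, p))%type) (measurableTypeR R) _ _ _
  (RGenOpens.measurableE R)).
move=> _ [_ [a [b ->]] <-]; rewrite setTI; apply: sub_sigma_algebra.
apply: (@open_comp _ _ (fun z : ('cV[R]_n * 'M[R]_(n, p))%type => z.2 i j)) => [z _|];
  last exact: interval_open.
apply: (@continuous_comp _ _ _ (snd : ('cV[R]_n * 'M[R]_(n, p))%type -> 'M[R]_(n, p)) (fun x :
  'M[R]_(n, p) => x i j)).
  exact: cvg_snd.
exact: coord_continuous.
Qed.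

Lemma measurable_observation (R : realType) n p (b : 'cV[R]_p) :
  measurable_fun setT ((fun z => (z.2 *m b + z.1, z.2)) :
    Borel ('cV[R]_n * 'M[R]_(n, p))%type -> Borel ('cV[R]_n * 'M[R]_(n, p))%type).
Proof.
apply: measurable_fun_Borel_mx2 => i j; last exact: measurable_snd_coord.
rewrite (_ : (fun z => _) = (fun z : ('cV[R]_n * 'M[R]_(n, p))%type =>
   \sum_k z.2 i k * b k ord0 + z.1 i ord0)); last first.
  by apply/funext => z; rewrite !mxE (ord1 j).
apply: measurable_funD; last exact: measurable_fst_coord.
apply: measurable_sum => k; apply: measurable_funM => //; exact: measurable_snd_coord.
Qed.

Section NoiseLaw.
Context {R : realType} d (Om : measurableType d) (P : probability Om R) {n p : nat}.
Context (X : Om -> 'M[R]_(n, p)) (eps : Om -> 'cV[R]_n).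
Hypotheses (rX : random_matrix X) (hXe : std_gaussian_indep P X eps).
Local Notation Z := ('cV[R]_n * 'M[R]_(n, p))%type.

Definition product_boxes : set (set Z) :=
  [set A | exists C : set 'M[R]_(n, p), exists2 B : 'I_n -> set R,
     borel C /\ (forall i, measurable (B i)) &
     A = [set z : Z | C z.2 /\ forall i, B i (z.1 i ord0)]].

Lemma product_boxes_setI : setI_closed product_boxes.
Proof.
move=> _ _ [C [B [bC mB] ->]] [C' [B' [bC' mB'] ->]].
exists (C `&` C'), (fun i => B i `&` B' i).
  split; first exact: (@measurableI _ (Borel 'M[R]_(n, p)) _ _ bC bC').
  by move=> i; exact: measurableI.
apply/seteqP; split => z /=.
  by move=> [[c b] [c' b']]; do !split => //.
by move=> [[c c'] b]; split; split => // i; case: (b i).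
Qed.

Lemma product_boxes_setT : product_boxes setT.
Proof.
exists setT, (fun=> setT); last by apply/seteqP; split.
by split => //; exact: (@measurableT _ (Borel 'M[R]_(n, p))).
Qed.

Lemma measurable_fun_product_boxes (f : Borel Z -> \bar R) : measurable_fun setT f ->
  measurable_fun setT (f : g_sigma_algebraType product_boxes -> \bar R).
Proof.
move=> mf.
have mi : measurable_fun setT ((fun z => (z.1, z.2)) : g_sigma_algebraType product_boxes -> Borel Z).
  apply: measurable_fun_Borel_mx2 => i j _ B mB; rewrite setTI; apply: sub_sigma_algebra.
    exists setT, (fun i' => if i' == i then B else setT).
      split; first exact: (@measurableT _ (Borel 'M[R]_(n, p))).
      by move=> i'; case: ifP.
    apply/seteqP; split => z /=.
      by rewrite (ord1 j) => h; split => // i'; case: eqP => // ->.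
    by move=> [_ /(_ i)]; rewrite eqxx (ord1 j).
  exists [set x | B (x i j)], (fun=> setT).
    split => //; have := @measurable_coord R n p i j measurableT B mB; by rewrite setTI.
  by apply/seteqP; split => z /=; [split|case].
have fE : f = (fun z => f (z.1, z.2)) by apply/funext => -[].
rewrite fE; exact: (measurableT_comp mf mi).
Qed.

(** With mu the law of [eps], independence makes the law of (eps, X) the image of the product of P
    and mu, so the noise can be integrated out with the design frozen at [X w]. *)
Lemma noise_law : exists2 mu : probability (Borel 'cV[R]_n) R, std_normal_vec mu &
  forall f : Borel Z -> \bar R, measurable_fun setT f -> (forall z, 0 <= f z)%E ->
  measurable_fun setT (fun w => \int[mu]_e f (e, X w))%E /\
  (\int[P]_w f (eps w, X w) = \int[P]_w \int[mu]_e f (e, X w))%E.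
Proof.
have [meps hbox] := hXe.
have me : measurable_fun setT (eps : Om -> Borel 'cV[R]_n).
  by apply: measurable_fun_Borel_mx => i j; rewrite (ord1 j).
have mX := measurable_random_matrix rX.
have mXij i j := measurable_random_entry rX i j.
pose ef : {mfun Om >-> Borel 'cV[R]_n} := mfun_Sub (mem_set me).
have efE : (ef : Om -> 'cV[R]_n) = eps by [].
have muE (A : set (Borel 'cV[R]_n)) : distribution P ef A = P (eps @^-1` A) by [].
exists (distribution P ef).
  move=> B mB.
  transitivity (P (eps @^-1` [set e : 'cV[R]_n | forall i, B i (e i ord0)])) => //.
  have := hbox setT B (@measurableT _ (Borel 'M[R]_(n, p))) mB.
  rewrite preimage_setT probability_setT mul1e => <-.
  by congr (P _); apply/seteqP; split => w /=; [split|case].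
move=> f mf f0.
have mF2 : measurable_fun setT ((fun we => (we.2, X we.1)) : (Om * Borel 'cV[R]_n)%type -> Borel Z).
  apply: measurable_fun_Borel_mx2 => i j.
    exact: (measurableT_comp (measurable_coord i j) measurable_snd).
  exact: (measurableT_comp (mXij i j) measurable_fst).
split.
  apply: (@measurable_fun_fubini_tonelli_F _ _ Om (Borel 'cV[R]_n) R (distribution P ef) (fun we =>
    f (we.2, X we.1))) => //.
  exact: measurableT_comp mf mF2.
have mF1 : measurable_fun setT ((fun w => (eps w, X w)) : Om -> Borel Z).
  by apply: measurable_fun_Borel_mx2 => i j //; rewrite (ord1 j).
have mbox (A : set Z) : product_boxes A -> measurable (A : set (Borel Z)).
  move=> [C [B [bC mB] ->]].
  rewrite [X in measurable X](_ : _ = (snd : Z -> 'M[R]_(n, p)) @^-1` C `&`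
    (fst : Z -> 'cV[R]_n) @^-1` [set e : 'cV[R]_n | forall i, B i (e i ord0)]) //.
  apply: measurableI.
    have ms : measurable_fun setT (snd : Borel Z -> Borel 'M[R]_(n, p)).
      by apply: measurable_fun_Borel_mx => i j; exact: measurable_snd_coord.
    by have := ms measurableT C bC; rewrite setTI.
  have ms : measurable_fun setT (fst : Borel Z -> Borel 'cV[R]_n).
    by apply: measurable_fun_Borel_mx => i j; rewrite (ord1 j); exact: measurable_fst_coord.
  have := ms measurableT [set e : 'cV[R]_n | forall i, B i (e i ord0)].
  by rewrite setTI; apply; apply: measurable_boxes; exists B.
rewrite (@eq_integral_pi_system _ _ _ Om (Om * Borel 'cV[R]_n)%type P (P \x distribution P ef)%E
  _ product_boxes (fun w => (eps w, X w)) (fun we => (we.2, X we.1)) f) //=.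
- rewrite fubini_tonelli1//; exact: measurableT_comp mf mF2.
- by rewrite probability_setT ltry.
- exact: product_boxes_setI.
- exact: product_boxes_setT.
- by move=> A /mbox mA; have := mF1 measurableT A mA; rewrite setTI.
- by move=> A /mbox mA; have := mF2 measurableT A mA; rewrite setTI.
- move=> _ [C [B [bC mB] ->]].
  transitivity (P [set w | C (X w) /\ forall i, B i (eps w i ord0)]) => //.
  rewrite hbox//.
  transitivity ((P \x distribution P ef)%E ((X @^-1` C) `*` [set e : Borel 'cV[R]_n | forall i, B i
    (e i ord0)])).
    have mbx : measurable ([set e : 'cV[R]_n | forall i, B i (e i ord0)] : set (Borel 'cV[R]_n)).
      by apply: measurable_boxes; exists B.
    rewrite product_measure1E //; last exact: rX.
    congr (_ * _)%E.
    transitivity (P (eps @^-1` [set e : 'cV[R]_n | forall i, B i (e i ord0)])) => //.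
    have := hbox setT B (@measurableT _ (Borel 'M[R]_(n, p))) mB.
    rewrite preimage_setT probability_setT mul1e => <-.
    by congr (P _); apply/seteqP; split => w /=; [case|split].
  by congr ((P \x distribution P ef)%E _); apply/seteqP; split => -[w e].
- exact: measurable_fun_product_boxes.
Qed.

End NoiseLaw.

Lemma integral_indicT d (T : measurableType d) (R : realType) (mu : {measure set T -> \bar R})
    (A : set T) : measurable A -> (\int[mu]_x (\1_A x)%:E = mu A)%E.
Proof. by move=> mA; rewrite integral_indic// setIT. Qed.

(** * Normalized columns and the maximum test *)

Section Columns.
Context {R : realType} {n p : nat}.
Local Notation Z := ('cV[R]_n * 'M[R]_(n, p))%type.

Definition scaled_col (x : 'M[R]_(n, p)) (j : 'I_p) : 'cV[R]_n :=
  (Num.sqrt n%:R)^-1 *: col j x.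

Lemma dot_scaled_col (x : 'M[R]_(n, p)) j k :
  dot (scaled_col x j) (scaled_col x k) = n%:R^-1 * \sum_i x i j * x i k.
Proof.
rewrite /scaled_col dotZl dotZr mulrA -invfM -expr2 sqr_sqrtr//; congr (_ * _).
by apply: eq_bigr => i _; rewrite !mxE.
Qed.

Lemma mulmx_scaled_col (x : 'M[R]_(n, p)) (b : 'cV[R]_p) : (0 < n)%N ->
  x *m b = \sum_j (Num.sqrt n%:R * b j ord0) *: scaled_col x j.
Proof.
move=> n0; have sn : Num.sqrt n%:R != 0 :> R by rewrite sqrtr_eq0 -ltNge ltr0n.
apply/matrixP => i k; rewrite !mxE summxE (ord1 k); apply: eq_bigr => j _.
by rewrite !mxE mulrACA mulfV// mul1r mulrC.
Qed.

Definition detections (t : R) : set (Borel Z) :=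
  [set z | exists j, t <= `|dot (scaled_col z.2 j) z.1|].

Lemma measurable_detections t : measurable (detections t).
Proof.
apply: (@measurable_finex _ (Borel Z) _ (fun j => [set z | t <= `|dot (scaled_col z.2 j) z.1|])) => j.
have mf : measurable_fun setT (fun z : Borel Z => `|dot (scaled_col z.2 j) z.1|).
  apply: measurableT_comp => //; apply: measurable_sum => i.
  apply: measurable_funM; last exact: measurable_fst_coord.
  rewrite (_ : (fun z => _) = (fun z : Borel Z => (Num.sqrt n%:R)^-1 * z.2 i j)).
    by apply: measurable_funM => //; exact: measurable_snd_coord.
  by apply/funext => z; rewrite !mxE.
rewrite (_ : [set z | _] = setT `&` (fun z : Borel Z => `|dot (scaled_col z.2 j) z.1|) @^-1` `[t,
  +oo[%classic).
  exact: mf.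
by rewrite setTI; apply/seteqP; split => z /=; rewrite in_itv/= andbT.
Qed.

Definition max_test (t : R) (z : Z) : R := \1_(detections t) z.

Lemma max_test_is_test t : is_test (max_test t).
Proof.
split.
  by move=> z; rewrite /max_test indicE; case: (_ \in _) => /=; rewrite ?ler01 ?lexx.
move=> B mB.
have mT : measurable_fun setT (max_test t : Borel Z -> R).
  by apply: measurable_indic; exact: measurable_detections.
by have := mT measurableT B mB; rewrite setTI.
Qed.

End Columns.

(** * From fixed designs to the risk *)

Section RiskBounds.
Context {R : realType}.

Definition gram_bad {d} {Om : measurableType d} {n p : nat} (X : Om -> 'M[R]_(n, p)) (del : R) :
  set Om :=
  [set w | exists jk : 'I_p * 'I_p,
      n%:R * del < `|\sum_i X w i jk.1 * X w i jk.2 - n%:R * (jk.1 == jk.2)%:R|].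

Section Fixed.
Context d (Om : measurableType d) (P : probability Om R) {n p : nat}.
Context (X : Om -> 'M[R]_(n, p)) (eps : Om -> 'cV[R]_n).
Hypotheses (rX : random_matrix X) (hXe : std_gaussian_indep P X eps) (n0 : (0 < n)%N).
Local Notation Z := ('cV[R]_n * 'M[R]_(n, p))%type.

Lemma measurable_gram_bad del : measurable (gram_bad X del).
Proof.
apply: (@measurable_finex _ Om _ (fun jk : 'I_p * 'I_p => [set w |
  n%:R * del < `|\sum_i X w i jk.1 * X w i jk.2 - n%:R * (jk.1 == jk.2)%:R|])) => jk.
have mf : measurable_fun setT (fun w => `|\sum_i X w i jk.1 * X w i jk.2 - n%:R * (jk.1 == jk.2)%:R|).
  apply: measurableT_comp => //; apply: measurable_funB => //; apply: measurable_sum => i.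
  by apply: measurable_funM; exact: measurable_random_entry.
rewrite (_ : [set w | _] = setT `&` (fun w => `|\sum_i X w i jk.1 * X w i jk.2 - n%:R * (jk.1 ==
  jk.2)%:R|) @^-1` `]n%:R * del, +oo[%classic).
  exact: mf.
by rewrite setTI; apply/seteqP; split => z /=; rewrite in_itv/= andbT.
Qed.

Lemma near_orthonormal_cols del w j k : ~ gram_bad X del w ->
  `|dot (scaled_col (X w) j) (scaled_col (X w) k) - (j == k)%:R| <= del.
Proof.
have nn : 0 < n%:R :> R by rewrite ltr0n.
move=> h; rewrite leNgt; apply/negP => h1; apply: h; exists (j, k) => /=.
move: h1; rewrite dot_scaled_col -(ltr_pM2l nn); congr (_ < _).
rewrite -[X in X * `|_| = _](ger0_norm (ltW nn)) -normrM; congr `|_|.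
by field; rewrite gt_eqF.
Qed.

(** A conditional probability is at most 1, so the bad designs add no more than their own
    probability. *)
Lemma average_le del (g : Om -> \bar R) (c r : R) : measurable_fun setT g ->
  (forall w, 0 <= g w <= 1)%E -> 0 <= c -> (forall w, ~ gram_bad X del w -> g w <= c%:E)%E ->
  (P (gram_bad X del) <= r%:E)%E -> (\int[P]_w g w <= (c + r)%:E)%E.
Proof.
move=> mg g01 c0 gc Pr; have mb := measurable_gram_bad del.
apply: (@le_trans _ _ (\int[P]_w (cst c%:E w + (\1_(gram_bad X del) w)%:E))%E).
  apply: ge0_le_integral => //.
  - by move=> w _; case/andP: (g01 w).
  - by apply: emeasurable_funD => //; apply/measurable_EFinP; exact: measurable_indic.
  move=> w _; rewrite indicE /=; case: (boolP (w \in _)) => [_|/negP].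
    by rewrite (le_trans (y := 1%E))//; [case/andP: (g01 w)|rewrite -EFinD lee_fin /=; lra].
  by rewrite in_setE => h; rewrite adde0; exact: gc.
rewrite ge0_integralD//; last by apply/measurable_EFinP; exact: measurable_indic.
rewrite integral_indic// setIT EFinD; apply: leeD => //.
rewrite (_ : (\int[P]_x cst c%:E x = c%:E)%E)//.
transitivity (c%:E * P setT)%E; first exact: (integral_cst P measurableT c%:E).
by rewrite (@probability_setT _ _ R P) mule1.
Qed.

Lemma average_ge del (g : Om -> \bar R) (c r : R) : measurable_fun setT g ->
  (forall w, 0 <= g w)%E -> 0 <= c <= 1 -> (forall w, ~ gram_bad X del w -> c%:E <= g w)%E ->
  (P (gram_bad X del) <= r%:E)%E -> ((c - r)%:E <= \int[P]_w g w)%E.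
Proof.
move=> mg g0 /andP[c0 c1] gc Pr; have mb := measurable_gram_bad del.
have mi : measurable_fun setT (fun w => (\1_(~` gram_bad X del) w)%:E : \bar R).
  by apply/measurable_EFinP; apply: measurable_indic; exact: measurableC.
apply: (@le_trans _ _ (\int[P]_w (c%:E * (\1_(~` gram_bad X del) w)%:E))%E); last first.
  apply: ge0_le_integral => //.
  - by move=> w _; rewrite mule_ge0// lee_fin.
  - exact: measurable_funeM.
  move=> w _; rewrite indicE /=; case: (boolP (w \in _)) => [|_].
    by rewrite in_setE mule1 => h; exact: gc.
  by rewrite mule0.
rewrite ge0_integralZl// integral_indic ?setIT//; last exact: measurableC.
rewrite [X in (_ * X)%E](_ : _ = (1 - P (gram_bad X del))%E); last exact: probability_setC.
pose m := fine (P (gram_bad X del)).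
have mE : P (gram_bad X del) = m%:E by rewrite fineK// fin_num_measure.
have m0 : 0 <= m by rewrite fine_ge0.
rewrite mE lee_fin in Pr; rewrite mE -EFinB -EFinM lee_fin.
nra.
Qed.

Lemma Ebeta_fubini : exists2 mu : probability (Borel 'cV[R]_n) R, std_normal_vec mu &
  forall (b : 'cV[R]_p) (f : Borel Z -> R), measurable_fun setT f -> (forall z, 0 <= f z) ->
  measurable_fun setT (fun w => \int[mu]_e (f (X w *m b + e, X w))%:E)%E /\
  Ebeta P X eps b f = (\int[P]_w \int[mu]_e (f (X w *m b + e, X w))%:E)%E.
Proof.
have [mu hmu hf] := noise_law rX hXe; exists mu => // b f mf f0.
apply: (hf (fun z => (f (z.2 *m b + z.1, z.2))%:E)) => [|z]; last by rewrite lee_fin.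
apply/measurable_EFinP; exact: (measurableT_comp mf (measurable_observation b)).
Qed.

End Fixed.

(** The constants of [missed_detection] do not depend on the signal, so the supremum over signals
    costs nothing. Each type of error loses e for a good design and r for the bad ones. *)
Lemma risk_upper s (e : R) : 0 < e -> exists2 kap : R, 0 < kap & exists K : R,
  forall d (Om : measurableType d) (P : probability Om R) n p
    (X : Om -> 'M[R]_(n, p)) (eps : Om -> 'cV[R]_n) (a del r : R),
  random_matrix X -> std_gaussian_indep P X eps -> (0 < n)%N ->
  K <= a -> p%:R <= expR (a ^+ 2 / 2) -> 0 <= del -> del * a ^+ 2 <= kap ->
  (P (gram_bad X del) <= r%:E)%E ->
  (Risk P X eps s (a / Num.sqrt n%:R) <= (2^-1 ^+ s + e + e + r + r)%:E)%E.
Proof.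
move=> e0; have [K1 hfa] := false_alarm e0; have [kap2 kap20 [K2 hmd]] := missed_detection s e0.
(* It serves as margin and as bound on del a^2: eta <= 1 gives eta <= a and del a^2 <= 1 for
   [false_alarm]. *)
pose eta := Num.min kap2 1.
have eta0 : 0 < eta by rewrite lt_min kap20 ltr01.
have eta1 : eta <= 1 by rewrite ge_min lexx orbT.
have etak : eta <= kap2 by rewrite ge_min lexx.
exists eta => //; exists (Num.max 1 (Num.max K2 (K1 / eta))).
move=> d Om P n p X eps a del r rX hXe n0; rewrite !ge_max => /and3P[a1 aK2 aK1] pa del0 dela Pr.
have sn : 0 < Num.sqrt n%:R :> R by rewrite sqrtr_gt0 ltr0n.
have {}aK1 : K1 <= a * eta by rewrite -ler_pdivrMr.
have [mu hmu hE] := Ebeta_fubini rX hXe.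
have mT : measurable_fun setT (max_test (a + eta) : Borel ('cV[R]_n * 'M[R]_(n, p))%type -> R).
  by apply: measurable_indic; exact: measurable_detections.
have [T01 _] := @max_test_is_test R n p (a + eta).
have T0 (z : 'cV[R]_n * 'M[R]_(n, p)) : 0 <= max_test (a + eta) z by case/andP: (T01 z).
have T1 (z : 'cV[R]_n * 'M[R]_(n, p)) : 0 <= 1 - max_test (a + eta) z by rewrite subr_ge0;
  case/andP: (T01 z).
have m1T : measurable_fun setT ((fun z => 1 - max_test (a + eta) z) : Borel ('cV[R]_n * 'M[R]_(n,
  p))%type -> R).
  exact: measurable_funB.
apply: le_trans; first by apply: ereal_inf_lbound; exists (max_test (a + eta)) => //;
  exact: max_test_is_test.
rewrite /RiskT (_ : 2^-1 ^+ s + e + e + r + r = (e + r) + (2^-1 ^+ s + e + r)); last by ring.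
rewrite EFinD; apply: leeD.
  have [mg ->] := hE 0 _ mT T0.
  have mx w : measurable [set x : Borel 'cV[R]_n | exists i, a + eta <= `|dot (scaled_col (X w) i) x|].
    apply: measurable_finex => i.
    by have := measurable_abs_dot_ge (scaled_col (X w) i) 0 (a + eta); under eq_set do rewrite addr0.
  have gE w : (\int[mu]_e (max_test (a + eta) (X w *m 0 + e, X w))%:E =
      mu [set x | exists i, (a + eta <= `|dot (scaled_col (X w) i) x|)%R])%E.
    rewrite -(integral_indicT _ (mx w)).
    by apply: eq_integral => x _; rewrite mulmx0 add0r.
  apply: (average_le (del := del) rX mg) => //.
  - by move=> w; rewrite gE measure_ge0 probability_le1.
  - exact: ltW.
  move=> w hw; rewrite gE; apply: (hfa n mu hmu p (scaled_col (X w)) a eta del) => //.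
  - lra.
  - by apply/andP; split; lra.
  - lra.
  move=> i; have := near_orthonormal_cols n0 i i hw; rewrite eqxx mulr1n ler_norml; lra.
apply: ge_ereal_sup => _ [b [bs bA] <-].
have [mg ->] := hE b _ m1T T1.
pose bb (j : 'I_p) := Num.sqrt n%:R * b j ord0.
have bb0 j : (bb j != 0) = (b j ord0 != 0) by rewrite mulf_eq0 negb_or gt_eqF.
have mm w : measurable [set x : Borel 'cV[R]_n | forall i,
    `|dot (scaled_col (X w) i) (x + \sum_j bb j *: scaled_col (X w) j)| < a + eta].
  by apply: measurable_finall => i; exact: measurable_abs_dot_lt.
have gE w : (\int[mu]_e (1 - max_test (a + eta) (X w *m b + e, X w))%:E =
      mu [set x | forall i, (`|dot (scaled_col (X w) i) (x + \sum_j bb j *: scaled_col (X w) j)%R|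
        < a + eta)%R])%E.
  rewrite -(integral_indicT _ (mm w)).
  apply: eq_integral => x _; congr (_%:E); rewrite /max_test !indicE.
  rewrite (_ : X w *m b + x = x + \sum_j (Num.sqrt n%:R * b j ord0) *: scaled_col (X w) j); last first.
    by rewrite mulmx_scaled_col// addrC.
  have -> : (x \in [set x : 'cV[R]_n | forall i, `|dot (scaled_col (X w) i) (x + \sum_j bb j *:
    scaled_col (X w) j)%R| < a + eta]) =
    ~~ ((x + \sum_j (Num.sqrt n%:R * b j ord0) *: scaled_col (X w) j, X w) \in detections (a + eta)).
    apply/idP/negP; rewrite !in_setE /=.
      by move=> h [j]; rewrite leNgt => /negP; apply; exact: h.
    by move=> h j; rewrite ltNge; apply/negP => h1; apply: h; exists j.
  by case: (_ \in detections _) => /=; rewrite ?mulr1n ?mulr0n ?subrr ?subr0.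
apply: (average_le (del := del) rX mg) => //.
- by move=> w; rewrite gE measure_ge0 probability_le1.
- by rewrite addr_ge0 ?exprn_ge0 ?invr_ge0 ?ltW.
move=> w hw; rewrite gE; apply: (hmd n mu hmu p (scaled_col (X w)) a eta del bb) => //.
- by rewrite ltW.
- by rewrite (le_trans dela).
- by move=> i j; exact: near_orthonormal_cols.
- by rewrite -bs; apply: eq_card => i; rewrite finset.in_set bb0; apply/idP/idP; rewrite in_setE.
move=> i; rewrite bb0 => /bA h.
by rewrite /bb normrM (ger0_norm (ltW sn)) mulrC -ler_pdivrMr.
Qed.

End RiskBounds.

(** * Signals with one spike per block of columns *)

Section BlockPrior.
Context {R : realType} {n p s q : nat} (sqp : (s * q <= p)%N).

Lemma block_index_proof (i : 'I_s) (j : 'I_q) : (i * q + j < p)%N.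
Proof.
apply: leq_trans sqp; apply: (@leq_trans (i.+1 * q)); last by rewrite leq_mul2r ltn_ord orbT.
by rewrite mulSn addnC ltn_add2r.
Qed.

Definition block_index i j : 'I_p := Ordinal (block_index_proof i j).

Lemma block_index_eq i j i' j' :
  (block_index i j == block_index i' j') = (i == i') && (j == j').
Proof.
apply/eqP/andP => [/(congr1 val)/= h|[/eqP-> /eqP->]//].
have q0 : (0 < q)%N by exact: leq_ltn_trans (leq0n j) (ltn_ord j).
have ii : i = i' :> nat.
  have := congr1 (fun m => m %/ q)%N h.
  by rewrite !divnMDl// !divn_small ?addn0// ltn_ord.
split; first exact/eqP/val_inj.
by apply/eqP/val_inj; move: h; rewrite ii => /addnI.
Qed.

Definition block_signal (A : R) (f : {ffun 'I_s -> 'I_q}) : 'cV[R]_p :=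
  \sum_i A *: delta_mx (block_index i (f i)) ord0.

Lemma block_signalE A f k :
  block_signal A f k ord0 = if [exists i, k == block_index i (f i)] then A else 0.
Proof.
rewrite summxE; case: existsP => [[i /eqP ->]|h].
  rewrite (bigD1 i)//= !mxE !eqxx mulr1 big1 ?addr0// => i' i'i.
  by rewrite !mxE block_index_eq eq_sym (negbTE i'i) mulr0.
rewrite big1// => i _; rewrite !mxE; case: eqP => [ki|_]; last by rewrite mulr0.
by case: h; exists i; rewrite ki.
Qed.

Lemma block_signal_Xi A f : 0 < A -> Xi s A (block_signal A f).
Proof.
move=> A0; split; last first.
  by move=> k; rewrite block_signalE; case: ifP; rewrite ?eqxx// gtr0_norm.
have hinj : injective (fun i => block_index i (f i)).
  by move=> i i' /eqP; rewrite block_index_eq => /andP[/eqP].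
rewrite -[RHS](card_ord s) -(card_codom hinj); apply: eq_card => k.
apply/idP/idP; rewrite in_setE /= block_signalE.
  by case: existsP => [[i /eqP->] _|]; [exact: codom_f|rewrite eqxx].
move=> /codomP[i ->]; case: existsP => [_|[]]; first by rewrite gt_eqF.
by exists i.
Qed.

Lemma mulmx_block_signal (x : 'M[R]_(n, p)) (a : R) f : (0 < n)%N ->
  x *m block_signal (a / Num.sqrt n%:R) f =
  a *: direction (fun i j => scaled_col x (block_index i j)) f.
Proof.
move=> n0; rewrite /block_signal mulmx_sumr /direction scaler_sumr.
by apply: eq_bigr => i _; rewrite -scalemxAr -colE /scaled_col scalerA.
Qed.

End BlockPrior.

Lemma average_le_sup (R : realType) (F : finType) (E : F -> \bar R) (S : \bar R) :
  (0 < #|F|)%N -> (forall f, 0 <= E f <= S)%E ->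
  ((#|F|%:R^-1)%:E * \sum_f E f <= S)%E.
Proof.
move=> F0 ES; have M0 : 0 < #|F|%:R :> R by rewrite ltr0n.
case: S ES => [S| |] ES; last 2 first.
- by rewrite leey.
- have /card_gt0P[f _] := F0; have := ES f; case: (E f) => [x| |] /andP[]//.
rewrite -(@lee_pmul2l _ #|F|%:R%:E)// muleA -EFinM divff ?gt_eqF// mul1e.
apply: (@le_trans _ _ (\sum_(f : F) S%:E)%E).
  by apply: lee_sum => f _; case/andP: (ES f).
by rewrite sumEFin sumr_const -EFinM mulr_natl.
Qed.

(** The supremum dominates the average over the prior, which is moved inside the integral over the
    design; for each good design [bayes_risk_lower] then applies to the test with X fixed. The bound
    e <= 2^-s keeps the averaged lower bound nonnegative. *)
Lemma risk_lower (R : realType) s (e : R) : (0 < s)%N -> 0 < e <= 2^-1 ^+ s ->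
  exists2 kap : R, 0 < kap & exists K : R,
  forall d (Om : measurableType d) (P : probability Om R) n p
    (X : Om -> 'M[R]_(n, p)) (eps : Om -> 'cV[R]_n) (a del r : R),
  random_matrix X -> std_gaussian_indep P X eps -> (0 < n)%N -> (s <= p)%N ->
  K <= a -> expR (a ^+ 2 / 2) <= p%:R -> 0 <= del -> del * a ^+ 2 <= kap ->
  (P (gram_bad X del) <= r%:E)%E ->
  ((2^-1 ^+ s - e - r)%:E <= Risk P X eps s (a / Num.sqrt n%:R))%E.
Proof.
move=> s0 /andP[e0 ec]; have [kap kap0 [K hb]] := bayes_risk_lower s e0.
exists kap => //; exists (Num.max 1 K).
move=> d Om P n p X eps a del r rX hXe n0 sp; rewrite ge_max => /andP[a1 aK] pa del0 dela Pr.
have sn : 0 < Num.sqrt n%:R :> R by rewrite sqrtr_gt0 ltr0n.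
(* Fewer than s columns are left out of the blocks; p < (q + 1) s <= 2 s q is the origin of the
   factor 2 in [bayes_risk_lower]. *)
pose q := (p %/ s)%N.
have q0 : (0 < q)%N by rewrite divn_gt0.
have sqp : (s * q <= p)%N by rewrite mulnC leq_trunc_div.
have pq : p%:R <= 2 * s%:R * q%:R :> R.
  rewrite -!natrM ler_nat.
  have h1 : (p < q.+1 * s)%N by rewrite -ltn_divLR.
  apply: ltnW; apply: (leq_trans h1); rewrite -mulnA [(s * q)%N]mulnC mulnA leq_mul2r.
  by rewrite mul2n -addnn -addn1 leq_add2l q0 orbT.
have [mu hmu hE] := Ebeta_fubini rX hXe.
apply: le_ereal_inf_tmp => _ [T [T01 bT] <-]; rewrite /RiskT.
have mT : measurable_fun setT (T : Borel ('cV[R]_n * 'M[R]_(n, p))%type -> R).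
  by move=> _ B mB; rewrite setTI; exact: bT.
have T0 (z : 'cV[R]_n * 'M[R]_(n, p)) : 0 <= T z by case/andP: (T01 z).
have T1 (z : 'cV[R]_n * 'M[R]_(n, p)) : 0 <= 1 - T z by rewrite subr_ge0; case/andP: (T01 z).
have m1T : measurable_fun setT ((fun z => 1 - T z) : Borel ('cV[R]_n * 'M[R]_(n, p))%type -> R).
  exact: measurable_funB.
set A := a / Num.sqrt n%:R.
have A0 : 0 < A by rewrite divr_gt0//; lra.
set S := ereal_sup _.
pose b (f : {ffun 'I_s -> 'I_q}) := block_signal sqp A f.
have cardP : #|{ffun 'I_s -> 'I_q}|%:R = q%:R ^+ s :> R by rewrite card_ffun !card_ord natrX.
have P0 : (0 < #|{ffun 'I_s -> 'I_q}|)%N by rewrite -(ltr_nat R) cardP exprn_gt0// ltr0n.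
have avg := @average_le_sup R {ffun 'I_s -> 'I_q} (fun f => Ebeta P X eps (b f) (fun z => 1 - T z)) S P0.
have {}avg : ((q%:R ^+ s)^-1%:E * \sum_(f : {ffun 'I_s -> 'I_q}) Ebeta P X eps (b f) (fun z => (1 -
  T z)%R) <= S)%E.
  rewrite -cardP; apply: avg => f; apply/andP; split.
    by apply: integral_ge0 => w _; rewrite lee_fin.
  by apply: ereal_sup_ubound; exists (b f) => //; exact: block_signal_Xi.
apply: (le_trans _ (leeD2l _ avg)).
have [mI0 ->] := hE 0 _ mT T0.
pose I0 w := (\int[mu]_e0 (T (X w *m 0 + e0, X w))%:E)%E.
pose I1 f w := (\int[mu]_e0 (1 - T (X w *m b f + e0, X w))%:E)%E.
have mI1 f : measurable_fun setT (I1 f) by have [] := hE (b f) _ m1T T1.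
have I10 f w : (0 <= I1 f w)%E by apply: integral_ge0 => x _; rewrite lee_fin.
have I00 w : (0 <= I0 w)%E by apply: integral_ge0 => x _; rewrite lee_fin.
have qs0 : 0 < q%:R ^+ s :> R by rewrite exprn_gt0// ltr0n.
have c0 : (0 <= ((q%:R ^+ s)^-1)%:E :> \bar R)%E by rewrite lee_fin invr_ge0 ltW.
have mS : measurable_fun setT (fun w => \sum_f I1 f w)%E by apply: emeasurable_sum.
have S0 w : (0 <= \sum_f I1 f w)%E by apply: sume_ge0.
have -> : (\int[P]_w I0 w + ((q%:R ^+ s)^-1)%:E * \sum_f Ebeta P X eps (b f) (fun z => (1 - T z)%R) =
   \int[P]_w (I0 w + ((q%:R ^+ s)^-1)%:E * \sum_f I1 f w))%E.
  have m2 : measurable_fun setT (fun w => ((q%:R ^+ s)^-1)%:E * \sum_f I1 f w)%E.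
    exact: measurable_funeM.
  have p2 w : [set: Om] w -> (0 <= ((q%:R ^+ s)^-1)%:E * \sum_f I1 f w)%E.
    by move=> _; rewrite mule_ge0.
  rewrite (ge0_integralD P measurableT (fun w _ => I00 w) mI0 p2 m2).
  rewrite (ge0_integralZl P measurableT mS (fun w _ => S0 w) c0).
  rewrite ge0_integral_sum//; congr (_ + _ * _)%E.
  by apply: eq_bigr => f _; have [] := hE (b f) _ m1T T1.
apply: (average_ge (del := del) rX) => //.
- by apply: emeasurable_funD => //; exact: measurable_funeM.
- by move=> w; rewrite adde_ge0// mule_ge0.
- rewrite subr_ge0 ec /= lerBlDr (le_trans (y := 1))//; last by rewrite lerDl ltW.
  by rewrite exprn_ile1// invf_le1// ler1n.
move=> w hw.
pose phi (x : Borel 'cV[R]_n) := T (x, X w).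
have mphi : measurable_fun setT phi.
  have mp : measurable_fun setT ((fun x => (x, X w)) : Borel 'cV[R]_n -> Borel ('cV[R]_n *
    'M[R]_(n, p))%type).
    by apply: measurable_fun_Borel_mx2 => i j //; exact: measurable_coord.
  exact: (measurableT_comp mT mp).
pose u (i : 'I_s) (j : 'I_q) := scaled_col (X w) (block_index sqp i j).
have uo i j i' j' : `|dot (u i j) (u i' j') - ((i == i') && (j == j'))%:R| <= del.
  by rewrite -(block_index_eq sqp); exact: near_orthonormal_cols.
have := hb n mu hmu q u a del phi aK del0 dela q0 (le_trans pa pq) uo mphi (fun x => T01 (x, X w)).
move=> /le_trans; apply; apply: leeD.
  by rewrite /I0; under [leRHS]eq_integral do rewrite mulmx0 add0r.
apply: lee_wpmul2l => //; apply: lee_sum => f _; rewrite /I1.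
under [leRHS]eq_integral => x _ do rewrite mulmx_block_signal// (addrC _ x).
exact: lexx.
Qed.

(** * Asymptotics *)

Lemma cvg_fin_ereal (R : realType) (u : nat -> \bar R) (c : R) :
  (forall e : R, 0 < e -> \forall p \near \oo, ((c - e)%:E <= u p <= (c + e)%:E)%E) ->
  u @ \oo --> c%:E.
Proof.
move=> h; apply/fine_cvgP; split.
  near=> p; have /andP[h1 h2] : ((c - 1)%:E <= u p <= (c + 1)%:E)%E by near: p; exact: h.
  by rewrite fin_numE -ltNye -ltey (lt_le_trans _ h1) ?ltNyr// (le_lt_trans h2)// ltry.
apply/cvgrPdist_le => e e0; near=> p.
have : ((c - e)%:E <= u p <= (c + e)%:E)%E by near: p; exact: h.
rewrite /=; case: (u p) => [r| |] /=; rewrite ?lee_fin; last 2 first.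
- by rewrite andbC.
- by [].
by rewrite ler_distlC.
Unshelve. all: by end_near.
Qed.

Lemma gram_bad_orth (R : realType) d (Om : measurableType d) n p (X : Om -> 'M[R]_(n, p)) del :
  Orth X -> 0 <= del -> gram_bad X del = set0.
Proof.
move=> [_ hX] del0; apply/seteqP; split => // w [[j k]] /=.
have := congr1 (fun M : 'M[R]_p => M j k) (hX w); rewrite !mxE => E.
have -> : \sum_i X w i j * X w i k = n%:R * (j == k)%:R.
  by rewrite mulr_natr -E; apply: eq_bigr => i _; rewrite mxE.
by rewrite subrr normr0 ltNge mulr_ge0.
Qed.

Section Asymptotics.
Context {R : realType}.
Local Notation amp := (fun p : nat => Num.sqrt (2 * ln p%:R) : R).

Lemma amp_near (K : R) : \forall p \near \oo, K <= amp p.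
Proof.
near=> p; have pK : expR (K ^+ 2) <= p%:R by near: p; exact: nbhs_infty_ger.
have h : K ^+ 2 <= ln p%:R.
  by rewrite -[leLHS]expRK ler_ln ?posrE ?expR_gt0// (lt_le_trans _ pK)// expR_gt0.
apply: (le_trans (ler_norm K)); rewrite -sqrtr_sqr ler_wsqrtr//.
by have := sqr_ge0 K; lra.
Unshelve. all: by end_near.
Qed.

Lemma amp_sqr p : (0 < p)%N -> amp p ^+ 2 = 2 * ln p%:R.
Proof. by move=> p0; rewrite sqr_sqrtr// mulr_ge0// ln_ge0// ler1n. Qed.

(** With t = kap / a^2 and a^4 = 4 log^2 p, the growth of n / (p log^2 p) makes rho n t^2 at least 4
    p, and exp (- 4 p) beats the p^2 of the union bound. *)
Lemma gram_bad_subG_near d (Omega : nat -> measurableType d)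
    (P : forall p, probability (Omega p) R) (n : nat -> nat)
    (X : forall p, Omega p -> 'M[R]_(n p, p)) (sigma2 kap r : R) :
  (forall p, SubG (P p) sigma2 (X p)) ->
  (fun p => ((n p)%:R / (p%:R * (ln p%:R) ^+ 2)) : R) @ \oo --> +oo ->
  0 < kap -> 0 < r ->
  \forall p \near \oo, (P p (gram_bad (X p) (kap / amp p ^+ 2)) <= r%:E)%E.
Proof.
move=> hX hn kap0 r0; have [rho rho0 ht] := gram_tail sigma2.
have M0 : 0 < rho * kap ^+ 2 by rewrite mulr_gt0// exprn_gt0.
near=> p.
have p2 : (2 <= p)%N by near: p; exact: nbhs_infty_ge.
have pr : 2 / r <= p%:R by near: p; exact: nbhs_infty_ger.
have ak : Num.max 1 kap <= amp p by near: p; exact: amp_near.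
(* One factor 4 comes from a^4 = 4 log^2 p, the other from the exponent 4 p. *)
have nK : 16 / (rho * kap ^+ 2) <= (n p)%:R / (p%:R * (ln p%:R) ^+ 2).
  by near: p; move/cvgryPge : hn; apply.
move: ak; rewrite ge_max => /andP[a1 ak].
have p0 : 0 < p%:R :> R by rewrite ltr0n (leq_trans _ p2).
have L0 : 0 < ln p%:R :> R by rewrite ln_gt0// ltr1n.
have aE : amp p ^+ 2 = 2 * ln p%:R by rewrite amp_sqr// (leq_trans _ p2).
have a20 : 0 < amp p ^+ 2 by rewrite aE mulr_gt0.
have t1 : 0 < kap / amp p ^+ 2 <= 1.
  by rewrite divr_gt0//= ler_pdivrMr// mul1r (le_trans ak)// expr2 ler_peMr//.
apply: (le_trans (ht _ _ _ _ _ _ (hX p) _ t1)); rewrite lee_fin.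
have pL0 : 0 < p%:R * ln p%:R ^+ 2 :> R by rewrite mulr_gt0// exprn_gt0.
have nt : 4 * p%:R <= rho * ((n p)%:R * (kap / amp p ^+ 2) ^+ 2).
  move: nK; rewrite ler_pdivlMr// mulrAC ler_pdivrMr// => nK.
  have -> : rho * ((n p)%:R * (kap / amp p ^+ 2) ^+ 2) =
      rho * kap ^+ 2 * (n p)%:R / (4 * ln p%:R ^+ 2).
    by rewrite aE; field; rewrite gt_eqF.
  rewrite ler_pdivlMr; last by rewrite mulr_gt0// exprn_gt0.
  by move: nK; clear; lra.
have pe : p%:R <= expR p%:R :> R by have := expR_ge1Dx (p%:R : R); lra.
(* The exponential is split so that exp (- 2 p) absorbs the union bound p^2 and the other half
   leaves 1 / (2 p). *)
have e2 : expR (- (rho * ((n p)%:R * (kap / amp p ^+ 2) ^+ 2))) <= expR (- (2 * p%:R)) * (expR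
  p%:R) ^- 2.
  rewrite -expRM_natl -expRN -expRD ler_expR; lra.
have e3 : expR (- (2 * p%:R)) <= (2 * p%:R)^-1 :> R.
  rewrite expRN lef_pV2 ?posrE ?expR_gt0// ?mulr_gt0//.
  by have := expR_ge1Dx (2 * p%:R : R); lra.
apply: (@le_trans _ _ (p%:R ^+ 2 * (4 * ((2 * p%:R)^-1 * (p%:R) ^- 2)))).
  rewrite ler_wpM2l ?sqr_ge0// ler_wpM2l// (le_trans e2)//.
  apply: ler_pM => //; rewrite ?expR_ge0 ?invr_ge0 ?exprn_ge0 ?expR_ge0//.
  by rewrite lef_pV2 ?posrE ?exprn_gt0 ?expR_gt0// lerXn2r ?nnegrE ?expR_ge0// ltW.
have -> : p%:R ^+ 2 * (4 * ((2 * p%:R)^-1 * (p%:R) ^- 2)) = 2 / p%:R :> R.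
  by field; rewrite gt_eqF.
by rewrite ler_pdivrMr// mulrC -ler_pdivrMr.
Unshelve. all: by end_near.
Qed.

End Asymptotics.

Theorem mainTheorem7 (R : realType) (d : measure_display)
  (Omega : nat -> measurableType d) (P : forall p, probability (Omega p) R)
  (n : nat -> nat)
  (X : forall p, Omega p -> 'M[R]_(n p, p))
  (eps : forall p, Omega p -> 'cV[R]_(n p))
  (s : nat) (sigma2 : R) :
  (1 <= s)%N ->
  (fun p => (n p)%:R : R) @ \oo --> +oo ->
  (forall p, std_gaussian_indep (P p) (X p) (eps p)) ->
  ((forall p, SubG (P p) sigma2 (X p)) /\
     (fun p => ((n p)%:R / (p%:R * (ln p%:R) ^+ 2)) : R) @ \oo --> +oo
   \/ (forall p, Orth (X p)) /\ (forall p, (p <= n p)%N)) ->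
  (fun p => Risk (P p) (X p) (eps p) s (Num.sqrt (2 * ln p%:R / (n p)%:R)))
    @ \oo --> (((1 / 2 : R) ^+ s)%:E).
Proof.
move=> s1 hn hXe hX.
have rX p : random_matrix (X p).
  by case: hX => [[h _]|[h _]]; case: (h p).
have bad (kap r : R) : 0 < kap -> 0 < r ->
    \forall p \near \oo, (P p (gram_bad (X p) (kap / Num.sqrt (2 * ln p%:R) ^+ 2)) <= r%:E)%E.
  move=> kap0 r0; case: hX => [[h1 h2]|[h1 _]]; first exact: (gram_bad_subG_near h1 h2).
  near=> p; rewrite gram_bad_orth//; last by rewrite divr_ge0 ?sqr_ge0// ltW.
  by rewrite measure0 lee_fin ltW.
rewrite (_ : 1 / 2 = 2^-1 :> R); last by rewrite mul1r.
apply: cvg_fin_ereal => e e0.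
(* The upper bound loses 4 e1, twice as error and twice as probability of a bad design; the lower
   bound requires e1 <= 2^-s. *)
pose e1 : R := Num.min (e / 4) (2^-1 ^+ s).
have c0 : 0 < 2^-1 ^+ s :> R by rewrite exprn_gt0// invr_gt0.
have e10 : 0 < e1 by rewrite lt_min c0 divr_gt0.
have e14 : e1 <= e / 4 by rewrite ge_min lexx.
have e1c : 0 < e1 <= 2^-1 ^+ s by rewrite e10 ge_min lexx orbT.
have [k1 k10 [K1 up]] := risk_upper s e10.
have [k2 k20 [K2 low]] := risk_lower s1 e1c.
pose kap := Num.min k1 k2.
have kap0 : 0 < kap by rewrite lt_min k10.
near=> p.
have sp : (s <= p)%N by near: p; exact: nbhs_infty_ge.
have p0 : (0 < p)%N by exact: leq_trans sp.
have aK : Num.max 1 (Num.max K1 K2) <= Num.sqrt (2 * ln p%:R) by near: p; exact: amp_near.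
have np : (0 < n p)%N.
  have : 1 <= (n p)%:R :> R by near: p; move/cvgryPge : hn; apply.
  by rewrite ler1n.
have Pr : (P p (gram_bad (X p) (kap / Num.sqrt (2 * ln p%:R) ^+ 2)) <= e1%:E)%E.
  by near: p; exact: bad.
have aE := @amp_sqr R p p0.
move: aK; rewrite !ge_max => /and3P[a1 aK1 aK2].
have pe : expR (Num.sqrt (2 * ln p%:R) ^+ 2 / 2) = p%:R :> R.
  by rewrite aE mulrC mulKf// lnK// posrE ltr0n.
have -> : Num.sqrt (2 * ln p%:R / (n p)%:R) = Num.sqrt (2 * ln p%:R) / Num.sqrt (n p)%:R :> R.
  by rewrite sqrtrM ?sqrtrV// mulr_ge0// ln_ge0// ler1n.
set a := Num.sqrt (2 * ln p%:R) in a1 aK1 aK2 pe Pr *.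
have a20 : 0 < a ^+ 2 by rewrite exprn_gt0//; lra.
have da : kap / a ^+ 2 * a ^+ 2 = kap by rewrite divfK// gt_eqF.
have d0 : 0 <= kap / a ^+ 2 by rewrite divr_ge0// ltW.
have dk1 : kap / a ^+ 2 * a ^+ 2 <= k1 by rewrite da ge_min lexx.
have dk2 : kap / a ^+ 2 * a ^+ 2 <= k2 by rewrite da ge_min lexx orbT.
apply/andP; split.
  apply: le_trans (low _ _ _ _ _ _ _ _ _ _ (rX p) (hXe p) np sp aK2 _ d0 dk2 Pr).
    by rewrite lee_fin; lra.
  by rewrite pe.
apply: (le_trans (up _ _ _ _ _ _ _ _ _ _ (rX p) (hXe p) np aK1 _ d0 dk1 Pr)).
  by rewrite pe.
by rewrite lee_fin; lra.
Unshelve. all: by end_near.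
Qed.
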